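(* Let $k\in(0,1)$, and let $k',\omega_1,\wp,e_j,\mathrm{f}_j$ be the data determined by $k$ as in the context. Put $g(u)=\wp(u)-e_3$ and $f(u)=\frac{\omega_1}{4}\wp'(u)$, and let $\Omega=(\Omega_1,\Omega_2,\Omega_3)$ be the null curve generated by osculation of the spectral curve described by $\zeta=g(u)$, $\eta=f(u)$, i.e. $$\Omega_1=\tfrac12\Big(-\tfrac12(1-g^2)\tfrac{d^2f}{dg^2}-g\tfrac{df}{dg}+f\Big),\quad \Omega_2=\tfrac{i}{2}\Big(-\tfrac12(1+g^2)\tfrac{d^2f}{dg^2}+g\tfrac{df}{dg}-f\Big),\quad \Omega_3=\tfrac12\Big(g\tfrac{d^2f}{dg^2}-\tfrac{df}{dg}\Big).$$ Then the components of this null curve with respect to $k$-monopole coordinates, namely $\Phi_1=-k\Omega_1+k'\Omega_3$, $\Phi_2=k'\Omega_1+k\Omega_3$, $\Phi_3=\Omega_2$, are $$\Phi_1(u)=-k\frac{\omega_1}{4}\,\mathrm{f}_1(2u)^3,\qquad \Phi_2(u)=k'\frac{\omega_1}{4}\,\mathrm{f}_2(2u)^3,\qquad \Phi_3(u)=-i\frac{\omega_1}{4}\,\mathrm{f}_3(2u)^3 .$$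
   Context: For $k\in(0,1)$: $k'=\sqrt{1-k^2}$, $K(k)=\int_0^{\pi/2}\frac{d\psi}{\sqrt{1-k^2\sin^2\psi}}$, $K'(k)=K(k')$, $\omega_1=2\sqrt{kk'}\,K(k)$, $\omega_2=2i\sqrt{kk'}\,K'(k)$, $\omega_3=\omega_1+\omega_2$. $\wp$ is the Weierstrass function of the lattice $\mathbb{Z}\omega_1+\mathbb{Z}\omega_2$; equivalently $(\wp')^2=4\wp^3-g_2\wp-g_3$ with $g_2=\frac{4(1-k^2+k^4)}{3k^2k'^2}$, $g_3=\frac{4(k^2-2)(k^2+1)(2k^2-1)}{27k^3k'^3}$. $e_j=\wp(\omega_j/2)$, so $e_1=\frac{2-k^2}{3kk'}$, $e_2=-\frac{1+k^2}{3kk'}$, $e_3=\frac{2k^2-1}{3kk'}$. $\mathrm{f}_j$ denotes the meromorphic square root of $\wp-e_j$ whose residue at the origin is $1$. Here $\frac{df}{dg}=f'/g'$ and $\frac{d^2f}{dg^2}=\left(\frac{df}{dg}\right)'\frac1{g'}$, where $'$ on functions is $d/du$. *)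

(* Defs.v *)
From Stdlib Require Export Reals ZArith.
From Coquelicot Require Export Coquelicot.
Open Scope R_scope.

Definition kc (k : R) : R := sqrt (1 - k ^ 2).

Definition ellK (k : R) : R :=
  RInt (fun psi => / sqrt (1 - k ^ 2 * sin psi ^ 2)) 0 (PI / 2).

Definition omega1 (k : R) : C := RtoC (2 * sqrt (k * kc k) * ellK k).

Definition omega2 (k : R) : C :=
  (Ci * RtoC (2 * sqrt (k * kc k) * ellK (kc k)))%C.

Definition omega3 (k : R) : C := (omega1 k + omega2 k)%C.

Definition in_lattice (w1 w2 z : C) : Prop :=
  exists m n : Z, z = (RtoC (IZR m) * w1 + RtoC (IZR n) * w2)%C.

(** Weierstrass function of the lattice [Z w1 + Z w2]:
    [1/z^2 + \sum_(w <> 0) (1/(z-w)^2 - 1/w^2)].  For a genuine lattice the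
    series converges absolutely, so its sum is the limit of the sums over the
    boxes [-N <= m, n <= N]; the limit is taken on real and imaginary parts. *)

Definition wp_term (w1 w2 z : C) (m n : Z) : C :=
  if (Z.eqb m 0 && Z.eqb n 0)%bool then RtoC 0
  else
    let w := (RtoC (IZR m) * w1 + RtoC (IZR n) * w2)%C in
    (/ (z - w) ^ 2 - / w ^ 2)%C.

(* [sum_n a p] has the p+1 terms a 0, ..., a p. *)
Definition wp_box (w1 w2 z : C) (N : nat) : C :=
  sum_n (fun i => sum_n (fun j =>
    wp_term w1 w2 z (Z.of_nat i - Z.of_nat N) (Z.of_nat j - Z.of_nat N))
    (2 * N)) (2 * N).

Definition wp (w1 w2 z : C) : C :=
  (/ z ^ 2 + (real (Lim_seq (fun N => Re (wp_box w1 w2 z N))),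
              real (Lim_seq (fun N => Im (wp_box w1 w2 z N)))))%C.

Definition wpk (k : R) : C -> C := wp (omega1 k) (omega2 k).

Definition e1 (k : R) : C := wpk k (omega1 k / 2)%C.
Definition e2 (k : R) : C := wpk k (omega2 k / 2)%C.
Definition e3 (k : R) : C := wpk k (omega3 k / 2)%C.

(** Meromorphic functions are represented by total functions [C -> C] whose
    values at the poles are irrelevant. *)

(* Near a (except at a), F z = h z + \sum_(j <= N) c j / (z - a)^(j+1)
   with h holomorphic; the coefficients c j are allowed to vanish. *)
Definition laurent_at (F : C -> C) (a : C) (N : nat) (c : nat -> C)
    (h : C -> C) : Prop :=
  locally a (fun z => ex_derive h z) /\
  locally a (fun z => z <> a ->
    F z = (h z + sum_n (fun j => c j / (z - a) ^ (S j)) N)%C).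

Definition meromorphic_at (F : C -> C) (a : C) : Prop :=
  exists N c h, laurent_at F a N c h.

Definition has_residue (F : C -> C) (a r : C) : Prop :=
  exists N c h, laurent_at F a N c h /\ c 0%nat = r.

(* F is the meromorphic square root of [wp - e] with residue 1 at the origin;
   its poles lie in the lattice, off which its values are the honest
   (holomorphic) ones. *)
Definition is_wp_root (k : R) (e : C) (F : C -> C) : Prop :=
  (forall a, meromorphic_at F a) /\
  (forall z, ~ in_lattice (omega1 k) (omega2 k) z ->
     ex_derive F z /\ (F z ^ 2)%C = (wpk k z - e)%C) /\
  has_residue F (RtoC 0) (RtoC 1).

(** [dd f g] and [dd2 f g] are df/dg and d^2f/dg^2 along a common parameter u.
    [C_derive] is total (a limit along the real direction) and is the complex
    derivative wherever the latter exists. *)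

Definition dd (f g : C -> C) (u : C) : C := (C_derive f u / C_derive g u)%C.

Definition dd2 (f g : C -> C) : C -> C := dd (dd f g) g.

(** Null curve generated by osculation of [zeta = g u, eta = f u]; the [Phi]s
    are its components in k-monopole coordinates. *)

Definition Omega1 (g f : C -> C) (u : C) : C :=
  (/ 2 * (- / 2 * (1 - g u ^ 2) * dd2 f g u - g u * dd f g u + f u))%C.

Definition Omega2 (g f : C -> C) (u : C) : C :=
  (Ci / 2 * (- / 2 * (1 + g u ^ 2) * dd2 f g u + g u * dd f g u - f u))%C.

Definition Omega3 (g f : C -> C) (u : C) : C :=
  (/ 2 * (g u * dd2 f g u - dd f g u))%C.

Definition Phi1 (k : R) (g f : C -> C) (u : C) : C :=
  (- RtoC k * Omega1 g f u + RtoC (kc k) * Omega3 g f u)%C.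

Definition Phi2 (k : R) (g f : C -> C) (u : C) : C :=
  (RtoC (kc k) * Omega1 g f u + RtoC k * Omega3 g f u)%C.

Definition Phi3 (g f : C -> C) (u : C) : C := Omega2 g f u.

Definition gk (k : R) (u : C) : C := (wpk k u - e3 k)%C.

Definition fk (k : R) (u : C) : C := (omega1 k / 4 * C_derive (wpk k) u)%C.

(* Main.v *)
Require Import Defs.
From Stdlib Require Import Lra Lia Psatz List Permutation Classical.
Import ListNotations.

(* The differential equation of the Weierstrass function p is obtained without
   Liouville's theorem, by Eisenstein's method: summing the partial fraction
   identity 1/(p^2 q^2) = (1/p^2 + 1/q^2)/(p+q)^2 + 2 (1/p + 1/q)/(p+q)^3 over
   pairs of lattice points in a large box shows that p^2 - p''/6 is constant, the
   boundary contributions tending to 0.  The values e_j are distinct, translation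
   by a half-period acts as (p(u) - e_j)(p(u + w_j/2) - e_j) = const, and
   p(2u) = (p''/(2p'))^2 - 2 p(u): in each case the difference of the two sides
   solves a homogeneous linear system along paths avoiding the poles and vanishes
   at a starting point.  Hence p(2u) - e_j is the square of
   -((p - e_j)^2 - (e_j - e_i)(e_j - e_l)) / p', and the residue fixes the sign, so
   that this quotient is f_j(2u).

   The modulus enters through e_1 - e_3 = k'/k and e_3 - e_2 = k/k'.  Inverting p
   on the two axes expresses the half-periods by K(kappa) and K(kappa') with
   kappa^2 = (e_3 - e_2)/(e_1 - e_2); comparison with the given periods and the
   monotonicity of K'/K force kappa = k.  The formulas for the null curve are then
   identities of rational functions in p - e_3 and p'. *)

(** * Complex limits and derivatives *)

(** Two obstacles shape the argument. The first is that the sum of 1/(z-w)^2 over the lattice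
    converges only conditionally. Rearranging a double sum is therefore done over finite boxes, and
    the error sits near the boundary of the box, where a translated box sticks out of the original
    one; its smallness has to be earned by a weighted sum over shells. The second is how to pass
    from a local differential identity to a global one. Uniqueness for linear differential systems
    on a segment does this, and a rectangular grid leaves enough free horizontal and vertical lines
    to reach every point off it. The starting points are half-periods or quarter-periods, where
    parity and periodicity force the values. The e_j are values of lattice sums, tied to k only
    through the periods, so their differences have to be recovered from elliptic integrals. A
    rectangular lattice is invariant under conjugation, which makes p real on both axes and turns
    this recovery into real analysis on an interval running from the pole to a half-period. *)

Definition cvg {T} (F : (T -> Prop) -> Prop) (f : T -> C) (l : C) : Prop :=
  filterlim (fun t => Re (f t)) F (locally (Re l)) /\
  filterlim (fun t => Im (f t)) F (locally (Im l)).

Lemma C_eq (x y : C) : Re x = Re y -> Im x = Im y -> x = y.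
Proof. destruct x, y; simpl; congruence. Qed.

Lemma Cminus_eq_0 (x y : C) : (x - y)%C = 0%C -> x = y.
Proof. intros E. replace x with (x - y + y)%C by ring. rewrite E. ring. Qed.

Lemma im_le_Cmod (c : C) : Rabs (Im c) <= Cmod c.
Proof.
  eapply Rle_trans; [apply Rmax_r | apply Rmax_Cmod].
Qed.

Lemma Cmod_le_Re_Im (c : C) : Cmod c <= Rabs (Re c) + Rabs (Im c).
Proof.
  replace c with (RtoC (Re c) + Ci * RtoC (Im c))%C at 1
    by (apply C_eq; simpl; ring).
  eapply Rle_trans; [apply Cmod_triangle |].
  rewrite Cmod_mult, !Cmod_R, Cmod_Ci. lra.
Qed.

Section Limits.
Context {T : Type} (F : (T -> Prop) -> Prop) {FF : Filter F}.

(** The componentwise form matches [wp] and [C_derive], which take limits of real and imaginary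
    parts; the form with [Cmod] is the one in which estimates are made. *)
Lemma cvg_eps (f : T -> C) (l : C) :
  cvg F f l <-> (forall eps, 0 < eps -> F (fun t => Cmod (f t - l) < eps)).
Proof.
  split.
  - intros [H1 H2] eps He.
    assert (H : F (fun t => Rabs (Re (f t) - Re l) < eps / 2 /\
                            Rabs (Im (f t) - Im l) < eps / 2)).
    { apply filter_and.
      - refine (H1 (fun x => Rabs (x - Re l) < eps / 2) _).
        exists (mkposreal (eps / 2) ltac:(lra)). intros y Hy. exact Hy.
      - refine (H2 (fun x => Rabs (x - Im l) < eps / 2) _).
        exists (mkposreal (eps / 2) ltac:(lra)). intros y Hy. exact Hy. }
    eapply filter_imp; [| exact H].
    intros t [A B]; simpl in A, B |- *.
    eapply Rle_lt_trans; [apply Cmod_le_Re_Im |].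
    change (Re (f t - l)) with (Re (f t) - Re l). change (Im (f t - l)) with (Im (f t) - Im l). lra.
  - intros H; split; intros P [d Hd].
    + refine (filter_imp (fun t => Cmod (f t - l) < d) _ _ (H d (cond_pos d))).
      intros t Ht; apply Hd.
      change (Rabs (Re (f t) - Re l) < d).
      eapply Rle_lt_trans; [| exact Ht].
      apply (re_le_Cmod (f t - l)%C).
    + refine (filter_imp (fun t => Cmod (f t - l) < d) _ _ (H d (cond_pos d))).
      intros t Ht; apply Hd.
      change (Rabs (Im (f t) - Im l) < d).
      eapply Rle_lt_trans; [| exact Ht].
      apply (im_le_Cmod (f t - l)%C).
Qed.

Lemma cvg_const (c : C) : cvg F (fun _ => c) c.
Proof. split; apply filterlim_const. Qed.

Lemma cvg_ext (f g : T -> C) (l : C) :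
  F (fun t => f t = g t) -> cvg F f l -> cvg F g l.
Proof.
  intros E [H1 H2]; split; eapply filterlim_ext_loc; try eassumption;
    (eapply filter_imp; [| exact E]); intros t <-; reflexivity.
Qed.

Lemma filterlim_Rplus (u v : T -> R) (x y : R) :
  filterlim u F (locally x) -> filterlim v F (locally y) ->
  filterlim (fun t => u t + v t) F (locally (x + y)).
Proof.
  intros A B. eapply filterlim_comp_2; [exact A | exact B |].
  apply (filterlim_plus (V := R_NormedModule)).
Qed.

Lemma filterlim_Rmult (u v : T -> R) (x y : R) :
  filterlim u F (locally x) -> filterlim v F (locally y) ->
  filterlim (fun t => u t * v t) F (locally (x * y)).
Proof.
  intros A B. eapply filterlim_comp_2; [exact A | exact B |].
  apply (filterlim_mult (K := R_AbsRing)).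
Qed.

Lemma filterlim_Ropp (u : T -> R) (x : R) :
  filterlim u F (locally x) -> filterlim (fun t => - u t) F (locally (- x)).
Proof.
  intros A. eapply filterlim_comp; [exact A |].
  apply (filterlim_opp (V := R_NormedModule)).
Qed.

Lemma cvg_plus (f g : T -> C) (l m : C) :
  cvg F f l -> cvg F g m -> cvg F (fun t => f t + g t)%C (l + m)%C.
Proof.
  intros [H1 H2] [K1 K2]; split; apply filterlim_Rplus; assumption.
Qed.

Lemma cvg_mult (f g : T -> C) (l m : C) :
  cvg F f l -> cvg F g m -> cvg F (fun t => f t * g t)%C (l * m)%C.
Proof.
  intros [H1 H2] [K1 K2].
  split; simpl.
  - apply filterlim_Rplus; [| apply filterlim_Ropp]; apply filterlim_Rmult; assumption.
  - apply filterlim_Rplus; apply filterlim_Rmult; assumption.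
Qed.

Lemma cvg_scal (c : C) (f : T -> C) (l : C) :
  cvg F f l -> cvg F (fun t => c * f t)%C (c * l)%C.
Proof. intros H; apply cvg_mult; [apply cvg_const | exact H]. Qed.

Lemma cvg_opp (f : T -> C) (l : C) :
  cvg F f l -> cvg F (fun t => - f t)%C (- l)%C.
Proof.
  intros H. replace (- l)%C with ((-1) * l)%C by ring.
  eapply cvg_ext; [| apply cvg_scal; exact H].
  apply filter_forall; intros t; ring.
Qed.

Lemma cvg_minus (f g : T -> C) (l m : C) :
  cvg F f l -> cvg F g m -> cvg F (fun t => f t - g t)%C (l - m)%C.
Proof. intros H K; apply cvg_plus; [exact H | apply cvg_opp; exact K]. Qed.

Lemma cvg_pow (f : T -> C) (l : C) (n : nat) :
  cvg F f l -> cvg F (fun t => f t ^ n)%C (l ^ n)%C.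
Proof.
  intros H; induction n as [| n IH]; simpl; [apply cvg_const |].
  apply cvg_mult; assumption.
Qed.

Lemma cvg_inv (f : T -> C) (l : C) :
  l <> 0%C -> cvg F f l -> cvg F (fun t => / f t)%C (/ l)%C.
Proof.
  intros Hl H. apply cvg_eps; intros eps He.
  assert (L := proj1 (Cmod_gt_0 l) Hl).
  pose proof (proj1 (cvg_eps f l) H) as H'.
  (* The first bound keeps [Cmod (f t)] above [Cmod l / 2]; the second then makes the quotient of
     [Cmod (f t - l)] by [Cmod (f t) * Cmod l] less than [eps]. *)
  set (d := Rmin (Cmod l / 2) (eps * Cmod l * Cmod l / 2)).
  assert (Hd : 0 < d).
  { apply Rmin_pos; [lra |]. apply Rdiv_lt_0_compat; [| lra].
    repeat apply Rmult_lt_0_compat; assumption. }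
  eapply filter_imp; [| apply (H' d Hd)].
  intros t Ht; simpl in Ht.
  assert (B : Cmod l / 2 < Cmod (f t)).
  { assert (X := Cmod_triangle (f t) (- (f t - l))%C).
    replace (f t + - (f t - l))%C with l in X by ring.
    rewrite Cmod_opp in X.
    assert (d <= Cmod l / 2) by apply Rmin_l. lra. }
  assert (N : f t <> 0%C) by (apply Cmod_gt_0; lra).
  replace (/ f t - / l)%C with (- (f t - l) / (f t * l))%C by (field; auto).
  rewrite Cmod_div by (apply Cmult_neq_0; assumption).
  rewrite Cmod_opp, Cmod_mult.
  apply Rlt_div_l; [apply Rmult_lt_0_compat; lra |].
  eapply Rlt_le_trans; [exact Ht |].
  eapply Rle_trans; [apply Rmin_r |].
  replace (eps * (Cmod (f t) * Cmod l)) with ((eps * Cmod l) * Cmod (f t)) by ring.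
  replace (eps * Cmod l * Cmod l / 2) with ((eps * Cmod l) * (Cmod l / 2)) by field.
  apply Rmult_le_compat_l; [apply Rmult_le_pos; lra | lra].
Qed.

Lemma cvg_div (f g : T -> C) (l m : C) :
  m <> 0%C -> cvg F f l -> cvg F g m -> cvg F (fun t => f t / g t)%C (l / m)%C.
Proof. intros N H K; apply cvg_mult; [exact H | apply cvg_inv; assumption]. Qed.

Lemma cvg_bound_0 (f : T -> C) (g : T -> R) (l : C) :
  F (fun t => Cmod (f t - l) <= g t) -> filterlim g F (locally 0) -> cvg F f l.
Proof.
  intros H G; apply cvg_eps; intros eps He.
  assert (G' : F (fun t => Rabs (g t) < eps)).
  { refine (G (fun x => Rabs x < eps) _). exists (mkposreal eps He). intros y Hy.
    change (Rabs (y - 0) < eps) in Hy. now rewrite Rminus_0_r in Hy. }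
  eapply filter_imp; [| exact (filter_and _ _ H G')].
  intros t [A B]; simpl in *. pose proof (Rle_abs (g t)). lra.
Qed.

End Limits.

Section ProperLimits.
Context {T : Type} (F : (T -> Prop) -> Prop) {FF : ProperFilter F}.

Lemma cvg_unique (f : T -> C) (l m : C) : cvg F f l -> cvg F f m -> l = m.
Proof.
  intros [H1 H2] [K1 K2]; apply C_eq.
  - apply (filterlim_locally_unique (V := R_NormedModule) _ _ _ H1 K1).
  - apply (filterlim_locally_unique (V := R_NormedModule) _ _ _ H2 K2).
Qed.

Lemma cvg_Cmod_le (f : T -> C) (l : C) (M : R) :
  F (fun t => Cmod (f t) <= M) -> cvg F f l -> Cmod l <= M.
Proof.
  intros H K. apply Rnot_lt_le; intros L.
  assert (K' := proj1 (cvg_eps F f l) K (Cmod l - M) ltac:(lra)).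
  destruct (filter_ex _ (filter_and _ _ H K')) as [t [A B]].
  assert (X := Cmod_triangle (f t) (- (f t - l))%C).
  replace (f t + - (f t - l))%C with l in X by ring.
  rewrite Cmod_opp in X. lra.
Qed.
End ProperLimits.

(** * Punctured neighbourhoods of 0 and complex differentiation *)

Definition at0 (P : C -> Prop) : Prop :=
  exists d, 0 < d /\ forall h : C, h <> 0%C -> Cmod h < d -> P h.

Global Instance at0_proper : ProperFilter at0.
Proof.
  constructor; [| constructor].
  - intros P [d [Hd H]]. exists (RtoC (d / 2)). apply H.
    + intros E. apply RtoC_inj in E. lra.
    + rewrite Cmod_R, Rabs_pos_eq; lra.
  - exists 1; split; [lra | auto].
  - intros P Q [d [Hd H]] [e [He K]]. exists (Rmin d e). split.
    + apply Rmin_pos; assumption.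
    + intros h N L; split; [apply H | apply K]; auto;
        (eapply Rlt_le_trans; [exact L |]); [apply Rmin_l | apply Rmin_r].
  - intros P Q I [d [Hd H]]. exists d; split; auto.
Qed.

(* Used instead of [is_derive] because Coquelicot's product rule is stated for
   the uniform structure of [C_AbsRing], not for that of [C_NormedModule]. *)
Definition hasd (f : C -> C) (z l : C) : Prop :=
  cvg at0 (fun h => (f (z + h) - f z) / h)%C l.

Definition contc (f : C -> C) (z : C) : Prop :=
  cvg at0 (fun h => f (z + h)%C) (f z).

Lemma at0_neq : at0 (fun h : C => h <> 0%C).
Proof. exists 1; split; [lra | auto]. Qed.

Lemma cvg_at0_ext (f g : C -> C) (l : C) :
  (forall h : C, h <> 0%C -> f h = g h) -> cvg at0 f l -> cvg at0 g l.
Proof.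
  intros E. apply (cvg_ext at0). refine (filter_imp _ _ _ at0_neq). exact E.
Qed.

Lemma RtoC_2_neq_0 : RtoC 2 <> RtoC 0.
Proof. intros E. apply RtoC_inj in E. lra. Qed.

Lemma at0_double (P : C -> Prop) : at0 P -> at0 (fun h => P (2 * h)%C).
Proof.
  intros [d [Hd H]]. exists (d / 2). split; [lra |]. intros h Nh Lh. apply H.
  - apply Cmult_neq_0; [exact RtoC_2_neq_0 | exact Nh].
  - rewrite Cmod_mult, Cmod_R, Rabs_pos_eq; lra.
Qed.

Lemma cvg_at0_id : cvg at0 (fun h => h) 0%C.
Proof.
  apply (cvg_eps at0).
  intros eps He. exists eps; split; [exact He |].
  intros h _ Hh. now replace (h - 0)%C with h by ring.
Qed.

Lemma hasd_cont (f : C -> C) (z l : C) : hasd f z l -> contc f z.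
Proof.
  intros H. unfold contc.
  assert (K := cvg_plus at0 _ _ _ _ (cvg_const at0 (f z)) (cvg_mult at0 _ _ _ _ cvg_at0_id H)).
  replace (f z + 0 * l)%C with (f z) in K by ring.
  eapply cvg_at0_ext; [| exact K].
  intros h Hh; simpl. field. exact Hh.
Qed.

Lemma hasd_const (c z : C) : hasd (fun _ => c) z 0%C.
Proof.
  eapply cvg_at0_ext; [| exact (cvg_const at0 _)].
  intros h Hh; simpl. field. exact Hh.
Qed.

Lemma hasd_eq (f : C -> C) (z l m : C) : hasd f z l -> l = m -> hasd f z m.
Proof. now intros H <-. Qed.

Lemma hasd_plus (f g : C -> C) (z l m : C) :
  hasd f z l -> hasd g z m -> hasd (fun u => f u + g u)%C z (l + m)%C.
Proof.
  intros H K. eapply cvg_at0_ext; [| exact (cvg_plus at0 _ _ _ _ H K)].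
  intros h Hh; simpl. field. exact Hh.
Qed.

Lemma hasd_mult (f g : C -> C) (z l m : C) :
  hasd f z l -> hasd g z m -> hasd (fun u => f u * g u)%C z (l * g z + f z * m)%C.
Proof.
  intros H K.
  eapply cvg_at0_ext;
    [| exact (cvg_plus at0 _ _ _ _ (cvg_mult at0 _ _ _ _ H (hasd_cont _ _ _ K))
                (cvg_scal at0 (f z) _ _ K))].
  intros h Hh; simpl. field. exact Hh.
Qed.

Lemma hasd_scal (c : C) (f : C -> C) (z l : C) :
  hasd f z l -> hasd (fun u => c * f u)%C z (c * l)%C.
Proof.
  intros H. eapply hasd_eq; [apply hasd_mult; [apply hasd_const | exact H] | simpl; ring].
Qed.

Lemma hasd_minus (f g : C -> C) (z l m : C) :
  hasd f z l -> hasd g z m -> hasd (fun u => f u - g u)%C z (l - m)%C.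
Proof.
  intros H K. eapply cvg_at0_ext; [| exact (cvg_minus at0 _ _ _ _ H K)].
  intros h Hh; simpl. field. exact Hh.
Qed.

Lemma hasd_inv (f : C -> C) (z l : C) :
  f z <> 0%C -> hasd f z l -> hasd (fun u => / f u)%C z (- l / (f z) ^ 2)%C.
Proof.
  intros N H.
  assert (K := hasd_cont _ _ _ H).
  assert (N' : at0 (fun h => f (z + h)%C <> 0%C)).
  { assert (X := proj1 (cvg_eps at0 _ _) K (Cmod (f z)) (proj1 (Cmod_gt_0 _) N)).
    eapply filter_imp; [| exact X]. intros h Hh E; simpl in Hh. rewrite E in Hh.
    replace (0 - f z)%C with (- f z)%C in Hh by ring. rewrite Cmod_opp in Hh. lra. }
  assert (L := cvg_div at0 _ _ _ _ (Cmult_neq_0 _ _ N N) (cvg_opp at0 _ _ H)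
    (cvg_scal at0 (f z) _ _ K)).
  replace (- l / (f z) ^ 2)%C with (- l / (f z * f z))%C by (field; auto).
  refine (cvg_ext at0 _ _ _ _ L).
  refine (filter_imp _ _ _ (filter_and _ _ at0_neq N')).
  intros h [Hh Nh]; simpl in *. field. auto.
Qed.

Lemma hasd_div (f g : C -> C) (z l m : C) :
  g z <> 0%C -> hasd f z l -> hasd g z m ->
  hasd (fun u => f u / g u)%C z ((l * g z - f z * m) / (g z) ^ 2)%C.
Proof.
  intros N H K.
  eapply hasd_eq; [apply hasd_mult; [exact H | apply hasd_inv; [exact N | exact K]] |].
  simpl. field. exact N.
Qed.

Lemma hasd_comp_affine (f : C -> C) (c d z l : C) :
  c <> 0%C -> hasd f (c * z + d)%C l -> hasd (fun u => f (c * u + d))%C z (c * l)%C.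
Proof.
  intros Nc H. apply (cvg_eps at0). intros eps He.
  assert (Lc := proj1 (Cmod_gt_0 c) Nc).
  destruct (proj1 (cvg_eps at0 _ _) H (eps / Cmod c) (Rdiv_lt_0_compat _ _ He Lc))
    as [r [Hr K]].
  exists (r / Cmod c); split; [apply Rdiv_lt_0_compat; assumption |].
  intros h Nh Lh.
  specialize (K (c * h)%C (Cmult_neq_0 _ _ Nc Nh)).
  rewrite Cmod_mult in K.
  assert (B : Cmod c * Cmod h < r).
  { apply (Rmult_lt_compat_l (Cmod c)) in Lh; [| exact Lc].
    replace (Cmod c * (r / Cmod c)) with r in Lh by (field; lra). exact Lh. }
  specialize (K B).
  replace ((f (c * (z + h) + d) - f (c * z + d)) / h - c * l)%C
    with (c * ((f (c * z + d + c * h) - f (c * z + d)) / (c * h) - l))%C.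
  2:{ replace (c * (z + h) + d)%C with (c * z + d + c * h)%C by ring. field. auto. }
  rewrite Cmod_mult. apply (Rmult_lt_compat_l (Cmod c)) in K; [| exact Lc].
  replace (Cmod c * (eps / Cmod c)) with eps in K by (field; lra). exact K.
Qed.

Lemma hasd_shift (f : C -> C) (d z l : C) :
  hasd f (z + d)%C l -> hasd (fun u => f (u + d))%C z l.
Proof.
  intros H. unfold hasd in *. eapply cvg_at0_ext; [| exact H].
  intros h _; simpl.
  now replace (z + h + d)%C with (z + d + h)%C by ring.
Qed.

Lemma hasd_ext_loc (f g : C -> C) (z l : C) :
  f z = g z -> at0 (fun h => f (z + h)%C = g (z + h)%C) -> hasd f z l -> hasd g z l.
Proof.
  intros E L H. unfold hasd in *. refine (cvg_ext at0 _ _ _ _ H).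
  refine (filter_imp _ _ _ L). intros h Eh; simpl in *. now rewrite E, Eh.
Qed.

(** A limit over all complex increments restricts to the horizontal increments along which
    [C_derive] is taken. *)
Lemma hasd_C_derive (f : C -> C) (z l : C) : hasd f z l -> C_derive f z = l.
Proof.
  intros [H1 H2]. unfold C_derive, C_lim.
  assert (A : filterlim (fun x : R => ((x, snd z) - z)%C) (Rbar_locally' (fst z)) at0).
  { intros P [d [Hd K]]. exists (mkposreal d Hd). intros x Hx Nx. apply K.
    - intros E. apply Nx.
      pose proof (f_equal Re E) as E'; simpl in E'. lra.
    - eapply Rle_lt_trans; [apply Cmod_le_Re_Im |]. simpl.
      rewrite Rplus_opp_r, Rabs_R0, Rplus_0_r. exact Hx. }
  assert (B : forall x : R, (z + ((x, snd z) - z))%C = (x, snd z)).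
  { intros x. apply C_eq; simpl; ring. }
  apply C_eq; cbn [Re Im fst snd];
    (match goal with |- real ?X = ?Y => enough (E : X = Finite Y) by (now rewrite E) end);
    apply is_lim_unique.
  - eapply filterlim_ext; [| eapply filterlim_comp; [exact A | exact H1]].
    intros x; cbv beta. now rewrite B.
  - eapply filterlim_ext; [| eapply filterlim_comp; [exact A | exact H2]].
    intros x; cbv beta. now rewrite B.
Qed.

Lemma hasd_path (f : C -> C) (p d l : C) (t : R) :
  hasd f (p + RtoC t * d)%C l ->
  is_derive (fun s : R => Re (f (p + RtoC s * d)%C)) t (Re (d * l)%C) /\
  is_derive (fun s : R => Im (f (p + RtoC s * d)%C)) t (Im (d * l)%C).
Proof.
  intros H.
  (* The affine chain rule needs a nonzero slope; on a degenerate segment the function is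
     constant. *)
  destruct (classic (d = 0%C)) as [-> | Nd].
  { assert (B : forall s : R, (p + RtoC s * 0)%C = p) by (intros s; ring).
    replace (0 * l)%C with (RtoC 0) by ring. split.
    - apply (is_derive_ext (fun _ => Re (f p))); [| exact (is_derive_const (Re (f p)) t)].
      intros s; now rewrite B.
    - apply (is_derive_ext (fun _ => Im (f p))); [| exact (is_derive_const (Im (f p)) t)].
      intros s; now rewrite B. }
  assert (H' : hasd (fun u => f (d * u + p))%C (RtoC t) (d * l)%C).
  { apply hasd_comp_affine; [exact Nd |].
    now replace (d * t + p)%C with (p + t * d)%C by ring. }
  assert (E := proj1 (cvg_eps at0 _ _) H').
  split; apply is_derive_Reals; intros eps He;
  destruct (E eps He) as [r [Hr K]]; exists (mkposreal r Hr); intros h Nh Lh;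
  specialize (K (RtoC h));
  (assert (Nh' : RtoC h <> 0%C) by (intros X; apply RtoC_inj in X; contradiction));
  specialize (K Nh'); rewrite Cmod_R in K; specialize (K Lh);
  (eapply Rle_lt_trans; [| exact K]).
  - eapply Rle_trans; [| apply re_le_Cmod]. right. f_equal.
    replace (p + RtoC (t + h) * d)%C with (d * (RtoC t + RtoC h) + p)%C
      by (rewrite RtoC_plus; ring).
    replace (p + RtoC t * d)%C with (d * RtoC t + p)%C by ring.
    unfold Cdiv. rewrite <- RtoC_inv by exact Nh.
    generalize (f (d * (RtoC t + RtoC h) + p)%C) (f (d * RtoC t + p)%C) (d * l)%C.
    intros x y v; unfold Re, Im; simpl. field. exact Nh.
  - eapply Rle_trans; [| apply im_le_Cmod]. right. f_equal.
    replace (p + RtoC (t + h) * d)%C with (d * (RtoC t + RtoC h) + p)%C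
      by (rewrite RtoC_plus; ring).
    replace (p + RtoC t * d)%C with (d * RtoC t + p)%C by ring.
    unfold Cdiv. rewrite <- RtoC_inv by exact Nh.
    generalize (f (d * (RtoC t + RtoC h) + p)%C) (f (d * RtoC t + p)%C) (d * l)%C.
    intros x y v; unfold Re, Im; simpl. field. exact Nh.
Qed.

(** * Sums over boxes of lattice indices *)

Definition csum {A} (f : A -> C) (l : list A) : C :=
  fold_right (fun x s => (f x + s)%C) 0%C l.

Definition rsum {A} (f : A -> R) (l : list A) : R :=
  fold_right (fun x s => f x + s) 0 l.

Section Sums.
Context {A : Type}.

Lemma csum_app (f : A -> C) (l m : list A) : csum f (l ++ m) = (csum f l + csum f m)%C.
Proof. induction l as [| x l IH]; simpl; [ring | rewrite IH; ring]. Qed.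

Lemma rsum_app (f : A -> R) (l m : list A) : rsum f (l ++ m) = rsum f l + rsum f m.
Proof. induction l as [| x l IH]; simpl; [ring | rewrite IH; ring]. Qed.

Lemma csum_perm (f : A -> C) (l m : list A) : Permutation l m -> csum f l = csum f m.
Proof. induction 1; simpl; try rewrite IHPermutation; try ring; congruence. Qed.

Lemma rsum_perm (f : A -> R) (l m : list A) : Permutation l m -> rsum f l = rsum f m.
Proof. induction 1; simpl; try rewrite IHPermutation; try ring; congruence. Qed.

Lemma csum_ext (f g : A -> C) (l : list A) :
  (forall x, In x l -> f x = g x) -> csum f l = csum g l.
Proof.
  induction l as [| x l IH]; simpl; intros H; [reflexivity |].
  rewrite (H x) by auto. rewrite IH; auto.
Qed.

Lemma csum_plus (f g : A -> C) (l : list A) :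
  csum (fun x => f x + g x)%C l = (csum f l + csum g l)%C.
Proof. induction l as [| x l IH]; simpl; [ring | rewrite IH; ring]. Qed.

Lemma csum_minus (f g : A -> C) (l : list A) :
  csum (fun x => f x - g x)%C l = (csum f l - csum g l)%C.
Proof. induction l as [| x l IH]; simpl; [ring | rewrite IH; ring]. Qed.

Lemma csum_scal (c : C) (f : A -> C) (l : list A) :
  csum (fun x => c * f x)%C l = (c * csum f l)%C.
Proof. induction l as [| x l IH]; simpl; [ring | rewrite IH; ring]. Qed.

Lemma csum_scal_r (c : C) (f : A -> C) (l : list A) :
  csum (fun x => f x * c)%C l = (csum f l * c)%C.
Proof. induction l as [| x l IH]; simpl; [ring | rewrite IH; ring]. Qed.

Lemma csum_conj (f : A -> C) (l : list A) :
  csum (fun x => Cconj (f x)) l = Cconj (csum f l).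
Proof.
  induction l as [| x l IH]; simpl.
  - apply C_eq; simpl; ring.
  - now rewrite IH, Cplus_conj.
Qed.

Lemma csum_zero (f : A -> C) (l : list A) :
  (forall x, In x l -> f x = 0%C) -> csum f l = 0%C.
Proof.
  induction l as [| x l IH]; simpl; intros H; [reflexivity |].
  rewrite (H x) by auto. rewrite IH by auto. ring.
Qed.

Lemma csum_map {B} (g : B -> A) (f : A -> C) (l : list B) :
  csum f (map g l) = csum (fun x => f (g x)) l.
Proof. induction l as [| x l IH]; simpl; [reflexivity | now rewrite IH]. Qed.

Lemma rsum_nonneg (f : A -> R) (l : list A) :
  (forall x, 0 <= f x) -> 0 <= rsum f l.
Proof. intros H; induction l as [| x l IH]; simpl; [lra |]. specialize (H x); lra. Qed.

Lemma rsum_scal (c : R) (f : A -> R) (l : list A) :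
  rsum (fun x => c * f x) l = c * rsum f l.
Proof. induction l as [| x l IH]; simpl; [ring | rewrite IH; ring]. Qed.

Lemma rsum_const_le (f : A -> R) (M : R) (l : list A) :
  (forall x, In x l -> f x <= M) -> rsum f l <= INR (length l) * M.
Proof.
  induction l as [| x l IH]; intros H; [simpl; lra |].
  change (length (x :: l)) with (S (length l)). rewrite S_INR. simpl.
  assert (f x <= M) by (apply H; simpl; auto).
  assert (rsum f l <= INR (length l) * M) by (apply IH; simpl in *; auto). lra.
Qed.

Lemma Cmod_csum_le (f : A -> C) (g : A -> R) (l : list A) :
  (forall x, In x l -> Cmod (f x) <= g x) -> Cmod (csum f l) <= rsum g l.
Proof.
  induction l as [| x l IH]; simpl; intros H; [rewrite Cmod_0; lra |].
  eapply Rle_trans; [apply Cmod_triangle |].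
  apply Rplus_le_compat; auto.
Qed.

Lemma csum_single (f : A -> C) (x : A) (l : list A) :
  NoDup l -> In x l -> (forall y, In y l -> y <> x -> f y = 0%C) -> csum f l = f x.
Proof.
  induction 1 as [| y l Ny ND IH]; simpl; [tauto |].
  intros [-> | I] H.
  - rewrite csum_zero; [ring |]. intros y I; apply H; auto. intros ->; contradiction.
  - rewrite IH by auto. rewrite (H y); [ring | auto |]. intros ->; contradiction.
Qed.

(** Set difference for lists: up to permutation a subset becomes a prefix, so that the sums over the
    two index sets can be subtracted. *)
Lemma NoDup_incl_complement (l m : list A) :
  NoDup l -> incl l m -> exists r, Permutation m (l ++ r).
Proof.
  intros ND; revert m; induction ND as [| x l Nx ND IH]; intros m I.
  - exists m; reflexivity.
  - destruct (in_split x m) as [m1 [m2 ->]]; [apply I; simpl; auto |].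
    destruct (IH (m1 ++ m2)) as [r Hr].
    + intros y Hy. assert (Hy' := I y (or_intror Hy)).
      apply in_app_or in Hy'. apply in_or_app. destruct Hy' as [| [<- |]]; auto.
      contradiction.
    + exists r. simpl. rewrite <- Hr. symmetry. apply Permutation_middle.
Qed.

End Sums.

Lemma csum_exch {A B} (f : A -> B -> C) (l : list A) (m : list B) :
  csum (fun x => csum (f x) m) l = csum (fun y => csum (fun x => f x y) l) m.
Proof.
  induction l as [| x l IH]; simpl.
  - symmetry; apply csum_zero; reflexivity.
  - rewrite IH, <- csum_plus. reflexivity.
Qed.

Definition zrange (N : nat) : list Z :=
  map (fun i => (Z.of_nat i - Z.of_nat N)%Z) (seq 0 (S (2 * N))).

Definition box (N : nat) : list (Z * Z) := list_prod (zrange N) (zrange N).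

(** The sup norm: its balls are the boxes over which [wp] is summed, and its sphere of radius n > 0
    has exactly 8n points. *)
Definition nz (v : Z * Z) : Z := Z.max (Z.abs (fst v)) (Z.abs (snd v)).

Lemma nz_nonneg (v : Z * Z) : (0 <= nz v)%Z.
Proof. unfold nz; lia. Qed.

Lemma in_zrange (N : nat) (m : Z) : In m (zrange N) <-> (Z.abs m <= Z.of_nat N)%Z.
Proof.
  unfold zrange. rewrite in_map_iff. split.
  - intros [i [<- I]]. apply in_seq in I. lia.
  - intros H. exists (Z.to_nat (m + Z.of_nat N)). split; [lia |].
    apply in_seq. lia.
Qed.

Lemma in_box (N : nat) (v : Z * Z) : In v (box N) <-> (nz v <= Z.of_nat N)%Z.
Proof.
  destruct v as [m n]. unfold box, nz. rewrite in_prod_iff, !in_zrange. simpl. lia.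
Qed.

Lemma NoDup_zrange (N : nat) : NoDup (zrange N).
Proof.
  apply FinFun.Injective_map_NoDup; [| apply seq_NoDup]. intros i j; lia.
Qed.

Lemma NoDup_list_prod {A B} (l : list A) (m : list B) :
  NoDup l -> NoDup m -> NoDup (list_prod l m).
Proof.
  intros Hl Hm. induction Hl as [| x l Nx Hl IH]; simpl; [constructor |].
  apply NoDup_app.
  - apply FinFun.Injective_map_NoDup; [| exact Hm]. intros y z E; congruence.
  - exact IH.
  - intros [a b] I J. apply in_map_iff in I. destruct I as [y [E _]].
    apply in_prod_iff in J. injection E as -> ->. tauto.
Qed.

Lemma NoDup_box (N : nat) : NoDup (box N).
Proof. apply NoDup_list_prod; apply NoDup_zrange. Qed.

Lemma length_box (N : nat) : length (box N) = ((2 * N + 1) * (2 * N + 1))%nat.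
Proof.
  unfold box, zrange. rewrite length_prod, length_map, length_seq. lia.
Qed.

Definition shell (N : nat) : list (Z * Z) :=
  filter (fun v => Z.eqb (nz v) (Z.of_nat N)) (box N).

Lemma in_shell (N : nat) (v : Z * Z) : In v (shell N) <-> nz v = Z.of_nat N.
Proof. unfold shell. rewrite filter_In, in_box, Z.eqb_eq. lia. Qed.

Lemma box_S (N : nat) : Permutation (box (S N)) (box N ++ shell (S N)).
Proof.
  apply NoDup_Permutation; [apply NoDup_box | |].
  - apply NoDup_app; [apply NoDup_box | apply NoDup_filter, NoDup_box |].
    intros v. rewrite in_box, in_shell. lia.
  - intros v. rewrite in_app_iff, !in_box, in_shell. lia.
Qed.

Lemma length_shell (N : nat) : length (shell (S N)) = (8 * S N)%nat.
Proof.
  assert (H := Permutation_length (box_S N)).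
  rewrite length_app, !length_box in H. lia.
Qed.

Lemma rsum_box_S_le (f : Z * Z -> R) (M : R) (N : nat) :
  (forall v, nz v = Z.of_nat (S N) -> f v <= M) ->
  rsum f (box (S N)) <= rsum f (box N) + 8 * INR (S N) * M.
Proof.
  intros H. rewrite (rsum_perm _ _ _ (box_S N)), rsum_app.
  apply Rplus_le_compat_l.
  replace (8 * INR (S N)) with (INR (length (shell (S N)))).
  - apply rsum_const_le. intros v I; apply H, in_shell, I.
  - rewrite length_shell, mult_INR. simpl (INR 8). ring.
Qed.

(** Squeezed between two boxes, [L] is the inner box together with some indices of the annulus; the
    majorant [G], being nonnegative, may be summed over the whole annulus. *)
Lemma box_sandwich (F : Z * Z -> C) (G : Z * Z -> R) (L : list (Z * Z)) (p q : nat) :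
  (forall v, 0 <= G v) ->
  (forall v, (Z.of_nat p < nz v <= Z.of_nat q)%Z -> Cmod (F v) <= G v) ->
  NoDup L -> (forall v, (nz v <= Z.of_nat p)%Z -> In v L) ->
  (forall v, In v L -> (nz v <= Z.of_nat q)%Z) ->
  Cmod (csum F L - csum F (box p))%C <= rsum G (box q) - rsum G (box p).
Proof.
  intros Gp FG ND I1 I2.
  destruct (NoDup_incl_complement (box p) L (NoDup_box p)) as [r Hr].
  { intros v Hv. apply I1, in_box, Hv. }
  destruct (NoDup_incl_complement L (box q) ND) as [s Hs].
  { intros v Hv. apply in_box, I2, Hv. }
  rewrite (rsum_perm _ _ _ Hs), rsum_app, (rsum_perm _ _ _ Hr), rsum_app.
  rewrite (csum_perm _ _ _ Hr), csum_app.
  replace (csum F (box p) + csum F r - csum F (box p))%C with (csum F r) by ring.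
  assert (B : Cmod (csum F r) <= rsum G r).
  { apply Cmod_csum_le. intros v Hv.
    assert (HL : In v L).
    { apply (Permutation_in v (Permutation_sym Hr)), in_or_app; auto. }
    apply FG. split; [| apply I2, HL].
    assert (ND' : NoDup (box p ++ r)) by (apply (Permutation_NoDup Hr ND)).
    apply Z.nle_gt. intros X. apply in_box in X.
    revert X Hv. clear - ND'. induction (box p) as [| x l IH]; simpl in *; [tauto |].
    inversion_clear ND' as [| ? ? N1 N2]. intros [-> | X] Hv.
    - apply N1, in_or_app; auto.
    - apply IH; auto. }
  assert (0 <= rsum G s) by (apply rsum_nonneg, Gp). lra.
Qed.

Lemma annulus3 (G : Z * Z -> R) (K : R) (p q : nat) :
  0 <= K -> (p <= q)%nat ->
  (forall v, (Z.of_nat p < nz v)%Z -> G v <= K / IZR (nz v) ^ 3) ->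
  rsum G (box q) - rsum G (box p) <= 16 * K * (/ INR (S p) - / INR (S q)).
Proof.
  intros HK Hpq H. induction Hpq as [| q Hpq IH]; [lra |].
  assert (B : rsum G (box (S q)) <= rsum G (box q) + 8 * INR (S q) * (K / INR (S q) ^ 3)).
  { apply rsum_box_S_le. intros v Hv. rewrite INR_IZR_INZ, <- Hv.
    apply H. lia. }
  assert (P : 0 < INR (S q)) by (apply lt_0_INR; lia).
  (* A shell of radius x >= 1 contributes at most 8K/x^2 <= 16K/(x(x+1)), which telescopes; the 16
     is the 8 of the shell times the 2 of x + 1 <= 2x. *)
  assert (E : 8 * INR (S q) * (K / INR (S q) ^ 3) <=
              16 * K * (/ INR (S q) - / INR (S (S q)))).
  { rewrite (S_INR (S q)). set (x := INR (S q)) in *.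
    assert (1 <= x) by (unfold x; rewrite S_INR; assert (0 <= INR q) by apply pos_INR; lra).
    replace (16 * K * (/ x - / (x + 1)))
      with (8 * x * (K / x ^ 3) + 8 * K * (x - 1) / (x ^ 2 * (x + 1))) by (field; lra).
    assert (0 <= 8 * K * (x - 1) / (x ^ 2 * (x + 1))).
    { apply Rdiv_le_0_compat; [nra | nra]. }
    lra. }
  lra.
Qed.

(** With quadratic decay a shell of radius x contributes up to 8K/x, so the full sum may grow like a
    logarithm. An annulus of fixed width nevertheless becomes negligible as [p] grows, and this is
    all that translations of a box require. *)
Lemma annulus2 (G : Z * Z -> R) (K : R) (p q : nat) :
  0 <= K -> (p <= q)%nat ->
  (forall v, (Z.of_nat p < nz v)%Z -> G v <= K / IZR (nz v) ^ 2) ->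
  rsum G (box q) - rsum G (box p) <= 8 * K * (INR q - INR p) / INR (S p).
Proof.
  intros HK Hpq H. induction Hpq as [| q Hpq IH].
  - unfold Rdiv. replace (INR p - INR p) with 0 by ring. lra.
  - assert (B : rsum G (box (S q)) <= rsum G (box q) + 8 * INR (S q) * (K / INR (S q) ^ 2)).
    { apply rsum_box_S_le. intros v Hv. rewrite INR_IZR_INZ, <- Hv.
      apply H. lia. }
    assert (P : 0 < INR (S p)) by (apply lt_0_INR; lia).
    assert (Q : INR (S p) <= INR (S q)) by (apply le_INR; lia).
    assert (E : 8 * INR (S q) * (K / INR (S q) ^ 2) <= 8 * K / INR (S p)).
    { replace (8 * INR (S q) * (K / INR (S q) ^ 2)) with (8 * K * / INR (S q)) by (field; lra).
      apply Rmult_le_compat_l; [lra |]. apply Rinv_le_contravar; assumption. }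
    rewrite (S_INR q).
    replace (8 * K * (INR q + 1 - INR p) / INR (S p))
      with (8 * K * (INR q - INR p) / INR (S p) + 8 * K / INR (S p)) by (field; lra).
    lra.
Qed.

Lemma NoDup_box_shift (w : Z * Z) (N : nat) :
  NoDup (map (fun v => (fst v - fst w, snd v - snd w)%Z) (box N)).
Proof.
  apply FinFun.Injective_map_NoDup; [| apply NoDup_box].
  intros [a b] [c d] E. injection E as E1 E2. f_equal; lia.
Qed.

Lemma in_box_shift (w v : Z * Z) (N : nat) :
  In v (map (fun v => (fst v - fst w, snd v - snd w)%Z) (box N)) <->
  (nz (fst v + fst w, snd v + snd w) <= Z.of_nat N)%Z.
Proof.
  rewrite in_map_iff. split.
  - intros [x [<- I]]. apply in_box in I. unfold nz in *; simpl in *; lia.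
  - intros I. exists (fst v + fst w, snd v + snd w)%Z. split.
    + destruct v; simpl; f_equal; lia.
    + apply in_box, I.
Qed.

(** Triangle inequality for the sup norm; the hypothesis makes the truncated subtraction
    [N - Z.to_nat (nz u)] a genuine one. *)
Lemma box_shift_between (u : Z * Z) (N : nat) : (nz u <= Z.of_nat N)%Z ->
  let L := map (fun v => (fst v - fst u, snd v - snd u)%Z) (box N) in
  (forall v, (nz v <= Z.of_nat (N - Z.to_nat (nz u)))%Z -> In v L) /\
  (forall v, In v L -> (nz v <= Z.of_nat (N + Z.to_nat (nz u)))%Z).
Proof.
  intros Hu L. split; intros v Hv; [apply in_box_shift | apply in_box_shift in Hv];
    unfold nz in *; simpl in *; lia.
Qed.

Lemma INR_inner_box (u : Z * Z) (N : nat) : (nz u <= Z.of_nat N)%Z ->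
  INR (S (N - Z.to_nat (nz u))) = INR N - IZR (nz u) + 1.
Proof.
  intros Hu. pose proof (nz_nonneg u).
  rewrite S_INR, minus_INR, (INR_IZR_INZ (Z.to_nat _)), Z2Nat.id by lia. ring.
Qed.

(** The value 0 at the origin makes the weight nonnegative on every index pair, as [box_sandwich]
    requires. *)
Definition tail_weight (K : R) (s : nat) (v : Z * Z) : R :=
  if Z.leb (nz v) 0 then 0 else K / IZR (nz v) ^ s.

Lemma tail_weight_pos (K : R) (s : nat) (v : Z * Z) :
  (0 < nz v)%Z -> tail_weight K s v = K / IZR (nz v) ^ s.
Proof. intros H. unfold tail_weight. destruct (Z.leb_spec (nz v) 0); [lia | reflexivity]. Qed.

Lemma box_sandwich_weight (F : Z * Z -> C) (K : R) (s : nat) (L : list (Z * Z)) (p q : nat) :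
  0 <= K -> (forall v, (0 < nz v)%Z -> Cmod (F v) <= K / IZR (nz v) ^ s) ->
  NoDup L -> (forall v, (nz v <= Z.of_nat p)%Z -> In v L) ->
  (forall v, In v L -> (nz v <= Z.of_nat q)%Z) ->
  Cmod (csum F L - csum F (box p))%C <=
    rsum (tail_weight K s) (box q) - rsum (tail_weight K s) (box p).
Proof.
  intros HK HF. apply box_sandwich.
  - intros v. unfold tail_weight. destruct (Z.leb_spec (nz v) 0) as [L0 | L0]; [lra |].
    apply Rdiv_le_0_compat; [exact HK |]. apply pow_lt, IZR_lt, L0.
  - intros v Hv. rewrite tail_weight_pos by lia. apply HF. lia.
Qed.

Lemma box_sandwich3 (F : Z * Z -> C) (K : R) (L : list (Z * Z)) (p q : nat) :
  0 <= K -> (p <= q)%nat -> (forall v, (0 < nz v)%Z -> Cmod (F v) <= K / IZR (nz v) ^ 3) ->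
  NoDup L -> (forall v, (nz v <= Z.of_nat p)%Z -> In v L) ->
  (forall v, In v L -> (nz v <= Z.of_nat q)%Z) ->
  Cmod (csum F L - csum F (box p))%C <= 16 * K * / INR (S p).
Proof.
  intros HK Hpq HF ND I1 I2.
  eapply Rle_trans; [exact (box_sandwich_weight F K 3 L p q HK HF ND I1 I2) |].
  eapply Rle_trans; [apply (annulus3 _ K p q HK Hpq) |].
  - intros v Hv. rewrite tail_weight_pos by lia. apply Rle_refl.
  - assert (0 < / INR (S q)) by (apply Rinv_0_lt_compat, lt_0_INR; lia). nra.
Qed.

Lemma box_sandwich2 (F : Z * Z -> C) (K : R) (L : list (Z * Z)) (p q : nat) :
  0 <= K -> (p <= q)%nat -> (forall v, (0 < nz v)%Z -> Cmod (F v) <= K / IZR (nz v) ^ 2) ->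
  NoDup L -> (forall v, (nz v <= Z.of_nat p)%Z -> In v L) ->
  (forall v, In v L -> (nz v <= Z.of_nat q)%Z) ->
  Cmod (csum F L - csum F (box p))%C <= 8 * K * (INR q - INR p) / INR (S p).
Proof.
  intros HK Hpq HF ND I1 I2.
  eapply Rle_trans; [exact (box_sandwich_weight F K 2 L p q HK HF ND I1 I2) |].
  apply annulus2; [exact HK | exact Hpq |].
  intros v Hv. rewrite tail_weight_pos by lia. apply Rle_refl.
Qed.

(** The difference of the roots is the reciprocal of their sum, which is at most 2 sqrt x, and 1/x
    <= 1/sqrt x. This gives a telescoping majorant for harmonic sums, cruder than a logarithm. *)
Lemma inv_le_sqrt_diff (x : R) : 1 <= x -> / x <= 2 * (sqrt x - sqrt (x - 1)).
Proof.
  intros H. assert (0 < sqrt x) by (apply sqrt_lt_R0; lra).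
  assert (0 <= sqrt (x - 1)) by apply sqrt_pos.
  assert (A := sqrt_sqrt x ltac:(lra)). assert (B := sqrt_sqrt (x - 1) ltac:(lra)).
  assert (1 <= sqrt x) by (rewrite <- sqrt_1; apply sqrt_le_1; lra).
  assert (sqrt (x - 1) <= sqrt x) by (apply sqrt_le_1; lra).
  set (s := sqrt x) in *. set (t := sqrt (x - 1)) in *.
  assert (E : (s - t) * (s + t) = 1) by nra.
  apply (Rmult_le_reg_r (x * (s + t))); [nra |].
  replace (/ x * (x * (s + t))) with (s + t) by (field; lra).
  replace (2 * (s - t) * (x * (s + t))) with (2 * x * ((s - t) * (s + t))) by ring.
  rewrite E. nra.
Qed.

(** Up to a constant, the share of the index [v] when Eisenstein's identity on the box of radius N
    is compared at two points. The last factor of the denominator is the distance from [v] to the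
    outside of the box. *)
Definition edge_weight (N : nat) (v : Z * Z) : R :=
  / ((1 + IZR (nz v)) ^ 2 * (INR N + 1 - IZR (nz v))).

(* Partial fractions split [1/((1+j)(N+1-j))], the contribution of the j-th
   shell, into two harmonic tails of size O(sqrt N), weighted by 1/(N+2). *)
Lemma edge_weight_bound (N : nat) :
  rsum (edge_weight N) (box N) <= 33 * / sqrt (INR (S N)).
Proof.
  assert (PN : 0 <= INR N) by apply pos_INR.
  assert (B : forall M, (M <= N)%nat -> rsum (edge_weight N) (box M) <=
    / (INR N + 1) + 16 / (INR N + 2) *
      ((sqrt (INR M + 1) - 1) + (sqrt (INR N) - sqrt (INR N - INR M)))).
  { induction M as [| M IH]; intros HM.
    - unfold box, zrange, edge_weight, nz. simpl. change (Z.max 0 0) with 0%Z.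
      replace (INR N - 0) with (INR N) by ring.
      replace (0 + 1) with 1 by ring. rewrite sqrt_1.
      replace ((1 + 0) * ((1 + 0) * 1) * (INR N + 1 - 0)) with (INR N + 1) by ring.
      lra.
    - assert (PM : 0 <= INR M) by apply pos_INR.
      assert (QM : INR M + 1 <= INR N) by (rewrite <- S_INR; apply le_INR, HM).
      eapply Rle_trans.
      { apply rsum_box_S_le. intros v Hv. unfold edge_weight.
        rewrite Hv, <- INR_IZR_INZ. apply Rle_refl. }
      rewrite S_INR. specialize (IH ltac:(lia)).
      assert (H1 := inv_le_sqrt_diff (INR M + 1 + 1) ltac:(lra)).
      assert (H2 := inv_le_sqrt_diff (INR N - INR M) ltac:(lra)).
      replace (INR M + 1 + 1 - 1) with (INR M + 1) in H1 by ring.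
      replace (INR N - (INR M + 1)) with (INR N - INR M - 1) by ring.
      set (m := INR M) in *. set (n := INR N) in *.
      assert (E : 8 * (m + 1) * / ((1 + (m + 1)) ^ 2 * (n + 1 - (m + 1))) <=
                  8 / (n + 2) * (/ (m + 1 + 1) + / (n - m))).
      { replace (8 / (n + 2) * (/ (m + 1 + 1) + / (n - m)))
          with (8 * (m + 2) * / ((1 + (m + 1)) ^ 2 * (n + 1 - (m + 1)))) by (field; lra).
        apply Rmult_le_compat_r; [| lra]. left. apply Rinv_0_lt_compat.
        apply Rmult_lt_0_compat; nra. }
      assert (P8 : 0 < 8 / (n + 2)) by (apply Rdiv_lt_0_compat; lra).
      replace (16 / (n + 2)) with (8 / (n + 2) * 2) in * by (field; lra).
      nra. }
  eapply Rle_trans; [apply (B N (le_n N)) |].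
  rewrite S_INR. set (n := INR N) in *.
  replace (n - n) with 0 by ring. rewrite sqrt_0.
  assert (S1 : sqrt n <= sqrt (n + 1)) by (apply sqrt_le_1; lra).
  assert (S2 := sqrt_sqrt (n + 1) ltac:(lra)).
  assert (S3 : 1 <= sqrt (n + 1)) by (rewrite <- sqrt_1 at 1; apply sqrt_le_1; lra).
  set (s := sqrt (n + 1)) in *.
  apply Rle_trans with (/ s + 16 / (n + 2) * (2 * s)).
  - apply Rplus_le_compat.
    + apply Rinv_le_contravar; nra.
    + apply Rmult_le_compat_l; [| lra]. left; apply Rdiv_lt_0_compat; lra.
  - apply (Rmult_le_reg_r (s * (n + 2))); [nra |].
    replace ((/ s + 16 / (n + 2) * (2 * s)) * (s * (n + 2)))
      with ((n + 2) + 32 * (s * s)) by (field; lra).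
    replace (33 * / s * (s * (n + 2))) with (33 * (n + 2)) by (field; lra).
    lra.
Qed.

Lemma csum_box_involution (s : Z * Z -> Z * Z) (F : Z * Z -> C) (N : nat) :
  (forall v, s (s v) = v) -> (forall v, nz (s v) = nz v) ->
  csum (fun v => F (s v)) (box N) = csum F (box N).
Proof.
  intros Hs Hn. rewrite <- (csum_map s). apply csum_perm, NoDup_Permutation.
  - apply FinFun.Injective_map_NoDup; [| apply NoDup_box].
    intros u v E. now rewrite <- (Hs u), E.
  - apply NoDup_box.
  - intros v. rewrite in_map_iff. split.
    + intros [x [<- I]]. apply in_box. rewrite Hn. now apply in_box.
    + intros I. exists (s v). split; [apply Hs |].
      apply in_box. rewrite Hn. now apply in_box.
Qed.

Lemma csum_box_opp (F : Z * Z -> C) (N : nat) :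
  csum (fun v => F (- fst v, - snd v)%Z) (box N) = csum F (box N).
Proof.
  apply (csum_box_involution (fun v => (- fst v, - snd v)%Z)); intros [m n]; unfold nz; simpl.
  - f_equal; lia.
  - lia.
Qed.

Lemma csum_box_conj (F : Z * Z -> C) (N : nat) :
  csum (fun v => F (fst v, - snd v)%Z) (box N) = csum F (box N).
Proof.
  apply (csum_box_involution (fun v => (fst v, - snd v)%Z)); intros [m n]; unfold nz; simpl.
  - f_equal; lia.
  - lia.
Qed.

(** * The Weierstrass function of a rectangular lattice *)

(** This convention is exploited: it reduces [weier_term] at the origin to the pole [/ z ^ 2], and
    it removes the diagonal terms from the sums over differences of lattice points. *)
Lemma Cinv_0 : (/ 0)%C = 0%C.
Proof. apply C_eq; simpl; unfold Rdiv; ring. Qed.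

Lemma Cinv_conj_total (c : C) : Cconj (/ c) = (/ Cconj c)%C.
Proof.
  destruct (classic (c = 0%C)) as [-> | N]; [| apply Cinv_conj; exact N].
  rewrite Cinv_0. replace (Cconj 0) with (RtoC 0) by (apply C_eq; simpl; ring).
  now rewrite Cinv_0.
Qed.

Lemma Cmod_inv_le (c : C) (r : R) : 0 < r -> r <= Cmod c -> Cmod (/ c) <= / r.
Proof.
  intros Hr H. assert (N : c <> 0%C) by (apply Cmod_gt_0; lra).
  rewrite Cmod_inv by exact N. now apply Rinv_le_contravar.
Qed.

Lemma Cmod_mult_le (x y : C) (r s : R) :
  Cmod x <= r -> Cmod y <= s -> Cmod (x * y)%C <= r * s.
Proof.
  intros H K. rewrite Cmod_mult.
  apply Rmult_le_compat; auto using Cmod_ge_0.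
Qed.

Lemma Cmod_plus_le (x y : C) (r s : R) :
  Cmod x <= r -> Cmod y <= s -> Cmod (x + y)%C <= r + s.
Proof. intros H K. eapply Rle_trans; [apply Cmod_triangle | lra]. Qed.

Lemma Cmod_pow_le (x : C) (r : R) (n : nat) : Cmod x <= r -> Cmod (x ^ n)%C <= r ^ n.
Proof.
  intros H. rewrite Cmod_pow. apply pow_incr. split; [apply Cmod_ge_0 | exact H].
Qed.

Lemma Cpow_inv_C (x : C) (n : nat) : (/ x ^ n)%C = ((/ x) ^ n)%C.
Proof.
  induction n as [| n IH]; simpl.
  - apply C_eq; simpl; field.
  - rewrite <- IH.
    destruct (classic (x = 0%C)) as [-> | N].
    + rewrite Cmult_0_l, Cinv_0. ring.
    + field. split; [| exact N]. now apply Cpow_nz.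
Qed.

Lemma seq_cvg_rate (u : nat -> C) (M : R) :
  (forall p q, (p <= q)%nat -> Cmod (u q - u p)%C <= M * / INR (S p)) ->
  exists l, cvg eventually u l.
Proof.
  intros H.
  assert (T : forall eps : posreal, exists N : nat, forall n, (N <= n)%nat -> M * / INR (S n) < eps).
  { intros eps. destruct (nfloor_ex (Rmax 0 (M / eps)) (Rmax_l _ _)) as [N [_ HN]].
    exists N. intros n Hn. apply Rlt_div_l; [apply lt_0_INR; lia |].
    assert (X : M / eps < INR (S n)).
    { eapply Rle_lt_trans; [apply Rmax_r |]. eapply Rlt_le_trans; [exact HN |].
      rewrite <- S_INR. apply le_INR. lia. }
    apply (Rmult_lt_compat_r eps) in X; [| apply cond_pos].
    replace (M / eps * eps) with M in X by (field; apply Rgt_not_eq, cond_pos). lra. }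
  assert (W : forall f : C -> R, (forall x y, Rabs (f x - f y) <= Cmod (x - y)%C) ->
    ex_finite_lim_seq (fun n => f (u n))).
  { intros f Hf. apply ex_lim_seq_cauchy_corr. intros eps.
    destruct (T eps) as [N HN]. exists N. intros n m Hn Hm.
    destruct (Nat.le_ge_cases n m) as [L | L].
    - rewrite Rabs_minus_sym.
      eapply Rle_lt_trans; [apply Hf |]. eapply Rle_lt_trans; [apply H, L |]. now apply HN.
    - eapply Rle_lt_trans; [apply Hf |]. eapply Rle_lt_trans; [apply H, L |]. now apply HN. }
  destruct (W Re) as [x Hx]; [intros y z; apply (re_le_Cmod (y - z)%C) |].
  destruct (W Im) as [y Hy]; [intros v z; apply (im_le_Cmod (v - z)%C) |].
  exists (x, y). split; [exact Hx | exact Hy].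
Qed.

(** The limit is encoded exactly as in [wp]. It is total, and a genuine limit only once [lsum_cvg]
    applies. *)
Definition lsum (f : Z * Z -> C) : C :=
  (real (Lim_seq (fun N => Re (csum f (box N)))),
   real (Lim_seq (fun N => Im (csum f (box N))))).

Lemma lsum_unique (f : Z * Z -> C) (l : C) :
  cvg eventually (fun N => csum f (box N)) l -> lsum f = l.
Proof.
  intros [H1 H2]. apply C_eq; unfold lsum; cbn [Re Im fst snd].
  - now rewrite (is_lim_seq_unique _ (Finite (Re l)) H1).
  - now rewrite (is_lim_seq_unique _ (Finite (Im l)) H2).
Qed.

Lemma lsum_cvg (f : Z * Z -> C) (K : R) :
  (forall v, (0 < nz v)%Z -> Cmod (f v) <= K / IZR (nz v) ^ 3) ->
  cvg eventually (fun N => csum f (box N)) (lsum f).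
Proof.
  intros H.
  assert (HK : 0 <= K).
  { specialize (H (1, 0)%Z ltac:(unfold nz; simpl; lia)).
    change (nz (1, 0)%Z) with 1%Z in H.
    pose proof (Cmod_ge_0 (f (1, 0)%Z)). lra. }
  destruct (seq_cvg_rate (fun N => csum f (box N)) (16 * K)) as [l Hl].
  - intros p q L. apply (box_sandwich3 f K (box q) p q HK L H (NoDup_box q)).
    + intros v Hv. apply in_box. lia.
    + intros v Hv. now apply in_box.
  - rewrite (lsum_unique f l Hl). exact Hl.
Qed.

(** The origin gives [K], and [annulus3] gives [16 * K] for everything else. *)
Lemma rsum_cube_le (K : R) (N : nat) : 0 <= K ->
  rsum (fun v => K / (1 + IZR (nz v)) ^ 3) (box N) <= 17 * K.
Proof.
  intros HK. set (g := fun v => _).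
  assert (B : rsum g (box N) - rsum g (box 0) <= 16 * K * (/ INR 1 - / INR (S N))).
  { apply annulus3; [exact HK | lia |]. intros v Hv. unfold g.
    assert (1 <= IZR (nz v)) by (apply IZR_le; lia).
    apply Rmult_le_compat_l; [exact HK |].
    apply Rinv_le_contravar; [apply pow_lt; lra |]. apply pow_incr; lra. }
  assert (X : 0 < / INR (S N)) by (apply Rinv_0_lt_compat, lt_0_INR; lia).
  assert (B0 : rsum g (box 0) = K).
  { unfold g, box, zrange, nz; simpl. change (Z.max 0 0) with 0%Z. field. }
  simpl (INR 1) in B. assert (0 <= 16 * K * / INR (S N)) by nra. lra.
Qed.

(** Termwise differentiation: the remainders of first order are bounded by |h|^2 times a summable
    weight, uniformly in h, so the remainder of the sum is at most 17 K |h|^2. *)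
Lemma hasd_series (f g : C -> Z * Z -> C) (Lf : C -> C) (l z : C) (kap K : R) :
  0 < kap -> 0 <= K ->
  (forall h, Cmod h <= kap -> cvg eventually (fun N => csum (f (z + h)%C) (box N)) (Lf (z + h)%C)) ->
  cvg eventually (fun N => csum (g z) (box N)) l ->
  (forall h v, Cmod h <= kap ->
     Cmod (f (z + h)%C v - f z v - h * g z v)%C <= Cmod h ^ 2 * (K / (1 + IZR (nz v)) ^ 3)) ->
  hasd Lf z l.
Proof.
  intros Hk HK Cf Cg B. unfold hasd.
  assert (C0 : cvg eventually (fun N => csum (f z) (box N)) (Lf z)).
  { specialize (Cf 0%C). replace (z + 0)%C with z in Cf by ring.
    apply Cf. rewrite Cmod_0. lra. }
  apply (cvg_bound_0 at0 _ (fun h => Cmod h * (17 * K))).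
  - exists kap. split; [exact Hk |]. intros h Nh Lh.
    assert (Q := Cf h (Rlt_le _ _ Lh)).
    assert (Q' := cvg_minus eventually _ _ _ _ (cvg_minus eventually _ _ _ _ Q C0)
                    (cvg_scal eventually h _ _ Cg)).
    assert (E : Cmod (Lf (z + h) - Lf z - h * l)%C <= Cmod h ^ 2 * (17 * K)).
    { refine (cvg_Cmod_le eventually _ _ _ _ Q'). exists 0%nat. intros N _.
      rewrite <- csum_scal, <- !csum_minus.
      eapply Rle_trans.
      { apply Cmod_csum_le. intros v _. apply B. lra. }
      rewrite rsum_scal. apply Rmult_le_compat_l; [apply pow_le, Cmod_ge_0 |].
      now apply rsum_cube_le. }
    assert (P := proj1 (Cmod_gt_0 h) Nh).
    replace ((Lf (z + h) - Lf z) / h - l)%C with ((Lf (z + h) - Lf z - h * l) / h)%C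
      by (field; exact Nh).
    rewrite Cmod_div by exact Nh. apply Rle_div_l; [exact P |]. nra.
  - intros P [d Hd].
    assert (D : 0 < 17 * K + 1) by lra.
    exists (d / (17 * K + 1)). split; [apply Rdiv_lt_0_compat; [apply cond_pos | exact D] |].
    intros h _ Lh. apply Hd. change (Rabs (Cmod h * (17 * K) - 0) < d).
    pose proof (Cmod_ge_0 h).
    rewrite Rminus_0_r, Rabs_pos_eq by nra.
    apply Rlt_div_r in Lh; [| exact D]. nra.
Qed.

Section Lattice.
Variables (a b : R).
Hypotheses (Ha : 0 < a) (Hb : 0 < b).

Definition lpoint (v : Z * Z) : C := (IZR (fst v) * a, IZR (snd v) * b).

Definition in_lat (z : C) : Prop := exists v, z = lpoint v.

Definition eis_term (s : nat) (z : C) (v : Z * Z) : C := (/ (z - lpoint v) ^ s)%C.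

Definition weier_term (z : C) (v : Z * Z) : C := (/ (z - lpoint v) ^ 2 - / (lpoint v) ^ 2)%C.

Definition weier (z : C) : C := lsum (weier_term z).
Definition cube_sum (z : C) : C := lsum (eis_term 3 z).
Definition quartic_sum (z : C) : C := lsum (eis_term 4 z).
Definition weier' (z : C) : C := (-2 * cube_sum z)%C.

Lemma lpoint_lower : exists c, 0 < c /\ c <= 1 /\ forall v, c * IZR (nz v) <= Cmod (lpoint v).
Proof.
  exists (Rmin 1 (Rmin a b)). split; [repeat apply Rmin_pos; lra |].
  split; [apply Rmin_l |]. intros v.
  assert (A1 : Rmin 1 (Rmin a b) <= a).
  { eapply Rle_trans; [apply Rmin_r | apply Rmin_l]. }
  assert (B1 : Rmin 1 (Rmin a b) <= b).
  { eapply Rle_trans; [apply Rmin_r | apply Rmin_r]. }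
  assert (C1 : 0 < Rmin 1 (Rmin a b)) by (repeat apply Rmin_pos; lra).
  assert (X := re_le_Cmod (lpoint v)). assert (Y := im_le_Cmod (lpoint v)).
  simpl in X, Y. rewrite Rabs_mult, <- abs_IZR, (Rabs_pos_eq a) in X by lra.
  rewrite Rabs_mult, <- abs_IZR, (Rabs_pos_eq b) in Y by lra.
  unfold nz. destruct (Z.max_spec (Z.abs (fst v)) (Z.abs (snd v))) as [[_ ->] | [_ ->]].
  - assert (0 <= IZR (Z.abs (snd v))) by (apply IZR_le; lia). nra.
  - assert (0 <= IZR (Z.abs (fst v))) by (apply IZR_le; lia). nra.
Qed.

Lemma lpoint_opp (v : Z * Z) : lpoint (- fst v, - snd v)%Z = (- lpoint v)%C.
Proof. apply C_eq; unfold lpoint; simpl; rewrite opp_IZR; ring. Qed.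

Lemma lpoint_conj (v : Z * Z) : lpoint (fst v, - snd v)%Z = Cconj (lpoint v).
Proof. apply C_eq; unfold lpoint; simpl; rewrite ?opp_IZR; ring. Qed.

Lemma lpoint_minus (v u : Z * Z) : lpoint (fst v - fst u, snd v - snd u)%Z = (lpoint v - lpoint u)%C.
Proof. apply C_eq; unfold lpoint; simpl; rewrite minus_IZR; ring. Qed.

Lemma lpoint_0 : lpoint (0, 0)%Z = 0%C.
Proof. apply C_eq; unfold lpoint; simpl; ring. Qed.

Lemma nz_0 (v : Z * Z) : (nz v <= 0)%Z -> v = (0, 0)%Z.
Proof. destruct v as [m n]; unfold nz; simpl; intros H; f_equal; lia. Qed.

(** The single estimate behind all convergence bounds, uniform for z' near z. Writing 1 + nz keeps
    it meaningful at the origin index, and the predicate [Q] allows that index to be excluded when z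
    is itself the origin. *)
Lemma lattice_distance (Q : Z * Z -> Prop) (z : C) :
  (forall v, Q v -> z <> lpoint v) ->
  exists kap, 0 < kap /\ kap <= 1 /\
    forall z' v, Cmod (z' - z)%C <= kap -> Q v ->
      kap * (1 + IZR (nz v)) <= Cmod (z' - lpoint v)%C.
Proof.
  intros H. destruct lpoint_lower as [c [Hc [Hc1 Hw]]].
  assert (M : forall l : list (Z * Z), exists d, 0 < d /\
    forall v, In v l -> Q v -> d <= Cmod (z - lpoint v)%C).
  { induction l as [| u l [d [Hd IH]]].
    - exists 1; split; [lra |]. intros v [].
    - destruct (classic (Q u)) as [Hu | Hu].
      + assert (P : 0 < Cmod (z - lpoint u)%C).
        { apply Cmod_gt_0. intros E. apply (H u Hu).
          now apply Cminus_eq_0. }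
        exists (Rmin d (Cmod (z - lpoint u)%C)). split; [now apply Rmin_pos |].
        intros v [<- | I] Hv; [apply Rmin_r |].
        eapply Rle_trans; [apply Rmin_l | auto].
      + exists d; split; [exact Hd |]. intros v [<- | I] Hv; [contradiction | auto]. }
  (* Outside the box of radius N + 1 one has 2(|z| + 1) < c (nz v - 1), so the lattice point
     dominates z'; inside it, finitely many positive distances have a positive minimum d. *)
  destruct (nfloor_ex (2 * (Cmod z + 1) / c + 1)) as [N [_ HN]].
  { assert (0 <= Cmod z) by apply Cmod_ge_0.
    assert (0 <= 2 * (Cmod z + 1) / c) by (apply Rdiv_le_0_compat; lra). lra. }
  destruct (M (box (S N))) as [d [Hd HM]].
  pose proof (pos_INR N) as PN.
  (* The 3 arises because 1 + nz is at most N + 2 in the box, and moving from z to z' costs one more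
     [kap]. *)
  set (kap := Rmin (c / 4) (d / (INR N + 3))).
  assert (K1 : kap <= c / 4) by apply Rmin_l.
  assert (K2 : kap <= d / (INR N + 3)) by apply Rmin_r.
  assert (K3 : kap * (INR N + 3) <= d) by (apply Rle_div_r; [lra | exact K2]).
  assert (K0 : 0 < kap) by (apply Rmin_pos; [lra | apply Rdiv_lt_0_compat; lra]).
  exists kap. split; [exact K0 |]. split; [lra |].
  intros z' v Hz Hv.
  destruct (Z.le_gt_cases (nz v) (Z.of_nat (S N))) as [L | L].
  - assert (X := HM v (proj2 (in_box _ _) L) Hv).
    assert (T := Cmod_triangle (z' - lpoint v) (- (z' - z))%C).
    replace (z' - lpoint v + - (z' - z))%C with (z - lpoint v)%C in T by ring.
    rewrite Cmod_opp in T.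
    apply IZR_le in L. rewrite <- INR_IZR_INZ, S_INR in L. nra.
  - assert (T := Cmod_triangle (z' - lpoint v) (- z')%C).
    replace (z' - lpoint v + - z')%C with (- lpoint v)%C in T by ring.
    rewrite !Cmod_opp in T.
    assert (T' := Cmod_triangle (z' - z)%C z).
    replace (z' - z + z)%C with z' in T' by ring.
    apply IZR_lt in L. rewrite <- INR_IZR_INZ, S_INR in L.
    specialize (Hw v).
    assert (Y : 2 * (Cmod z + 1) / c + 1 < IZR (nz v)) by lra.
    assert (Y' : 2 * (Cmod z + 1) < (IZR (nz v) - 1) * c).
    { apply Rlt_div_l; [exact Hc |]. lra. }
    assert (1 <= IZR (nz v)) by (assert (0 <= 2 * (Cmod z + 1) / c) by
      (apply Rdiv_le_0_compat; [assert (0 <= Cmod z) by apply Cmod_ge_0; lra | lra]); lra).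
    nra.
Qed.
End Lattice.

Section LatticeFunctions.
Variables (a b : R).
Hypotheses (Ha : 0 < a) (Hb : 0 < b).

Local Notation w := (lpoint a b).
Local Notation lat := (in_lat a b).
Local Notation F := (eis_term a b).
Local Notation G := (weier_term a b).
Local Notation pe := (weier a b).
Local Notation S3 := (cube_sum a b).
Local Notation S4 := (quartic_sum a b).
Local Notation pe' := (weier' a b).

Lemma inv_pow_bound (kap x : R) (s : nat) :
  0 < kap -> 1 <= x -> (3 <= s)%nat -> (/ (kap * x)) ^ s <= (/ kap) ^ s / x ^ 3.
Proof.
  intros Hk Hx Hs. rewrite Rinv_mult, Rpow_mult_distr.
  apply Rmult_le_compat_l; [apply pow_le, Rlt_le, Rinv_0_lt_compat, Hk |].
  rewrite pow_inv. apply Rinv_le_contravar; [apply pow_lt; lra |].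
  apply Rle_pow; assumption.
Qed.

Lemma off_lattice (z : C) :
  ~ lat z -> exists kap, 0 < kap /\ kap <= 1 /\
    (forall z' v, Cmod (z' - z)%C <= kap -> kap * (1 + IZR (nz v)) <= Cmod (z' - w v)%C) /\
    forall v, kap * (1 + IZR (nz v)) <= Cmod (z - w v)%C.
Proof.
  intros N. destruct (lattice_distance a b Ha Hb (fun _ => True) z) as [k [A [B D]]].
  - intros v _ E. apply N. now exists v.
  - exists k. do 2 (split; [assumption |]). split; [auto |]. intros v. apply D; [| exact I].
    replace (z - z)%C with (RtoC 0) by ring. rewrite Cmod_0; lra.
Qed.

Lemma near_zero :
  exists kap, 0 < kap /\ kap <= 1 /\
    forall z' v, Cmod z' <= kap -> (0 < nz v)%Z ->
      kap * (1 + IZR (nz v)) <= Cmod (z' - w v)%C.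
Proof.
  destruct (lattice_distance a b Ha Hb (fun v => (0 < nz v)%Z) 0%C) as [k [A [B D]]].
  - intros v Hv E. destruct (lpoint_lower a b Ha Hb) as [c [Hc [_ Hw]]].
    specialize (Hw v). rewrite <- E, Cmod_0 in Hw. apply IZR_lt in Hv. nra.
  - exists k; split; [exact A |]; split; [exact B |]. intros z' v Hz. apply D.
    now replace (z' - 0)%C with z' by ring.
Qed.

Lemma one_le_nz (v : Z * Z) : 1 <= 1 + IZR (nz v).
Proof. pose proof (IZR_le _ _ (nz_nonneg v)). lra. Qed.

Lemma eis_term_bound (kap : R) (s : nat) (z : C) (v : Z * Z) :
  0 < kap -> (3 <= s)%nat -> kap * (1 + IZR (nz v)) <= Cmod (z - w v)%C ->
  Cmod (F s z v) <= (/ kap) ^ s / (1 + IZR (nz v)) ^ 3.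
Proof.
  intros Hk Hs H. pose proof (one_le_nz v).
  unfold eis_term. rewrite Cpow_inv_C.
  eapply Rle_trans; [apply Cmod_pow_le, Cmod_inv_le; [| exact H]; nra |].
  now apply inv_pow_bound.
Qed.

Lemma cube_compare (K : R) (v : Z * Z) : 0 <= K -> (0 < nz v)%Z ->
  K / (1 + IZR (nz v)) ^ 3 <= K / IZR (nz v) ^ 3.
Proof.
  intros HK H. apply IZR_lt in H. apply Rmult_le_compat_l; [exact HK |].
  apply Rinv_le_contravar; [apply pow_lt; lra |]. apply pow_incr; lra.
Qed.

Lemma eis_term_cvg (s : nat) (z : C) : (3 <= s)%nat -> ~ lat z ->
  cvg eventually (fun N => csum (F s z) (box N)) (lsum (F s z)).
Proof.
  intros Hs N. destruct (off_lattice z N) as [k [Hk [_ [_ D]]]].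
  apply (lsum_cvg _ ((/ k) ^ s)). intros v Hv.
  eapply Rle_trans; [apply (eis_term_bound k); auto |].
  apply cube_compare; [apply pow_le, Rlt_le, Rinv_0_lt_compat, Hk | exact Hv].
Qed.

Lemma inv_sq_diff_bound (p q : C) (r : R) :
  p <> 0%C -> q <> 0%C -> Cmod (/ p)%C <= r -> Cmod (/ q)%C <= r ->
  Cmod (/ p ^ 2 - / q ^ 2)%C <= Cmod (q - p)%C * (2 * r ^ 3).
Proof.
  intros Np Nq Hp Hq.
  replace (/ p ^ 2 - / q ^ 2)%C with ((q - p) * ((/ p) ^ 2 * / q + / p * (/ q) ^ 2))%C
    by (field; auto).
  apply Cmod_mult_le; [lra |].
  replace (2 * r ^ 3) with (r ^ 2 * r + r * r ^ 2) by ring.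
  apply Cmod_plus_le; apply Cmod_mult_le; auto using Cmod_pow_le.
Qed.

Lemma Cmod_pos_neq (p : C) (r : R) : 0 < r -> r <= Cmod p -> p <> 0%C.
Proof. intros H K. apply Cmod_gt_0. lra. Qed.

(** Subtracting [/ w v ^ 2] gains the order of decay that makes the box sums converge. *)
Lemma weier_term_bound (kap : R) (z : C) (v : Z * Z) :
  0 < kap -> (0 < nz v)%Z ->
  kap * (1 + IZR (nz v)) <= Cmod (z - w v)%C ->
  kap * (1 + IZR (nz v)) <= Cmod (- w v)%C ->
  Cmod (G z v) <= Cmod z * (2 * (/ kap) ^ 3) / (1 + IZR (nz v)) ^ 3.
Proof.
  intros Hk Hv H1 H2. pose proof (one_le_nz v).
  assert (Hr : 0 < kap * (1 + IZR (nz v))) by nra.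
  unfold weier_term. replace (/ w v ^ 2)%C with (/ (- w v) ^ 2)%C
    by (f_equal; ring).
  eapply Rle_trans.
  { apply (inv_sq_diff_bound _ _ (/ (kap * (1 + IZR (nz v))))).
    - now apply (Cmod_pos_neq _ _ Hr).
    - now apply (Cmod_pos_neq _ _ Hr).
    - now apply Cmod_inv_le.
    - now apply Cmod_inv_le. }
  replace (- w v - (z - w v))%C with (- z)%C by ring. rewrite Cmod_opp.
  unfold Rdiv. rewrite !Rmult_assoc. apply Rmult_le_compat_l; [apply Cmod_ge_0 |].
  apply Rmult_le_compat_l; [lra |]. apply inv_pow_bound; auto.
Qed.

Lemma weier_term_cvg (z : C) : ~ lat z ->
  cvg eventually (fun N => csum (G z) (box N)) (pe z).
Proof.
  intros N. destruct (off_lattice z N) as [k [Hk [_ [_ D]]]].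
  destruct near_zero as [k' [Hk' [_ D']]].
  set (m := Rmin k k'). assert (Hm : 0 < m) by (apply Rmin_pos; auto).
  assert (M1 : m <= k) by apply Rmin_l. assert (M2 : m <= k') by apply Rmin_r.
  apply (lsum_cvg _ (Cmod z * (2 * (/ m) ^ 3))). intros v Hv.
  pose proof (one_le_nz v).
  eapply Rle_trans; [apply (weier_term_bound m); auto |].
  - eapply Rle_trans; [| apply D]. nra.
  - replace (- w v)%C with (0 - w v)%C by ring.
    eapply Rle_trans; [| apply D'; auto].
    + nra.
    + rewrite Cmod_0; lra.
  - apply cube_compare; [| exact Hv].
    apply Rmult_le_pos; [apply Cmod_ge_0 |].
    assert (0 < (/ m) ^ 3) by apply pow_lt, Rinv_0_lt_compat, Hm. lra.
Qed.

Lemma not_lat_near (z : C) (kap : R) :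
  0 < kap ->
  (forall z' v, Cmod (z' - z)%C <= kap -> kap * (1 + IZR (nz v)) <= Cmod (z' - w v)%C) ->
  forall h, Cmod h <= kap -> ~ lat (z + h)%C.
Proof.
  intros Hk D h Hh [v E].
  assert (X := D (z + h)%C v). replace (z + h - z)%C with h in X by ring.
  specialize (X Hh). rewrite E in X. replace (w v - w v)%C with (RtoC 0) in X by ring.
  rewrite Cmod_0 in X. pose proof (one_le_nz v). nra.
Qed.

Lemma not_lat_at0 (z : C) : ~ lat z -> at0 (fun h => ~ lat (z + h)%C).
Proof.
  intros N. destruct (off_lattice z N) as [k [Hk [_ [D _]]]].
  exists k; split; [exact Hk |]. intros h _ Hh. apply (not_lat_near z k Hk D). lra.
Qed.

Lemma hasd_weier (z : C) : ~ lat z -> hasd pe z (pe' z).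
Proof.
  intros N. destruct (off_lattice z N) as [k [Hk [_ [D D0]]]].
  apply (hasd_series G (fun z v => (-2 * F 3 z v)%C) pe (pe' z) z k (3 * (/ k) ^ 4)).
  - exact Hk.
  - assert (0 < (/ k) ^ 4) by apply pow_lt, Rinv_0_lt_compat, Hk. lra.
  - intros h Hh. apply weier_term_cvg, (not_lat_near z k Hk D h Hh).
  - unfold weier'. refine (cvg_ext eventually _ _ _ _ (cvg_scal eventually _ _ _ (eis_term_cvg 3 z _ N))).
    + apply filter_forall. intros n. now rewrite csum_scal.
    + lia.
  - intros h v Hh.
    assert (D1 := D0 v).
    assert (D2 := D (z + h)%C v). replace (z + h - z)%C with h in D2 by ring.
    specialize (D2 Hh). pose proof (one_le_nz v).
    assert (Hr : 0 < k * (1 + IZR (nz v))) by nra.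
    unfold weier_term, eis_term. replace (z + h - w v)%C with (z - w v + h)%C in * by ring.
    set (p := (z - w v)%C) in *.
    assert (Np := Cmod_pos_neq _ _ Hr D1). assert (Nq := Cmod_pos_neq _ _ Hr D2).
    assert (Ip := Cmod_inv_le _ _ Hr D1). assert (Iq := Cmod_inv_le _ _ Hr D2).
    replace (/ (p + h) ^ 2 - / w v ^ 2 - (/ p ^ 2 - / w v ^ 2) - h * (-2 * / p ^ 3))%C
      with (/ (p + h) ^ 2 - / p ^ 2 + 2 * h * / p ^ 3)%C by ring.
    (* Taylor remainder with h^2 extracted; its coefficients 1 and 2 add up to the constant 3
       announced above. For the cubes the coefficients 3, 2, 1 give 6 in the same way. *)
    replace (/ (p + h) ^ 2 - / p ^ 2 + 2 * h * / p ^ 3)%C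
      with (h ^ 2 * ((/ p) ^ 2 * (/ (p + h)) ^ 2 + 2 * ((/ p) ^ 3 * / (p + h))))%C
      by (field; auto).
    set (r := / (k * (1 + IZR (nz v)))) in *.
    assert (B4 : r ^ 4 <= (/ k) ^ 4 / (1 + IZR (nz v)) ^ 3)
      by (apply inv_pow_bound; auto; lia).
    apply Cmod_mult_le; [rewrite Cmod_pow; lra |].
    apply Rle_trans with (r ^ 2 * r ^ 2 + 2 * (r ^ 3 * r)).
    + apply Cmod_plus_le; [| apply Cmod_mult_le; [rewrite Cmod_R, Rabs_pos_eq; lra |]];
        apply Cmod_mult_le; auto using Cmod_pow_le.
    + replace (3 * (/ k) ^ 4 / (1 + IZR (nz v)) ^ 3)
        with (3 * ((/ k) ^ 4 / (1 + IZR (nz v)) ^ 3)) by (unfold Rdiv; ring).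
      nra.
Qed.

Lemma hasd_cube_sum (z : C) : ~ lat z -> hasd S3 z (-3 * S4 z)%C.
Proof.
  intros N. destruct (off_lattice z N) as [k [Hk [_ [D D0]]]].
  apply (hasd_series (F 3) (fun z v => (-3 * F 4 z v)%C) S3 (-3 * S4 z)%C z k (6 * (/ k) ^ 5)).
  - exact Hk.
  - assert (0 < (/ k) ^ 5) by apply pow_lt, Rinv_0_lt_compat, Hk. lra.
  - intros h Hh. apply eis_term_cvg; [lia |]. apply (not_lat_near z k Hk D h Hh).
  - refine (cvg_ext eventually _ _ _ _ (cvg_scal eventually _ _ _ (eis_term_cvg 4 z _ N))).
    + apply filter_forall. intros n. now rewrite csum_scal.
    + lia.
  - intros h v Hh.
    assert (D1 := D0 v).
    assert (D2 := D (z + h)%C v). replace (z + h - z)%C with h in D2 by ring.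
    specialize (D2 Hh). pose proof (one_le_nz v).
    assert (Hr : 0 < k * (1 + IZR (nz v))) by nra.
    unfold eis_term. replace (z + h - w v)%C with (z - w v + h)%C in * by ring.
    set (p := (z - w v)%C) in *.
    assert (Np := Cmod_pos_neq _ _ Hr D1). assert (Nq := Cmod_pos_neq _ _ Hr D2).
    assert (Ip := Cmod_inv_le _ _ Hr D1). assert (Iq := Cmod_inv_le _ _ Hr D2).
    replace (/ (p + h) ^ 3 - / p ^ 3 - h * (-3 * / p ^ 4))%C
      with (h ^ 2 * (3 * ((/ p) ^ 4 * / (p + h)) + 2 * ((/ p) ^ 3 * (/ (p + h)) ^ 2)
                     + (/ p) ^ 2 * (/ (p + h)) ^ 3))%C
      by (field; auto).
    set (r := / (k * (1 + IZR (nz v)))) in *.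
    assert (B4 : r ^ 5 <= (/ k) ^ 5 / (1 + IZR (nz v)) ^ 3)
      by (apply inv_pow_bound; auto; lia).
    apply Cmod_mult_le; [rewrite Cmod_pow; lra |].
    apply Rle_trans with (3 * (r ^ 4 * r) + 2 * (r ^ 3 * r ^ 2) + r ^ 2 * r ^ 3).
    + repeat apply Cmod_plus_le;
        try (apply Cmod_mult_le; [rewrite Cmod_R, Rabs_pos_eq; lra |]);
        apply Cmod_mult_le; auto using Cmod_pow_le.
    + replace (6 * (/ k) ^ 5 / (1 + IZR (nz v)) ^ 3)
        with (6 * ((/ k) ^ 5 / (1 + IZR (nz v)) ^ 3)) by (unfold Rdiv; ring).
      nra.
Qed.

Lemma lsum_ext (f g : Z * Z -> C) :
  (forall N, csum f (box N) = csum g (box N)) -> lsum f = lsum g.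
Proof.
  intros H. unfold lsum. f_equal; f_equal; apply Lim_seq_ext; intros N; now rewrite H.
Qed.

(** The total limit commutes with negation whether or not the sums converge, so parity and
    conjugation symmetry hold at every point, poles included. *)
Lemma lsum_opp (f : Z * Z -> C) : lsum (fun v => - f v)%C = (- lsum f)%C.
Proof.
  assert (E : forall N, csum (fun v => - f v)%C (box N) = (- csum f (box N))%C).
  { intros N. replace (- csum f (box N))%C with (-1 * csum f (box N))%C by ring.
    rewrite <- csum_scal. apply csum_ext. intros v _. ring. }
  apply C_eq; unfold lsum; cbn [Re Im fst snd].
  - rewrite (Lim_seq_ext _ (fun N => - Re (csum f (box N)))).
    + rewrite Lim_seq_opp. now destruct (Lim_seq _); simpl; rewrite ?Ropp_0.
    + intros N. now rewrite E.
  - rewrite (Lim_seq_ext _ (fun N => - Im (csum f (box N)))).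
    + rewrite Lim_seq_opp. now destruct (Lim_seq _); simpl; rewrite ?Ropp_0.
    + intros N. now rewrite E.
Qed.

Lemma lsum_conj (f : Z * Z -> C) : lsum (fun v => Cconj (f v)) = Cconj (lsum f).
Proof.
  apply C_eq; unfold lsum; cbn [Re Im fst snd Cconj].
  - f_equal. apply Lim_seq_ext. intros N. now rewrite csum_conj.
  - rewrite (Lim_seq_ext _ (fun N => - Im (csum f (box N)))).
    + rewrite Lim_seq_opp. now destruct (Lim_seq _); simpl; rewrite ?Ropp_0.
    + intros N. now rewrite csum_conj.
Qed.

Lemma weier_even (z : C) : pe (- z)%C = pe z.
Proof.
  unfold weier. apply lsum_ext. intros N. rewrite <- (csum_box_opp (G (- z)%C)).
  apply csum_ext. intros v _. unfold weier_term. rewrite lpoint_opp.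
  replace ((- z - - w v) ^ 2)%C with ((z - w v) ^ 2)%C by ring.
  now replace ((- w v) ^ 2)%C with ((w v) ^ 2)%C by ring.
Qed.

Lemma weier'_odd (z : C) : pe' (- z)%C = (- pe' z)%C.
Proof.
  unfold weier', cube_sum.
  enough (E : lsum (F 3 (- z)%C) = (- lsum (F 3 z))%C) by (rewrite E; ring).
  rewrite <- lsum_opp. apply lsum_ext. intros N. rewrite <- (csum_box_opp (F 3 (- z)%C)).
  apply csum_ext. intros v _. unfold eis_term. rewrite lpoint_opp.
  rewrite !Cpow_inv_C. replace (- z - - w v)%C with (- (z - w v))%C by ring.
  generalize (z - w v)%C; intros p.
  destruct (classic (p = 0%C)) as [-> | Np].
  - replace (- 0)%C with (RtoC 0) by ring. rewrite Cinv_0. ring.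
  - field. exact Np.
Qed.

Lemma weier_conj (z : C) : pe (Cconj z) = Cconj (pe z).
Proof.
  unfold weier. rewrite <- lsum_conj. apply lsum_ext. intros N.
  rewrite <- (csum_box_conj (G (Cconj z))).
  apply csum_ext. intros v _. unfold weier_term. rewrite lpoint_conj.
  now rewrite Cminus_conj, !Cinv_conj_total, !Cpow_conj, Cminus_conj.
Qed.

(** Both index sets contain the box of radius N - |u| and lie in that of radius N + |u|. Each
    differs from the inner box by at most 8K times the width 2|u| over N - |u| + 1; the two
    comparisons together give 32. *)
Lemma box_shift_diff (f : Z * Z -> C) (K : R) (u : Z * Z) (N : nat) :
  0 <= K -> (nz u <= Z.of_nat N)%Z ->
  (forall v, (0 < nz v)%Z -> Cmod (f v) <= K / IZR (nz v) ^ 2) ->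
  Cmod (csum f (map (fun v => (fst v - fst u, snd v - snd u)%Z) (box N))
        - csum f (box N))%C
  <= 32 * K * IZR (nz u) / (INR N - IZR (nz u) + 1).
Proof.
  intros HK Hu Hf. pose proof (nz_nonneg u) as U.
  destruct (box_shift_between u N Hu) as [I1 I2]. assert (Ip := INR_inner_box u N Hu).
  set (p := (N - Z.to_nat (nz u))%nat) in *. set (q := (N + Z.to_nat (nz u))%nat) in *.
  assert (Sd := fun L => box_sandwich2 f K L p q HK ltac:(lia) Hf).
  assert (E1 := Sd _ (NoDup_box_shift u N) I1 I2).
  set (L := map _ (box N)) in *.
  assert (E2 := Sd _ (NoDup_box N) ltac:(intros v Hv; apply in_box; lia)
                  ltac:(intros v Hv; apply in_box in Hv; lia)).
  replace (csum f L - csum f (box N))%C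
    with ((csum f L - csum f (box p)) + - (csum f (box N) - csum f (box p)))%C by ring.
  eapply Rle_trans.
  { apply Cmod_plus_le; [exact E1 | rewrite Cmod_opp; exact E2]. }
  rewrite Ip. right. unfold q, p.
  rewrite minus_INR, plus_INR, (INR_IZR_INZ (Z.to_nat _)), Z2Nat.id by lia.
  field. rewrite <- Ip. apply not_0_INR. lia.
Qed.

Lemma lim_inv_shift (K r : R) :
  filterlim (fun N => K / (INR N - r + 1)) eventually (locally 0).
Proof.
  assert (H : is_lim_seq (fun N => K * / (INR N - r + 1)) (Rbar_mult K (Rbar_inv p_infty))).
  { apply is_lim_seq_scal_l. apply is_lim_seq_inv; [| discriminate].
    apply (is_lim_seq_ext (fun N => INR N + (1 - r))).
    - intros N; ring.
    - eapply is_lim_seq_plus; [apply is_lim_seq_INR | apply is_lim_seq_const | reflexivity]. }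
  simpl in H. rewrite Rmult_0_r in H. exact H.
Qed.

(** The subtracted terms [/ w v ^ 2] cancel, leaving the sum of inverse squares over a box and over
    its translate; quadratic decay is enough for their difference to vanish in the limit. *)
Lemma weier_periodic (z : C) (u : Z * Z) : ~ lat z -> pe (z + w u)%C = pe z.
Proof.
  intros N.
  assert (N' : ~ lat (z + w u)%C).
  { intros [v E]. apply N. exists (fst v - fst u, snd v - snd u)%Z.
    rewrite lpoint_minus, <- E. ring. }
  assert (C1 := cvg_minus eventually _ _ _ _ (weier_term_cvg _ N') (weier_term_cvg _ N)).
  enough (C2 : cvg eventually
    (fun n => csum (G (z + w u)%C) (box n) - csum (G z) (box n))%C 0%C).
  { exact (Cminus_eq_0 _ _ (cvg_unique eventually _ _ _ C1 C2)). }
  destruct (off_lattice z N) as [k [Hk [_ [_ D]]]].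
  set (f := fun v => (/ (z - w v) ^ 2)%C).
  apply (cvg_bound_0 eventually _
    (fun n => 32 * (/ k) ^ 2 * IZR (nz u) / (INR n - IZR (nz u) + 1)));
    [| apply lim_inv_shift].
  exists (Z.to_nat (nz u)). intros n Hn. pose proof (nz_nonneg u).
  replace (csum (G (z + w u)%C) (box n) - csum (G z) (box n) - 0)%C
    with (csum f (map (fun v => (fst v - fst u, snd v - snd u)%Z) (box n)) - csum f (box n))%C.
  - apply box_shift_diff.
    + apply pow_le, Rlt_le, Rinv_0_lt_compat, Hk.
    + lia.
    + intros v Hv. unfold f. apply IZR_lt in Hv.
      rewrite Cpow_inv_C. eapply Rle_trans; [apply (Cmod_pow_le _ (/ (k * IZR (nz v)))) |].
      * apply Cmod_inv_le; [nra |]. eapply Rle_trans; [| apply D]. nra.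
      * right. field. lra.
  - rewrite csum_map. unfold weier_term. rewrite !csum_minus.
    rewrite (csum_ext _ (fun x => / (z + w u - w x) ^ 2)%C).
    + unfold f. ring.
    + intros v _. unfold f. rewrite lpoint_minus. do 2 f_equal. ring.
Qed.

Lemma hasd_unique (f : C -> C) (z l m : C) : hasd f z l -> hasd f z m -> l = m.
Proof. apply (cvg_unique at0). Qed.

Lemma lat_shift (z : C) (u : Z * Z) : lat (z + w u)%C -> lat z.
Proof.
  intros [v E]. exists (fst v - fst u, snd v - snd u)%Z. rewrite lpoint_minus, <- E. ring.
Qed.

Lemma weier'_periodic (z : C) (u : Z * Z) : ~ lat z -> pe' (z + w u)%C = pe' z.
Proof.
  intros N.
  assert (N' : ~ lat (z + w u)%C) by (intros L; apply N; exact (lat_shift _ _ L)).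
  apply (hasd_unique pe z).
  - apply (hasd_ext_loc (fun y => pe (y + w u)%C)).
    + now apply weier_periodic.
    + refine (filter_imp _ _ _ (not_lat_at0 z N)).
      intros h Nh. apply weier_periodic, Nh.
    + apply hasd_shift, hasd_weier, N'.
  - apply hasd_weier, N.
Qed.

End LatticeFunctions.

(** * The differential equation *)

Section Eisenstein.
Variables (a b : R).
Hypotheses (Ha : 0 < a) (Hb : 0 < b).

Local Notation w := (lpoint a b).
Local Notation lat := (in_lat a b).
Local Notation F := (eis_term a b).
Local Notation G := (weier_term a b).
Local Notation pe := (weier a b).
Local Notation S3 := (cube_sum a b).
Local Notation S4 := (quartic_sum a b).
Local Notation pe' := (weier' a b).

Lemma lpoint_inj (u v : Z * Z) : w u = w v -> u = v.
Proof.
  destruct u as [m n], v as [m' n']. unfold lpoint; simpl. intros E.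
  injection E as E1 E2. apply Rmult_eq_reg_r in E1; [| lra]. apply Rmult_eq_reg_r in E2; [| lra].
  apply eq_IZR in E1. apply eq_IZR in E2. congruence.
Qed.

Lemma Cinv_opp_total (c : C) : (/ - c)%C = (- / c)%C.
Proof.
  destruct (classic (c = 0%C)) as [-> | N].
  - replace (- 0)%C with (RtoC 0) by ring. rewrite Cinv_0. ring.
  - field. exact N.
Qed.

(** For fixed [v] and a large box, translating the index brings these sums close to their centred
    versions, which are [center_sum2] for squares and 0 for cubes. The deviation is a pure boundary
    effect, measured in [edge_bounds]. *)
Definition edge_sum2 (L : list (Z * Z)) (v : Z * Z) : C :=
  csum (fun u => (/ (w u - w v)) ^ 2)%C L.
Definition edge_sum3 (L : list (Z * Z)) (v : Z * Z) : C :=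
  csum (fun u => (/ (w u - w v)) ^ 3)%C L.

(* With p = z - w v, p' = z - w u, r = w u - w v one has
   1/(p p')^2 = (1/p^2 + 1/p'^2)/r^2 + 2 (1/p - 1/p')/r^3; the diagonal
   terms r = 0 vanish on the right because / 0 = 0. *)
Lemma eisenstein_finite (L : list (Z * Z)) (z : C) :
  NoDup L -> ~ lat z ->
  (csum (F 2 z) L ^ 2 - csum (F 4 z) L =
   2 * csum (fun v => edge_sum2 L v * / (z - w v) ^ 2) L +
   4 * csum (fun v => edge_sum3 L v * / (z - w v)) L)%C.
Proof.
  intros ND Nz.
  assert (Np : forall v, (z - w v)%C <> 0%C).
  { intros v E. apply Nz. exists v. now apply Cminus_eq_0. }
  set (T := fun v u => (F 2 z v * F 2 z u
     - ((/ (w u - w v)) ^ 2 * F 2 z v + (/ (w u - w v)) ^ 2 * F 2 z u)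
     - 2 * ((/ (w u - w v)) ^ 3 * / (z - w v) - (/ (w u - w v)) ^ 3 * / (z - w u)))%C).
  assert (HT : forall v, In v L -> csum (T v) L = F 4 z v).
  { intros v Iv. rewrite (csum_single _ v L ND Iv).
    - unfold T, eis_term. replace (w v - w v)%C with (RtoC 0) by ring. rewrite Cinv_0.
      specialize (Np v). field. exact Np.
    - intros u _ Hu. unfold T, eis_term.
      assert (Nr : (w u - w v)%C <> 0%C).
      { intros E. now apply Hu, lpoint_inj, Cminus_eq_0. }
      pose proof (Np u) as N1. pose proof (Np v) as N2.
      replace (w u - w v)%C with ((z - w v) - (z - w u))%C in * by ring.
      set (p := (z - w v)%C) in *. set (p' := (z - w u)%C) in *. field. auto. }
  assert (E1 : csum (fun v => csum (T v) L) L = csum (F 4 z) L) by (now apply csum_ext).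
  assert (E2 : csum (fun v => csum (T v) L) L =
    (csum (F 2 z) L * csum (F 2 z) L
     - (csum (fun v => edge_sum2 L v * / (z - w v) ^ 2) L
        + csum (fun v => edge_sum2 L v * / (z - w v) ^ 2) L)
     - 2 * (csum (fun v => edge_sum3 L v * / (z - w v)) L
            + csum (fun v => edge_sum3 L v * / (z - w v)) L))%C).
  { assert (X : forall s (f : Z * Z -> C),
      csum (fun v => csum (fun u => (/ (w u - w v)) ^ s * f u) L)%C L =
      csum (fun u => csum (fun v => (/ (w u - w v)) ^ s) L * f u)%C L).
    { intros s f. rewrite csum_exch. apply csum_ext. intros u _.
      now rewrite csum_scal_r. }
    rewrite (csum_ext _ (fun v => F 2 z v * csum (F 2 z) L
      - (edge_sum2 L v * F 2 z v + csum (fun u => (/ (w u - w v)) ^ 2 * F 2 z u) L)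
      - 2 * (edge_sum3 L v * / (z - w v) - csum (fun u => (/ (w u - w v)) ^ 3 * / (z - w u)) L))%C).
    - rewrite !csum_minus, csum_scal, csum_scal_r, csum_plus, csum_minus, !X.
      rewrite (csum_ext (fun u => csum (fun v => (/ (w u - w v)) ^ 2) L * F 2 z u)%C
                        (fun v => edge_sum2 L v * / (z - w v) ^ 2)%C).
      + rewrite (csum_ext (fun u => csum (fun v => (/ (w u - w v)) ^ 3) L * / (z - w u))%C
                          (fun v => -1 * (edge_sum3 L v * / (z - w v)))%C).
        * rewrite csum_scal. unfold eis_term. ring.
        * intros v _. unfold edge_sum3.
          rewrite (csum_ext (fun v0 => (/ (w v - w v0)) ^ 3)%C
                            (fun u => -1 * (/ (w u - w v)) ^ 3)%C).
          -- rewrite csum_scal. ring.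
          -- intros u _. replace (w v - w u)%C with (- (w u - w v))%C by ring.
             rewrite Cinv_opp_total. ring.
      + intros v _. unfold edge_sum2, eis_term. f_equal. apply csum_ext.
        intros u _. replace (w v - w u)%C with (- (w u - w v))%C by ring.
        rewrite Cinv_opp_total. ring.
    - intros v _. unfold T. rewrite !csum_minus, csum_scal, csum_scal, csum_plus, csum_minus.
      rewrite !csum_scal_r. reflexivity. }
  rewrite <- E1, E2. ring.
Qed.

(** It plays two roles: the correction between sums of [/ (z - w v) ^ 2] and sums of [weier_term],
    and the main term of [edge_sum2]. *)
Definition center_sum2 (N : nat) : C := csum (fun v => (/ w v) ^ 2)%C (box N).

Lemma inv_lpoint_bound (k : R) (v : Z * Z) (s : nat) :
  0 < k -> k * IZR (nz v) <= Cmod (w v) -> (0 < nz v)%Z ->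
  Cmod ((/ w v) ^ s)%C <= (/ k) ^ s / IZR (nz v) ^ s.
Proof.
  intros Hk H Hv. apply IZR_lt in Hv.
  eapply Rle_trans; [apply Cmod_pow_le, Cmod_inv_le; [| exact H]; nra |].
  rewrite Rinv_mult, Rpow_mult_distr, (pow_inv (IZR (nz v))). apply Rle_refl.
Qed.

(* The box translated by a lattice point and the box itself differ only in an
   annulus, and the cubes cancel in pairs on the largest centred box inside. *)
Lemma edge_bounds :
  exists K, 0 <= K /\ forall N v, (nz v <= Z.of_nat N)%Z ->
    Cmod (edge_sum2 (box N) v - center_sum2 N)%C <= K * IZR (nz v) / (INR N - IZR (nz v) + 1) /\
    Cmod (edge_sum3 (box N) v) <= K / (INR N - IZR (nz v) + 1).
Proof.
  destruct (lpoint_lower a b Ha Hb) as [k [Hk [Hk1 Hw]]].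
  assert (K2 : 0 <= (/ k) ^ 2) by (apply pow_le, Rlt_le, Rinv_0_lt_compat, Hk).
  assert (K3 : 0 <= (/ k) ^ 3) by (apply pow_le, Rlt_le, Rinv_0_lt_compat, Hk).
  exists (32 * (/ k) ^ 2 + 16 * (/ k) ^ 3). split; [lra |].
  intros N u Hu. pose proof (nz_nonneg u) as U.
  assert (Pd : 0 < INR N - IZR (nz u) + 1).
  { apply IZR_le in Hu. rewrite <- INR_IZR_INZ in Hu. lra. }
  split.
  - eapply Rle_trans.
    + unfold edge_sum2, center_sum2.
      rewrite (csum_ext (fun u0 => (/ (w u0 - w u)) ^ 2)%C
        (fun x => (fun y => (/ w y) ^ 2)%C (fst x - fst u, snd x - snd u)%Z)).
      * rewrite <- (csum_map (fun x => (fst x - fst u, snd x - snd u)%Z) (fun y => (/ w y) ^ 2)%C).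
        apply (box_shift_diff _ ((/ k) ^ 2)); auto.
        intros v Hv. apply inv_lpoint_bound; auto.
      * intros x _. now rewrite lpoint_minus.
    + apply Rmult_le_compat_r; [left; now apply Rinv_0_lt_compat |].
      apply Rmult_le_compat_r; [apply IZR_le, U | lra].
  - unfold edge_sum3.
    rewrite (csum_ext (fun u0 => (/ (w u0 - w u)) ^ 3)%C
        (fun x => (fun y => (/ w y) ^ 3)%C (fst x - fst u, snd x - snd u)%Z))
      by (intros x _; now rewrite lpoint_minus).
    rewrite <- (csum_map (fun x => (fst x - fst u, snd x - snd u)%Z) (fun y => (/ w y) ^ 3)%C).
    set (L := map _ (box N)). set (f := fun y => ((/ w y) ^ 3)%C).
    destruct (box_shift_between u N Hu) as [I1 I2]. assert (Ip := INR_inner_box u N Hu).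
    fold L in I1, I2.
    set (p := (N - Z.to_nat (nz u))%nat) in *. set (q := (N + Z.to_nat (nz u))%nat) in *.
    assert (Z0 : csum f (box p) = 0%C).
    { assert (E : csum f (box p) = (-1 * csum f (box p))%C).
      { rewrite <- csum_scal. rewrite <- (csum_box_opp f) at 1. apply csum_ext.
        intros v _. unfold f. rewrite lpoint_opp, Cinv_opp_total. ring. }
      replace (csum f (box p)) with (/ 2 * (csum f (box p) - -1 * csum f (box p)))%C by field.
      rewrite <- E. ring. }
    replace (csum f L) with (csum f L - csum f (box p))%C by (rewrite Z0; ring).
    eapply Rle_trans.
    + apply (box_sandwich3 f ((/ k) ^ 3) L p q K3 ltac:(lia)); auto; [| apply NoDup_box_shift].
      intros v Hv. apply inv_lpoint_bound; auto.
    + rewrite Ip. apply Rmult_le_compat_r; [left; now apply Rinv_0_lt_compat | lra].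
Qed.

Lemma edge_sum_lim (K : R) :
  filterlim (fun N => K * rsum (edge_weight N) (box N)) eventually (locally 0).
Proof.
  assert (H : is_lim_seq (fun N => / sqrt (INR (S N))) 0).
  { assert (S : is_lim_seq (fun N => sqrt (INR (S N))) p_infty).
    { apply (filterlim_comp _ _ _ (fun N => INR (S N)) sqrt _ (Rbar_locally p_infty)).
      - apply (is_lim_seq_incr_1 INR). apply is_lim_seq_INR.
      - apply filterlim_sqrt_p. }
    apply is_lim_seq_inv in S; [exact S | discriminate]. }
  assert (X : is_lim_seq (fun N => Rabs K * (33 * / sqrt (INR (S N)))) 0).
  { replace (Finite 0) with (Rbar_mult (Rabs K) (Rbar_mult 33 0)) by (simpl; f_equal; ring).
    apply is_lim_seq_scal_l. now apply is_lim_seq_scal_l. }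
  change (is_lim_seq (fun N => K * rsum (edge_weight N) (box N)) 0).
  apply (is_lim_seq_le_le (fun N => - (Rabs K * (33 * / sqrt (INR (S N))))) _
           (fun N => Rabs K * (33 * / sqrt (INR (S N))))).
  - intros N.
    assert (B := edge_weight_bound N).
    assert (B0 : 0 <= rsum (edge_weight N) (box N)).
    { rewrite <- (Rmult_0_r (INR (length (box N)))).
      assert (Y : forall l : list (Z * Z), (forall v, In v l -> (nz v <= Z.of_nat N)%Z) ->
        0 <= rsum (edge_weight N) l).
      { induction l as [| v l IH]; simpl; intros Hl; [lra |].
        apply Rplus_le_le_0_compat; [| auto].
        assert (V := Hl v (or_introl eq_refl)). apply IZR_le in V.
        rewrite <- INR_IZR_INZ in V. pose proof (one_le_nz v).
        left. apply Rinv_0_lt_compat. apply Rmult_lt_0_compat; [apply pow_lt |]; lra. }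
      rewrite Rmult_0_r. apply Y. intros v Hv. now apply in_box. }
    pose proof (Rle_abs K). pose proof (Rle_abs (- K)). rewrite Rabs_Ropp in *.
    split; nra.
  - replace (Finite 0) with (Rbar_opp 0) by (simpl; f_equal; ring).
    now apply is_lim_seq_opp in X.
  - exact X.
Qed.

(** Comparing two points is essential: it removes the constant [center_sum2 n ^ 2] and gains one
    order of decay in the differences of [/ (z - w v) ^ 2] and [/ (z - w v)], which brings the
    boundary errors under [edge_weight]. *)
Lemma weier_sqr_sub_quartic_sum (z z0 : C) : ~ lat z -> ~ lat z0 ->
  (pe z ^ 2 - S4 z = pe z0 ^ 2 - S4 z0)%C.
Proof.
  intros N1 N0.
  set (D := fun z n => (csum (G z) (box n) ^ 2 - csum (F 4 z) (box n))%C).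
  assert (CD : forall z, ~ lat z -> cvg eventually (D z) (pe z ^ 2 - S4 z)%C).
  { intros y Ny. apply (cvg_minus eventually).
    - apply (cvg_pow eventually). now apply weier_term_cvg.
    - apply eis_term_cvg; auto. }
  assert (C1 := cvg_minus eventually _ _ _ _ (CD z N1) (CD z0 N0)).
  enough (C2 : cvg eventually (fun n => D z n - D z0 n)%C 0%C).
  { exact (Cminus_eq_0 _ _ (cvg_unique eventually _ _ _ C1 C2)). }
  destruct (off_lattice a b Ha Hb z N1) as [k1 [Hk1 [_ [_ D1]]]].
  destruct (off_lattice a b Ha Hb z0 N0) as [k0 [Hk0 [_ [_ D0]]]].
  set (k := Rmin k1 k0). assert (Hk : 0 < k) by (apply Rmin_pos; auto).
  assert (L1 : k <= k1) by apply Rmin_l. assert (L0 : k <= k0) by apply Rmin_r.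
  assert (B1 : forall v, k * (1 + IZR (nz v)) <= Cmod (z - w v)%C).
  { intros v. pose proof (one_le_nz v). eapply Rle_trans; [| apply D1]. nra. }
  assert (B0 : forall v, k * (1 + IZR (nz v)) <= Cmod (z0 - w v)%C).
  { intros v. pose proof (one_le_nz v). eapply Rle_trans; [| apply D0]. nra. }
  destruct edge_bounds as [K [HK EB]].
  set (M := Cmod (z0 - z)%C). assert (HM : 0 <= M) by apply Cmod_ge_0.
  set (Q := 4 * K * M * (/ k) ^ 3 + 4 * K * M * (/ k) ^ 2).
  apply (cvg_bound_0 eventually _ (fun n => Q * rsum (edge_weight n) (box n)));
    [| apply edge_sum_lim].
  exists 0%nat. intros n _.
  (* Completing the square: with [center_sum2 n] subtracted inside the square, the main term of
     [edge_sum2] is absorbed and only a constant independent of y is left over. *)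
  assert (ED : forall y, ~ lat y -> D y n =
    (2 * csum (fun v => (edge_sum2 (box n) v - center_sum2 n) * / (y - w v) ^ 2) (box n) +
     4 * csum (fun v => edge_sum3 (box n) v * / (y - w v)) (box n) + center_sum2 n ^ 2)%C).
  { intros y Ny. unfold D.
    assert (EF := eisenstein_finite (box n) y (NoDup_box n) Ny).
    assert (EG : csum (G y) (box n) = (csum (F 2 y) (box n) - center_sum2 n)%C).
    { unfold weier_term, center_sum2. rewrite csum_minus. f_equal. apply csum_ext.
      intros v _. now rewrite Cpow_inv_C. }
    rewrite (csum_ext (fun v => (edge_sum2 (box n) v - center_sum2 n) * / (y - w v) ^ 2)%C
      (fun v => edge_sum2 (box n) v * / (y - w v) ^ 2 - center_sum2 n * F 2 y v)%C)
      by (intros v _; unfold eis_term; ring).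
    rewrite csum_minus, csum_scal, EG.
    replace (csum (F 4 y) (box n)) with (csum (F 2 y) (box n) ^ 2
      - (csum (F 2 y) (box n) ^ 2 - csum (F 4 y) (box n)))%C by ring.
    rewrite EF. ring. }
  rewrite (ED z N1), (ED z0 N0).
  match goal with |- Cmod ?X <= _ => replace X with
    (csum (fun v => 2 * ((edge_sum2 (box n) v - center_sum2 n) * (/ (z - w v) ^ 2 - / (z0 - w v) ^ 2))
           + 4 * (edge_sum3 (box n) v * (/ (z - w v) - / (z0 - w v))))%C (box n)) end.
  2:{ rewrite csum_plus, !csum_scal.
      rewrite (csum_ext (fun v => (edge_sum2 (box n) v - center_sum2 n) * (/ (z - w v) ^ 2 - / (z0 - w v) ^ 2))%C
        (fun v => (edge_sum2 (box n) v - center_sum2 n) * / (z - w v) ^ 2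
                  - (edge_sum2 (box n) v - center_sum2 n) * / (z0 - w v) ^ 2)%C) by (intros; ring).
      rewrite (csum_ext (fun v => edge_sum3 (box n) v * (/ (z - w v) - / (z0 - w v)))%C
        (fun v => edge_sum3 (box n) v * / (z - w v) - edge_sum3 (box n) v * / (z0 - w v))%C)
        by (intros; ring).
      rewrite !csum_minus. ring. }
  rewrite <- rsum_scal. apply Cmod_csum_le. intros v Iv. apply in_box in Iv.
  destruct (EB n v Iv) as [EA EBv].
  pose proof (one_le_nz v) as V. specialize (B1 v). specialize (B0 v).
  apply IZR_le in Iv. rewrite <- INR_IZR_INZ in Iv.
  set (x := IZR (nz v)) in *.
  assert (Hr : 0 < k * (1 + x)) by nra.
  assert (Np := Cmod_pos_neq _ _ Hr B1). assert (Nq := Cmod_pos_neq _ _ Hr B0).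
  assert (Ip := Cmod_inv_le _ _ Hr B1). assert (Iq := Cmod_inv_le _ _ Hr B0).
  assert (Y2 : Cmod (/ (z - w v) ^ 2 - / (z0 - w v) ^ 2)%C <= M * (2 * (/ (k * (1 + x))) ^ 3)).
  { unfold M. replace (z0 - z)%C with (z0 - w v - (z - w v))%C by ring.
    now apply inv_sq_diff_bound. }
  assert (Y1 : Cmod (/ (z - w v) - / (z0 - w v))%C <= M * (/ (k * (1 + x))) ^ 2).
  { replace (/ (z - w v) - / (z0 - w v))%C with ((z0 - z) * (/ (z - w v) * / (z0 - w v)))%C
      by (field; auto).
    apply Cmod_mult_le; [apply Rle_refl |]. simpl. rewrite Rmult_1_r.
    now apply Cmod_mult_le. }
  eapply Rle_trans.
  { apply Cmod_plus_le; (apply Cmod_mult_le; [rewrite Cmod_R, Rabs_pos_eq; [apply Rle_refl | lra] |]);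
      apply Cmod_mult_le; [exact EA | exact Y2 | exact EBv | exact Y1]. }
  unfold Q, edge_weight. fold x.
  assert (Pd : 0 < INR n - x + 1) by lra.
  replace (INR n + 1 - x) with (INR n - x + 1) by ring.
  apply (Rmult_le_reg_r ((1 + x) ^ 3 * (INR n - x + 1))).
  { apply Rmult_lt_0_compat; [apply pow_lt; lra | exact Pd]. }
  match goal with |- ?l <= ?r =>
    replace l with (4 * K * M * (/ k) ^ 3 * x + 4 * K * M * (/ k) ^ 2 * (1 + x)) by (field; repeat split; lra);
    replace r with (4 * K * M * (/ k) ^ 3 * (1 + x) + 4 * K * M * (/ k) ^ 2 * (1 + x))
      by (field; repeat split; lra) end.
  assert (0 <= 4 * K * M * (/ k) ^ 3).
  { assert (0 < (/ k) ^ 3) by (apply pow_lt, Rinv_0_lt_compat, Hk).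
    apply Rmult_le_pos; [repeat apply Rmult_le_pos |]; lra. }
  nra.
Qed.

(** The constant of [weier_sqr_sub_quartic_sum], read off at a quarter-period; the factor 12 makes
    weier'' equal to 6 weier^2 - g2/2. *)
Definition invariant_g2 : C :=
  (12 * (pe ((a / 4)%R, (b / 4)%R) ^ 2 - S4 ((a / 4)%R, (b / 4)%R)))%C.

Local Notation g2 := invariant_g2.

Lemma not_lat_im (z : C) : (forall n : Z, Im z <> IZR n * b) -> ~ lat z.
Proof. intros H [v E]. apply (H (snd v)). rewrite E. reflexivity. Qed.

Lemma not_lat_re (z : C) : (forall n : Z, Re z <> IZR n * a) -> ~ lat z.
Proof. intros H [v E]. apply (H (fst v)). rewrite E. reflexivity. Qed.

Lemma fraction_not_multiple (c t : R) (m n : Z) :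
  0 < c -> 0 < t < 1 -> (IZR m + t) * c <> IZR n * c.
Proof.
  intros Hc Ht E. apply Rmult_eq_reg_r in E; [| lra].
  assert (A : IZR m < IZR n) by lra. apply lt_IZR in A.
  assert (B : IZR n < IZR (m + 1)) by (rewrite plus_IZR; lra). apply lt_IZR in B. lia.
Qed.

(** Two differentiations give weier'' = 6 times the quartic sum, which differs from 6 weier^2 by a
    constant. The second-order equation thus precedes the first-order one. *)
Lemma hasd_weier' (z : C) : ~ lat z -> hasd pe' z (6 * pe z ^ 2 - g2 / 2)%C.
Proof.
  intros N.
  assert (Nc : ~ lat ((a / 4)%R, (b / 4)%R)).
  { apply not_lat_re. intros n. simpl.
    replace (a / 4) with ((IZR 0 + / 4) * a) by field.
    apply fraction_not_multiple; lra. }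
  eapply hasd_eq; [apply hasd_scal, hasd_cube_sum; auto |].
  assert (E := weier_sqr_sub_quartic_sum z _ N Nc). unfold invariant_g2. rewrite <- E. field.
Qed.

(** Splitting off the origin index isolates the pole; the remaining terms have a bound that stays
    uniform as the point tends to 0. *)
Lemma lsum_near_zero (f : Z * Z -> C) (l : C) (K : R) :
  0 <= K -> cvg eventually (fun N => csum f (box N)) l ->
  (forall v, (0 < nz v)%Z -> Cmod (f v) <= K / (1 + IZR (nz v)) ^ 3) ->
  Cmod (l - f (0, 0)%Z)%C <= 17 * K.
Proof.
  intros HK Hl Hf.
  apply (cvg_Cmod_le eventually (fun N => csum f (box N) - f (0, 0)%Z)%C).
  - exists 0%nat. intros N _.
    destruct (NoDup_incl_complement [(0, 0)%Z] (box N)) as [r Hr].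
    + constructor; [intros [] | constructor].
    + intros v [<- | []]. apply in_box. unfold nz; simpl; lia.
    + rewrite (csum_perm _ _ _ Hr). simpl.
      replace (f (0, 0)%Z + csum f r - f (0, 0)%Z)%C with (csum f r) by ring.
      eapply Rle_trans; [| apply (rsum_cube_le K N HK)].
      rewrite (rsum_perm _ _ _ Hr). cbn [app rsum fold_right].
      fold (rsum (fun v => K / (1 + IZR (nz v)) ^ 3) r).
      assert (B : Cmod (csum f r) <= rsum (fun v => K / (1 + IZR (nz v)) ^ 3) r).
      { apply Cmod_csum_le. intros v Iv. apply Hf.
        assert (ND := Permutation_NoDup Hr (NoDup_box N)). inversion_clear ND as [| ? ? N1 _].
        apply Z.nle_gt. intros Z0. apply nz_0 in Z0. subst v. contradiction. }
      assert (0 <= K / (1 + IZR (nz (0, 0)%Z)) ^ 3).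
      { apply Rdiv_le_0_compat; [exact HK |]. apply pow_lt. pose proof (one_le_nz (0, 0)%Z). lra. }
      lra.
  - apply (cvg_minus eventually); [exact Hl | apply (cvg_const eventually)].
Qed.

Lemma near_zero_not_lat :
  exists kap, 0 < kap /\ forall z : C, z <> 0%C -> Cmod z <= kap -> ~ lat z.
Proof.
  destruct (near_zero a b Ha Hb) as [k [Hk [_ D]]].
  exists k; split; [exact Hk |]. intros z Nz Hz [v E].
  destruct (Z.le_gt_cases (nz v) 0) as [L | L].
  - apply nz_0 in L. subst v. apply Nz. rewrite E. apply lpoint_0.
  - assert (X := D z v Hz L). rewrite <- E in X.
    replace (z - z)%C with (RtoC 0) in X by ring. rewrite Cmod_0 in X.
    pose proof (one_le_nz v). nra.
Qed.

Lemma principal_part (f : C -> C) (c : C) (s : nat) (M : R) :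
  (1 <= s)%nat -> at0 (fun h => Cmod (f h - c / h ^ s)%C <= M) ->
  cvg at0 (fun h => h ^ s * f h)%C c.
Proof.
  intros Hs [d [Hd H]].
  assert (HM : 0 <= M).
  { assert (X := H (RtoC (d / 2))).
    eapply Rle_trans; [apply Cmod_ge_0 | apply X].
    - intros E. apply RtoC_inj in E. lra.
    - rewrite Cmod_R, Rabs_pos_eq; lra. }
  apply (cvg_bound_0 at0 _ (fun h => Cmod h * M)).
  - exists (Rmin d 1). split; [apply Rmin_pos; lra |]. intros h Nh Lh.
    assert (L1 := Rlt_le_trans _ _ _ Lh (Rmin_l _ _)).
    assert (L2 := Rlt_le_trans _ _ _ Lh (Rmin_r _ _)).
    replace (h ^ s * f h - c)%C with (h ^ s * (f h - c / h ^ s))%C.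
    2:{ field. now apply Cpow_nz. }
    apply Cmod_mult_le; [| now apply H].
    rewrite Cmod_pow. destruct s as [| s]; [lia |]. simpl.
    assert (X : Cmod h ^ s <= 1 ^ s) by (apply pow_incr; split; [apply Cmod_ge_0 | lra]).
    rewrite pow1 in X. pose proof (Cmod_ge_0 h). nra.
  - intros P [e He].
    exists (e / (M + 1)). split; [apply Rdiv_lt_0_compat; [apply cond_pos | lra] |].
    intros h _ Lh. apply He. change (Rabs (Cmod h * M - 0) < e).
    pose proof (Cmod_ge_0 h).
    rewrite Rminus_0_r, Rabs_pos_eq by nra.
    apply Rlt_div_r in Lh; [| lra]. nra.
Qed.

Lemma weier_pole : cvg at0 (fun h => h ^ 2 * pe h)%C 1%C.
Proof.
  destruct (near_zero a b Ha Hb) as [k [Hk [Hk1 D]]].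
  destruct near_zero_not_lat as [k' [Hk' N']].
  assert (K3 : 0 < (/ k) ^ 3) by apply pow_lt, Rinv_0_lt_compat, Hk.
  apply (principal_part _ _ 2 (17 * (1 * (2 * (/ k) ^ 3)))); [lia |].
  exists (Rmin k k'). split; [now apply Rmin_pos |]. intros h Nh Lh.
  assert (L1 := Rlt_le_trans _ _ _ Lh (Rmin_l _ _)).
  assert (L2 := Rlt_le_trans _ _ _ Lh (Rmin_r _ _)).
  replace (1 / h ^ 2)%C with (G h (0, 0)%Z).
  2:{ unfold weier_term. rewrite lpoint_0, (Cpow_inv_C 0), Cinv_0.
      replace (h - 0)%C with h by ring. field. exact Nh. }
  apply lsum_near_zero.
  - lra.
  - apply weier_term_cvg; auto. apply N'; auto. lra.
  - intros v Hv. eapply Rle_trans; [apply (weier_term_bound a b k); auto |].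
    + apply D; [lra | exact Hv].
    + replace (- w v)%C with (0 - w v)%C by ring. apply D; [rewrite Cmod_0; lra | exact Hv].
    + apply Rmult_le_compat_r.
      * left. apply Rinv_0_lt_compat, pow_lt. pose proof (one_le_nz v); lra.
      * apply Rmult_le_compat_r; lra.
Qed.

Lemma weier'_pole : cvg at0 (fun h => h ^ 3 * pe' h)%C (-2)%C.
Proof.
  destruct (near_zero a b Ha Hb) as [k [Hk [Hk1 D]]].
  destruct near_zero_not_lat as [k' [Hk' N']].
  assert (K3 : 0 < (/ k) ^ 3) by apply pow_lt, Rinv_0_lt_compat, Hk.
  enough (X : cvg at0 (fun h => h ^ 3 * S3 h)%C 1%C).
  { apply (cvg_scal at0 (-2)%C) in X. replace (-2 * 1)%C with (RtoC (-2)) in X by ring.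
    refine (cvg_at0_ext _ _ _ _ X). intros h _. unfold weier'. ring. }
  apply (principal_part _ _ 3 (17 * (/ k) ^ 3)); [lia |].
  exists (Rmin k k'). split; [now apply Rmin_pos |]. intros h Nh Lh.
  assert (L1 := Rlt_le_trans _ _ _ Lh (Rmin_l _ _)).
  assert (L2 := Rlt_le_trans _ _ _ Lh (Rmin_r _ _)).
  replace (1 / h ^ 3)%C with (F 3 h (0, 0)%Z).
  2:{ unfold eis_term. rewrite lpoint_0. replace (h - 0)%C with h by ring. field. exact Nh. }
  apply lsum_near_zero.
  - lra.
  - apply eis_term_cvg; auto. apply N'; auto. lra.
  - intros v Hv. apply eis_term_bound; [exact Hk | lia |]. apply D; [lra | exact Hv].
Qed.

End Eisenstein.

(** * Linear systems along L-shaped paths *)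

(** The product of [E t] and [exp (- K * t)] is nonincreasing, starts at 0 and is nonnegative. *)
Lemma gronwall_zero (E dE : R -> R) (K : R) :
  (forall t, 0 <= t <= 1 -> is_derive E t (dE t)) ->
  (forall t, 0 <= t <= 1 -> dE t <= K * E t) ->
  (forall t, 0 <= E t) -> E 0 = 0 -> E 1 = 0.
Proof.
  intros HD HK Hp H0.
  set (f := fun t => E t * exp (- K * t)).
  set (df := fun t => dE t * exp (- K * t) + E t * (- K * exp (- K * t))).
  assert (Df : forall t, 0 <= t <= 1 -> is_derive f t (df t)).
  { intros t Ht. unfold f, df.
    apply (is_derive_mult (K := R_AbsRing) E (fun s => exp (- K * s)) t (dE t)).
    - now apply HD.
    - auto_derive; [exact I | ring].
    - intros n m. apply Rmult_comm. }
  destruct (MVT_gen f 0 1 df) as [c [Hc Ec]].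
  - intros x Hx. rewrite Rmin_left, Rmax_right in Hx by lra. apply Df; lra.
  - intros x Hx. rewrite Rmin_left, Rmax_right in Hx by lra.
    apply derivable_continuous_pt. exists (df x). apply is_derive_Reals, Df; lra.
  - rewrite Rmin_left, Rmax_right in Hc by lra.
    assert (Dc : df c <= 0).
    { unfold df. specialize (HK c Hc). assert (P := exp_pos (- K * c)). nra. }
    unfold f in Ec. rewrite H0 in Ec.
    assert (P := exp_pos (- K * 1)). specialize (Hp 1). nra.
Qed.

Lemma contc_Cmod_path (f : C -> C) (p d : C) (t : R) :
  contc f (p + RtoC t * d)%C -> continuity_pt (fun s => Cmod (f (p + RtoC s * d)%C)) t.
Proof.
  intros H eps He.
  destruct (classic (d = 0%C)) as [-> | Nd].
  { exists 1. split; [lra |]. refine (fun (x : R) _ => _).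
    change (Rabs (Cmod (f (p + RtoC x * 0)%C) - Cmod (f (p + RtoC t * 0)%C)) < eps).
    replace (p + RtoC x * 0)%C with (p + RtoC t * 0)%C by ring.
    rewrite Rminus_diag, Rabs_R0. exact He. }
  destruct (proj1 (cvg_eps at0 _ _) H eps He) as [r [Hr K]].
  assert (Pd := proj1 (Cmod_gt_0 d) Nd).
  exists (r / Cmod d). split; [now apply Rdiv_lt_0_compat |].
  refine (fun (x : R) Hx => _). destruct Hx as [[_ Nx] Lx]. change (Rabs (x - t) < r / Cmod d) in Lx.
  change (Rabs (Cmod (f (p + RtoC x * d)%C) - Cmod (f (p + RtoC t * d)%C)) < eps).
  specialize (K (RtoC (x - t) * d)%C).
  assert (X : Cmod (f (p + RtoC t * d + RtoC (x - t) * d) - f (p + RtoC t * d))%C < eps).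
  { apply K.
    - apply Cmult_neq_0; [| exact Nd]. intros E. apply RtoC_inj in E. apply Nx. lra.
    - rewrite Cmod_mult, Cmod_R. apply Rlt_div_r; assumption. }
  replace (p + RtoC t * d + RtoC (x - t) * d)%C with (p + RtoC x * d)%C in X
    by (rewrite RtoC_minus; ring).
  eapply Rle_lt_trans; [| exact X].
  set (u := f (p + RtoC x * d)%C). set (v := f (p + RtoC t * d)%C).
  assert (A := Cmod_triangle (u - v)%C v). replace (u - v + v)%C with u in A by ring.
  assert (B := Cmod_triangle (- (u - v))%C u). replace (- (u - v) + u)%C with v in B by ring.
  rewrite Cmod_opp in B. apply Rabs_le. lra.
Qed.

Lemma bounded_on_segment (f : C -> C) (p d : C) :
  (forall t, 0 <= t <= 1 -> contc f (p + RtoC t * d)%C) ->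
  exists K, 0 <= K /\ forall t, 0 <= t <= 1 -> Cmod (f (p + RtoC t * d)%C) <= K.
Proof.
  intros H.
  destruct (continuity_ab_maj (fun s => Cmod (f (p + RtoC s * d)%C)) 0 1) as [m [Hm _]].
  - lra.
  - intros t Ht. now apply contc_Cmod_path, H.
  - exists (Cmod (f (p + RtoC m * d)%C)). split; [apply Cmod_ge_0 | exact Hm].
Qed.

Lemma Re_inner_le (x y : C) : Re x * Re y + Im x * Im y <= Cmod x * Cmod y.
Proof.
  replace (Re x * Re y + Im x * Im y) with (Re (x * Cconj y)%C) by (unfold Re, Im; simpl; ring).
  eapply Rle_trans; [apply Rle_abs |]. eapply Rle_trans; [apply re_le_Cmod |].
  rewrite Cmod_mult, Cmod_conj. lra.
Qed.

Lemma is_derive_sum_sqr (u v : R -> R) (t du dv : R) :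
  is_derive u t du -> is_derive v t dv ->
  is_derive (fun s => u s ^ 2 + v s ^ 2) t (2 * (u t * du + v t * dv)).
Proof.
  intros H1 H2. auto_derive.
  - split; [eexists; exact H1 | split; [eexists; exact H2 | exact I]].
  - replace (Derive (fun x : R => u x) t) with du by (symmetry; apply is_derive_unique, H1).
    replace (Derive (fun x : R => v x) t) with dv by (symmetry; apply is_derive_unique, H2).
    ring.
Qed.

Lemma is_derive_Cmod_sqr (f : C -> C) (p d l : C) (t : R) :
  hasd f (p + RtoC t * d)%C l ->
  is_derive (fun s => Re (f (p + RtoC s * d)%C) ^ 2 + Im (f (p + RtoC s * d)%C) ^ 2) t
    (2 * (Re (f (p + RtoC t * d)%C) * Re (d * l)%C + Im (f (p + RtoC t * d)%C) * Im (d * l)%C)).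
Proof.
  intros H. destruct (hasd_path f p d l t H) as [H1 H2].
  exact (is_derive_sum_sqr _ _ t _ _ H1 H2).
Qed.

(** The shape follows a product AB of two functions with known second derivatives: (AB)'' contains
    2A'B', which becomes the third unknown and explains the factor 2. Second-order equations are the
    case X3 = 0. Continuous coefficients are bounded on the segment, so Gronwall applies to the sum
    of squared moduli. *)
Lemma linear_system_zero (X1 X2 X3 al be ga : C -> C) (p d : C) :
  (forall t, 0 <= t <= 1 -> let z := (p + RtoC t * d)%C in
     hasd X1 z (X2 z) /\ hasd X2 z (al z * X1 z + 2 * X3 z)%C /\
     hasd X3 z (be z * X2 z + ga z * X1 z)%C /\ contc al z /\ contc be z /\ contc ga z) ->
  X1 p = 0%C -> X2 p = 0%C -> X3 p = 0%C ->
  X1 (p + d)%C = 0%C /\ X2 (p + d)%C = 0%C /\ X3 (p + d)%C = 0%C.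
Proof.
  intros H Z1 Z2 Z3.
  destruct (bounded_on_segment al p d) as [Ka [Pa Ba]]; [intros t Ht; apply (H t Ht) |].
  destruct (bounded_on_segment be p d) as [Kb [Pb Bb]]; [intros t Ht; apply (H t Ht) |].
  destruct (bounded_on_segment ga p d) as [Kg [Pg Bg]]; [intros t Ht; apply (H t Ht) |].
  set (K := Cmod d * (1 + Ka + 2 + Kb + Kg)).
  pose proof (Cmod_ge_0 d) as Pd.
  assert (HK : 0 <= K) by (unfold K; nra).
  set (N := fun (X : C -> C) t => Re (X (p + RtoC t * d)%C) ^ 2 + Im (X (p + RtoC t * d)%C) ^ 2).
  assert (NE : forall X t, N X t = Cmod (X (p + RtoC t * d)%C) ^ 2).
  { intros X t. unfold N. now rewrite Cmod2_alt. }
  set (I := fun (X : C -> C) (l : C) t => 2 * (Re (X (p + RtoC t * d)%C) * Re (d * l)%C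
              + Im (X (p + RtoC t * d)%C) * Im (d * l)%C)).
  (* With S the sum of the three moduli, the derivative of the energy is at most 2 K S^2, and S^2 is
     at most three times the energy; hence the rate 6K. *)
  assert (R1 : N X1 1 + N X2 1 + N X3 1 = 0).
  { apply (gronwall_zero (fun t => N X1 t + N X2 t + N X3 t)
      (fun t => let z := (p + RtoC t * d)%C in
         I X1 (X2 z) t + I X2 (al z * X1 z + 2 * X3 z)%C t
         + I X3 (be z * X2 z + ga z * X1 z)%C t) (6 * K)).
    - intros t Ht. destruct (H t Ht) as [D1 [D2 [D3 _]]].
      apply (is_derive_plus (V := R_NormedModule) (fun t => N X1 t + N X2 t) (N X3)).
      + apply (is_derive_plus (V := R_NormedModule) (N X1) (N X2)).
        * now apply is_derive_Cmod_sqr.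
        * now apply is_derive_Cmod_sqr.
      + now apply is_derive_Cmod_sqr.
    - intros t Ht. cbv zeta. rewrite !NE.
      specialize (Ba t Ht). specialize (Bb t Ht). specialize (Bg t Ht).
      unfold I. set (z := (p + RtoC t * d)%C) in *.
      set (x1 := Cmod (X1 z)). set (x2 := Cmod (X2 z)). set (x3 := Cmod (X3 z)).
      assert (P1' : 0 <= x1) by apply Cmod_ge_0. assert (P2' : 0 <= x2) by apply Cmod_ge_0.
      assert (P3' : 0 <= x3) by apply Cmod_ge_0.
      set (S := x1 + x2 + x3).
      assert (Q : forall X l, Cmod l <= (1 + Ka + 2 + Kb + Kg) * S ->
        Re (X z) * Re (d * l)%C + Im (X z) * Im (d * l)%C <= Cmod (X z) * (K * S)).
      { intros X l Hl. eapply Rle_trans; [apply Re_inner_le |].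
        apply Rmult_le_compat_l; [apply Cmod_ge_0 |].
        unfold K. rewrite Rmult_assoc, Cmod_mult. now apply Rmult_le_compat_l. }
      assert (Q1 := Q X1 (X2 z)).
      assert (Q2 := Q X2 (al z * X1 z + 2 * X3 z)%C).
      assert (Q3 := Q X3 (be z * X2 z + ga z * X1 z)%C).
      fold x1 in Q1. fold x2 in Q2. fold x3 in Q3.
      assert (T1 : Cmod (X2 z) <= (1 + Ka + 2 + Kb + Kg) * S) by (fold x2; unfold S; nra).
      assert (T2 : Cmod (al z * X1 z + 2 * X3 z)%C <= (1 + Ka + 2 + Kb + Kg) * S).
      { apply Rle_trans with (Ka * x1 + 2 * x3).
        - apply Cmod_plus_le; apply Cmod_mult_le; try (apply Rle_refl); [exact Ba |].
          rewrite Cmod_R, Rabs_pos_eq; lra.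
        - unfold S; nra. }
      assert (T3 : Cmod (be z * X2 z + ga z * X1 z)%C <= (1 + Ka + 2 + Kb + Kg) * S).
      { apply Rle_trans with (Kb * x2 + Kg * x1).
        - apply Cmod_plus_le; apply Cmod_mult_le; try (apply Rle_refl); assumption.
        - unfold S; nra. }
      specialize (Q1 T1). specialize (Q2 T2). specialize (Q3 T3).
      assert (SS : S * S <= 3 * (x1 ^ 2 + x2 ^ 2 + x3 ^ 2)) by
        (unfold S; pose proof (pow2_ge_0 (x1 - x2)); pose proof (pow2_ge_0 (x2 - x3));
         pose proof (pow2_ge_0 (x1 - x3)); lra).
      assert (KS : K * (S * S) <= K * (3 * (x1 ^ 2 + x2 ^ 2 + x3 ^ 2)))
        by (apply Rmult_le_compat_l; assumption).
      replace (K * (S * S)) with (x1 * (K * S) + x2 * (K * S) + x3 * (K * S)) in KS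
        by (unfold S; ring).
      lra.
    - intros t. unfold N. nra.
    - unfold N. replace (p + RtoC 0 * d)%C with p by ring. rewrite Z1, Z2, Z3. simpl. ring. }
  rewrite !NE in R1. replace (p + RtoC 1 * d)%C with (p + d)%C in R1 by ring.
  pose proof (pow2_ge_0 (Cmod (X1 (p + d)%C))). pose proof (pow2_ge_0 (Cmod (X2 (p + d)%C))).
  pose proof (pow2_ge_0 (Cmod (X3 (p + d)%C))).
  repeat split; apply Cmod_eq_0; apply Rsqr_0_uniq; unfold Rsqr; nra.
Qed.

Lemma constant_on_segment (f : C -> C) (p d : C) :
  (forall t, 0 <= t <= 1 -> hasd f (p + RtoC t * d)%C 0%C) -> f (p + d)%C = f p.
Proof.
  intros H.
  enough (X : (f (p + d) - f p)%C = 0%C).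
  { exact (Cminus_eq_0 _ _ X). }
  refine (proj1 (linear_system_zero (fun z => f z - f p)%C (fun _ => 0%C) (fun _ => 0%C)
    (fun _ => 0%C) (fun _ => 0%C) (fun _ => 0%C) p d _ _ _ _)).
  - intros t Ht z.
    assert (Cc : contc (fun _ => RtoC 0) z) by apply (cvg_const at0).
    refine (conj _ (conj _ (conj _ (conj Cc (conj Cc Cc))))); cbv beta.
    + apply (hasd_eq _ _ (0 - 0)%C); [| ring].
      apply hasd_minus; [now apply H | apply hasd_const].
    + eapply hasd_eq; [apply hasd_const | ring].
    + eapply hasd_eq; [apply hasd_const | ring].
  - ring.
  - reflexivity.
  - reflexivity.
Qed.

(** * Connecting points by axis-parallel segments *)

Section Connect.
Variables (a b : R).
Hypotheses (Ha : 0 < a) (Hb : 0 < b).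
Local Notation lat := (in_lat a b).

(** Separates the geometry of the paths from the analysis: vanishing of a linear system, constancy
    and agreement of signs are all transported this way. *)
Definition propagates (Good Q : C -> Prop) : Prop :=
  forall p d, (forall t, 0 <= t <= 1 -> Good (p + RtoC t * d)%C) -> Q p -> Q (p + d)%C.

(** Neither coordinate of [c] lies on the grid, so both axis-parallel lines through [c] are free. If
    [u] lies on a horizontal grid line, its vertical line is free and is used last; otherwise its
    horizontal line is. *)
Lemma connect_from_generic (Good Q : C -> Prop) (c u : C) :
  (forall z, ~ lat z -> Good z) -> propagates Good Q ->
  (forall n : Z, Re c <> IZR n * a) -> (forall n : Z, Im c <> IZR n * b) ->
  Q c -> ~ lat u -> Q u.
Proof.
  intros HG HP Cre Cim Qc Hu.
  destruct c as [cx cy]; destruct u as [ux uy]; simpl in Cre, Cim.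
  destruct (classic (exists n : Z, uy = IZR n * b)) as [[n Hn] | Him].
  - assert (Hre : forall m : Z, ux <> IZR m * a).
    { intros m Hm. apply Hu. exists (m, n). now apply C_eq. }
    assert (Q1 : Q ((cx, cy) + ((ux - cx)%R, 0))%C).
    { apply HP; [| exact Qc]. intros t _. apply HG, not_lat_im. intros m. simpl.
      replace (cy + (t * 0 + 0 * (ux - cx))) with (cy) by ring. apply Cim. }
    replace (ux, uy) with ((cx, cy) + ((ux - cx)%R, 0) + (0, (uy - cy)%R))%C.
    + apply HP; [| exact Q1]. intros t _. apply HG, not_lat_re. intros m. simpl.
      replace (cx + (ux - cx) + (t * 0 - 0 * (uy - cy))) with (ux) by ring.
      apply Hre.
    + apply C_eq; simpl; ring.
  - assert (Q1 : Q ((cx, cy) + (0, (uy - cy)%R))%C).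
    { apply HP; [| exact Qc]. intros t _. apply HG, not_lat_re. intros m. simpl.
      replace (cx + (t * 0 - 0 * (uy - cy))) with (cx) by ring. apply Cre. }
    replace (ux, uy) with ((cx, cy) + (0, (uy - cy)%R) + ((ux - cx)%R, 0))%C.
    + apply HP; [| exact Q1]. intros t _. apply HG, not_lat_im. intros m. simpl.
      replace (cy + (uy - cy) + (t * 0 + 0 * (ux - cx))) with (uy) by ring.
      intros E. apply Him. now exists m.
    + apply C_eq; simpl; ring.
Qed.

(** Half a cell to the right and half a cell up lead from a grid point to a generic one. This serves
    with the half-lattice as grid, where a half-period can be a good starting point although it is a
    grid point. *)
Lemma connect_from_lattice (Good Q : C -> Prop) (s u : C) :
  (forall z, ~ lat z -> Good z) -> propagates Good Q ->
  lat s -> Good s -> Q s -> ~ lat u -> Q u.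
Proof.
  intros HG HP [v Hs] Gs Qs Hu.
  assert (Q1 : Q (s + ((/ 2 * a)%R, 0))%C).
  { apply HP; [| exact Qs]. intros t Ht.
    (* Only the starting point of this segment is on the grid, and it is good by assumption. *)
    destruct (Req_dec t 0) as [-> | Nt].
    - now replace (s + 0 * ((/ 2 * a)%R, 0))%C with s by ring.
    - apply HG, not_lat_re. intros m. rewrite Hs. simpl.
      replace (IZR (fst v) * a + (t * (/ 2 * a) - 0 * 0)) with ((IZR (fst v) + t / 2) * a) by field.
      apply fraction_not_multiple; lra. }
  assert (Q2 : Q (s + ((/ 2 * a)%R, 0) + (0, (/ 2 * b)%R))%C).
  { apply HP; [| exact Q1]. intros t Ht. apply HG, not_lat_re. intros m. rewrite Hs. simpl.
    replace (IZR (fst v) * a + / 2 * a + (t * 0 - 0 * (/ 2 * b)))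
      with ((IZR (fst v) + / 2) * a) by ring.
    apply fraction_not_multiple; lra. }
  apply (connect_from_generic Good Q (s + ((/ 2 * a)%R, 0) + (0, (/ 2 * b)%R))%C); auto.
  - intros m. rewrite Hs. simpl.
    replace (IZR (fst v) * a + / 2 * a + 0) with ((IZR (fst v) + / 2) * a) by ring.
    apply fraction_not_multiple; lra.
  - intros m. rewrite Hs. simpl.
    replace (IZR (snd v) * b + 0 + / 2 * b) with ((IZR (snd v) + / 2) * b) by ring.
    apply fraction_not_multiple; lra.
Qed.

End Connect.

(** * Half-periods and duplication *)

Section WeierstrassAlgebra.
Variables (a b : R).
Hypotheses (Ha : 0 < a) (Hb : 0 < b).

Local Notation lat := (in_lat a b).
Local Notation pe := (weier a b).
Local Notation pe' := (weier' a b).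
Local Notation g2 := (invariant_g2 a b).

Definition in_halflat (z : C) : Prop := lat (2 * z)%C.

Local Notation halflat := in_halflat.

Lemma halflat_lat (z : C) : in_lat (a / 2) (b / 2) z <-> halflat z.
Proof.
  unfold in_halflat, in_lat, lpoint. split; intros [v E]; exists v.
  - rewrite E. apply C_eq; simpl; field.
  - replace z with (/ 2 * (2 * z))%C by field. rewrite E. apply C_eq; simpl; field.
Qed.

Lemma lat_0 : lat 0%C.
Proof. exists (0, 0)%Z. now rewrite lpoint_0. Qed.

Lemma halflat_0 : halflat 0%C.
Proof. unfold in_halflat. replace (2 * 0)%C with (RtoC 0) by ring. exact lat_0. Qed.

Lemma lat_plus (x y : C) : lat x -> lat y -> lat (x + y)%C.
Proof.
  intros [u ->] [v ->]. exists (fst u + fst v, snd u + snd v)%Z.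
  apply C_eq; unfold lpoint; simpl; rewrite plus_IZR; ring.
Qed.

Lemma lat_opp (x : C) : lat x -> lat (- x)%C.
Proof. intros [u ->]. exists (- fst u, - snd u)%Z. now rewrite lpoint_opp. Qed.

Lemma lat_halflat (z : C) : lat z -> halflat z.
Proof.
  intros H. unfold in_halflat. replace (2 * z)%C with (z + z)%C by ring. now apply lat_plus.
Qed.

Lemma halflat_plus (x y : C) : halflat x -> halflat y -> halflat (x + y)%C.
Proof.
  unfold in_halflat. intros H K. replace (2 * (x + y))%C with (2 * x + 2 * y)%C by ring.
  now apply lat_plus.
Qed.

Lemma halflat_opp (x : C) : halflat x -> halflat (- x)%C.
Proof.
  unfold in_halflat. intros H. replace (2 * - x)%C with (- (2 * x))%C by ring.
  now apply lat_opp.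
Qed.

Lemma not_lat_shift (z h : C) : halflat h -> ~ halflat z -> ~ lat (z + h)%C.
Proof.
  intros Hh Hz L. apply Hz. replace z with (z + h + - h)%C by ring.
  apply halflat_plus; [now apply lat_halflat | now apply halflat_opp].
Qed.

Lemma not_halflat_lat (z : C) : ~ halflat z -> ~ lat z.
Proof. intros H L. apply H, lat_halflat, L. Qed.

Lemma connect_half (Good Q : C -> Prop) (s u : C) :
  (forall z, ~ halflat z -> Good z) -> propagates Good Q ->
  halflat s -> Good s -> Q s -> ~ halflat u -> Q u.
Proof.
  intros HG HP Hs Gs Qs Hu.
  apply (connect_from_lattice (a / 2) (b / 2) ltac:(lra) ltac:(lra) Good Q s u); auto.
  - intros z Hz. apply HG. intros L. now apply Hz, halflat_lat.
  - now apply halflat_lat.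
  - intros L. now apply Hu, halflat_lat.
Qed.

Lemma weier'_periodic_lat (z l : C) : lat l -> ~ lat z -> pe' (z + l)%C = pe' z.
Proof. intros [v ->] N. now apply weier'_periodic. Qed.

Lemma not_lat_opp (z : C) : ~ lat z -> ~ lat (- z)%C.
Proof.
  intros N L. apply N. replace z with (- - z)%C by ring. now apply lat_opp.
Qed.

Lemma C_double_zero (x : C) : (x + x)%C = 0%C -> x = 0%C.
Proof.
  intros E. replace x with (/ 2 * (x + x))%C by field. rewrite E. ring.
Qed.

(** [h] and [- h] differ by the period [2 * h], and the derivative is odd. *)
Lemma weier'_half_period (h : C) : halflat h -> ~ lat h -> pe' h = 0%C.
Proof.
  intros Hh Nh. apply C_double_zero.
  assert (E := weier'_periodic_lat (- h)%C (2 * h)%C Hh (not_lat_opp h Nh)).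
  replace (- h + 2 * h)%C with h in E by ring.
  rewrite weier'_odd in E. rewrite E at 1. ring.
Qed.

(** Generic for the half-lattice as well as for the lattice, and its double is the third
    half-period, which makes it a starting point for the duplication formula. *)
Definition center : C := ((a / 4)%R, (b / 4)%R).

Definition invariant_g3 : C := (4 * pe center ^ 3 - g2 * pe center - pe' center ^ 2)%C.

Local Notation g3 := invariant_g3.

(** The derivative is 2 weier' times the second-order equation. The constant value of this
    expression is [- invariant_g3]. *)
Lemma hasd_first_integral (z : C) : ~ lat z ->
  hasd (fun z => pe' z * pe' z - 4 * (pe z * (pe z * pe z)) + g2 * pe z)%C z 0%C.
Proof.
  intros N. pose proof (hasd_weier a b Ha Hb z N) as D0. pose proof (hasd_weier' a b Ha Hb z N) as D1.
  eapply hasd_eq.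
  - apply hasd_plus; [apply hasd_minus | apply hasd_scal; exact D0].
    + apply hasd_mult; exact D1.
    + apply hasd_scal, hasd_mult; [exact D0 | apply hasd_mult; exact D0].
  - simpl. field.
Qed.

Lemma center_generic_re (n : Z) : Re center <> IZR n * (a / 2).
Proof.
  simpl. replace (a / 4) with ((IZR 0 + / 2) * (a / 2)) by (simpl; field).
  apply fraction_not_multiple; lra.
Qed.

Lemma center_generic_im (n : Z) : Im center <> IZR n * (b / 2).
Proof.
  simpl. replace (b / 4) with ((IZR 0 + / 2) * (b / 2)) by (simpl; field).
  apply fraction_not_multiple; lra.
Qed.

Lemma weier'_sqr (z : C) : ~ lat z ->
  (pe' z ^ 2 = 4 * pe z ^ 3 - g2 * pe z - g3)%C.
Proof.
  intros N.
  set (I := fun z => (pe' z * pe' z - 4 * (pe z * (pe z * pe z)) + g2 * pe z)%C).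
  enough (E : I z = I center).
  { unfold invariant_g3. replace (pe' z ^ 2)%C with (I z + 4 * pe z ^ 3 - g2 * pe z)%C
      by (unfold I; ring).
    rewrite E. unfold I. ring. }
  apply (connect_from_generic a b (fun z => ~ lat z) (fun z => I z = I center) center z); auto.
  - intros p d Hg Hp. rewrite <- Hp. apply (constant_on_segment I).
    intros t Ht. apply hasd_first_integral, Hg, Ht.
  - intros n E. apply (center_generic_re (2 * n)). rewrite E, mult_IZR. field.
  - intros n E. apply (center_generic_im (2 * n)). rewrite E, mult_IZR. field.
Qed.

Lemma hasd_weier_shift (z h : C) : ~ lat (z + h)%C ->
  hasd (fun u => pe (u + h)%C) z (pe' (z + h)%C).
Proof. intros N. apply hasd_shift, hasd_weier; auto. Qed.

Lemma hasd_weier'_shift (z h : C) : ~ lat (z + h)%C ->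
  hasd (fun u => pe' (u + h)%C) z (6 * pe (z + h)%C ^ 2 - g2 / 2)%C.
Proof. intros N. apply (hasd_shift pe'), hasd_weier'; auto. Qed.

Lemma contc_const (c z : C) : contc (fun _ => c) z.
Proof. apply (cvg_const at0). Qed.

Lemma at0_not_halflat (s : C) : halflat s -> at0 (fun t => ~ halflat (s + t)%C).
Proof.
  intros Hs. destruct (near_zero_not_lat a b Ha Hb) as [k [Hk N]].
  assert (K : at0 (fun t => ~ lat t)).
  { exists k; split; [exact Hk |]. intros t Nt Lt. apply N; auto; lra. }
  refine (filter_imp _ _ _ (at0_double _ K)). intros t Nt L. apply Nt.
  change (halflat t). replace t with (s + t + - s)%C by ring.
  apply halflat_plus; [exact L | now apply halflat_opp].
Qed.

(* If the values agreed, the translates of weier by h1 and h2 would solve the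
   same second-order equation with the same data at 0, although they have
   different poles. *)
Lemma half_values_distinct (h1 h2 : C) :
  halflat h1 -> halflat h2 -> ~ lat h1 -> ~ lat h2 -> ~ lat (h2 - h1)%C ->
  pe h1 <> pe h2.
Proof.
  intros H1 H2 N1 N2 N12 E.
  assert (S : forall u, ~ halflat u -> pe (u + h1)%C = pe (u + h2)%C).
  { intros u Hu.
    enough (X : (pe (u + h1) - pe (u + h2))%C = 0%C /\ (pe' (u + h1) - pe' (u + h2))%C = 0%C).
    { exact (Cminus_eq_0 _ _ (proj1 X)). }
    apply (connect_half (fun z => ~ lat (z + h1)%C /\ ~ lat (z + h2)%C)
      (fun z => (pe (z + h1) - pe (z + h2))%C = 0%C /\ (pe' (z + h1) - pe' (z + h2))%C = 0%C) 0%C);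
      auto.
    - intros z Hz. split; now apply not_lat_shift.
    - intros p d Hg [Q0 Q1].
      destruct (linear_system_zero (fun z => pe (z + h1) - pe (z + h2))%C
        (fun z => pe' (z + h1) - pe' (z + h2))%C (fun _ => 0%C)
        (fun z => 6 * (pe (z + h1) + pe (z + h2)))%C (fun _ => 0%C) (fun _ => 0%C) p d)
        as [R0 [R1 _]]; auto.
      intros t Ht z. destruct (Hg t Ht) as [G1 G2]. fold z in G1, G2.
      refine (conj _ (conj _ (conj _ (conj _ (conj (contc_const _ _) (contc_const _ _)))))).
      + apply hasd_minus; now apply hasd_weier_shift.
      + eapply hasd_eq; [apply hasd_minus; now apply hasd_weier'_shift |]. field.
      + eapply hasd_eq; [apply hasd_const | ring].
      + eapply hasd_cont. apply hasd_scal, hasd_plus; now apply hasd_weier_shift.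
    - exact halflat_0.
    - replace (0 + h1)%C with h1 by ring. replace (0 + h2)%C with h2 by ring. auto.
    - replace (0 + h1)%C with h1 by ring. replace (0 + h2)%C with h2 by ring.
      rewrite E, !weier'_half_period by assumption. split; ring. }
  assert (L1 := weier_pole a b Ha Hb).
  assert (L2 : cvg at0 (fun t => t ^ 2 * pe (h2 - h1 + t))%C (0 ^ 2 * pe (h2 - h1))%C).
  { apply (cvg_mult at0).
    - apply (cvg_pow at0), cvg_at0_id.
    - apply (hasd_cont pe _ _ (hasd_weier a b Ha Hb _ N12)). }
  assert (L3 : cvg at0 (fun t => t ^ 2 * pe t)%C (0 ^ 2 * pe (h2 - h1))%C).
  { refine (cvg_ext at0 _ _ _ _ L2).
    refine (filter_imp _ _ _ (at0_not_halflat (- h1)%C (halflat_opp _ H1))).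
    intros t Ht. assert (X := S _ Ht).
    replace (- h1 + t + h1)%C with t in X by ring.
    replace (- h1 + t + h2)%C with (h2 - h1 + t)%C in X by ring.
    now rewrite X. }
  assert (X := cvg_unique at0 _ _ _ L1 L3).
  replace (0 ^ 2 * pe (h2 - h1))%C with (RtoC 0) in X by ring.
  apply RtoC_inj in X. lra.
Qed.

Lemma half_value_root (h : C) : halflat h -> ~ lat h ->
  (4 * pe h ^ 3 - g2 * pe h - g3 = 0)%C.
Proof.
  intros Hh Nh. rewrite <- weier'_sqr by exact Nh. rewrite weier'_half_period by assumption. ring.
Qed.

Lemma Cmult_integral (x y : C) : (x * y)%C = 0%C -> x = 0%C \/ y = 0%C.
Proof.
  intros E. destruct (classic (x = 0%C)) as [| Nx]; [auto |].
  destruct (classic (y = 0%C)) as [| Ny]; [auto |].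
  exfalso. now apply (Cmult_neq_0 x y Nx Ny).
Qed.

Lemma Cminus_neq_0 (x y : C) : x <> y -> (x - y)%C <> 0%C.
Proof.
  intros N E. now apply N, Cminus_eq_0.
Qed.

Lemma cubic_root_pair (A B x y : C) : x <> y ->
  (4 * x ^ 3 - A * x - B = 0)%C -> (4 * y ^ 3 - A * y - B = 0)%C ->
  (4 * (x ^ 2 + x * y + y ^ 2) - A = 0)%C.
Proof.
  intros N Ex Ey.
  destruct (Cmult_integral (x - y) (4 * (x ^ 2 + x * y + y ^ 2) - A)) as [X | X]; auto.
  - replace ((x - y) * (4 * (x ^ 2 + x * y + y ^ 2) - A))%C
      with ((4 * x ^ 3 - A * x - B) - (4 * y ^ 3 - A * y - B))%C by ring.
    rewrite Ex, Ey. ring.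
  - now apply Cminus_neq_0 in X.
Qed.

(** Vieta's formulas without factoring the cubic: differences of the equations are divided by
    differences of the distinct roots. *)
Lemma cubic_roots (A B x y z : C) :
  x <> y -> x <> z -> y <> z ->
  (4 * x ^ 3 - A * x - B = 0)%C -> (4 * y ^ 3 - A * y - B = 0)%C ->
  (4 * z ^ 3 - A * z - B = 0)%C ->
  (x + y + z = 0)%C /\ (A = -4 * (x * y + y * z + z * x))%C /\ (B = 4 * x * y * z)%C.
Proof.
  intros N1 N2 N3 Ex Ey Ez.
  assert (F1 := cubic_root_pair A B x y N1 Ex Ey).
  assert (F2 := cubic_root_pair A B x z N2 Ex Ez).
  assert (F3 : (x + y + z = 0)%C).
  { destruct (Cmult_integral (y - z) (x + y + z)) as [X | X]; auto.
    - replace ((y - z) * (x + y + z))%C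
        with (/ 4 * ((4 * (x ^ 2 + x * y + y ^ 2) - A) - (4 * (x ^ 2 + x * z + z ^ 2) - A)))%C
        by field.
      rewrite F1, F2. ring.
    - now apply Cminus_neq_0 in X. }
  assert (Z : z = (- x - y)%C).
  { replace z with (x + y + z - x - y)%C by ring. rewrite F3. ring. }
  assert (EA : A = (4 * (x ^ 2 + x * y + y ^ 2))%C).
  { replace A with (4 * (x ^ 2 + x * y + y ^ 2) - (4 * (x ^ 2 + x * y + y ^ 2) - A))%C by ring.
    rewrite F1. ring. }
  split; [exact F3 |]. split.
  - rewrite EA, Z. ring.
  - replace B with (4 * x ^ 3 - A * x - (4 * x ^ 3 - A * x - B))%C by ring.
    rewrite Ex, EA, Z. ring.
Qed.

Section HalfPeriodTranslation.
Variables (h k : C).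
Hypotheses (Hh : halflat h) (Hk : halflat k)
  (Nh : ~ lat h) (Nk : ~ lat k) (Nhk : ~ lat (k + h)%C).

Let e : C := pe h.
Let c : C := (3 * e ^ 2 - g2 / 4)%C.

(** [h], [k] and [k + h] represent the three nonzero half-period classes, so their values are the
    three roots of the cubic, and c is the product of the differences of the other two roots from e.
    These are the initial data for the translation formula. *)
Lemma half_period_k : (pe k - e)%C <> 0%C /\ (pe (k + h) - e)%C <> 0%C /\
  ((pe k - e) * (pe (k + h) - e) = c)%C /\ (pe k + pe (k + h) + e = 0)%C.
Proof.
  assert (Hkh : halflat (k + h)%C) by (now apply halflat_plus).
  assert (N1 : pe k <> e).
  { apply half_values_distinct; auto. intros L. apply Nhk.
    replace (k + h)%C with (- (h - k) + 2 * h)%C by ring.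
    apply lat_plus; [now apply lat_opp | exact Hh]. }
  assert (N2 : pe (k + h)%C <> e).
  { apply half_values_distinct; auto. intros L. apply Nk.
    replace k with (- (h - (k + h)))%C by ring. now apply lat_opp. }
  assert (N3 : pe k <> pe (k + h)%C).
  { apply half_values_distinct; auto. now replace (k + h - k)%C with h by ring. }
  destruct (cubic_roots g2 g3 (pe k) (pe (k + h)%C) e) as [S [A _]]; auto;
    try (apply half_value_root; assumption).
  refine (conj (Cminus_neq_0 _ _ N1) (conj (Cminus_neq_0 _ _ N2) (conj _ S))).
  unfold c. rewrite A.
  replace (pe (k + h)%C) with (pe k + pe (k + h) + e - pe k - e)%C by ring.
  rewrite S. field.
Qed.

(* With A = weier u - e and B = weier (u + h) - e, the triple
   (AB - c, A'B + AB', A'B' + 4c(A + B) + 12ec) solves a homogeneous linear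
   system and vanishes at u = k. *)
Lemma half_period_translation (u : C) : ~ halflat u ->
  ((pe u - e) * (pe (u + h) - e) = c)%C.
Proof.
  intros Hu.
  set (X1 := fun u => ((pe u - e) * (pe (u + h) - e) - c)%C).
  set (X2 := fun u => (pe' u * (pe (u + h) - e) + (pe u - e) * pe' (u + h))%C).
  set (X3 := fun u => (pe' u * pe' (u + h) + 4 * c * ((pe u - e) + (pe (u + h) - e))
                       + 12 * e * c)%C).
  enough (X : X1 u = 0%C /\ X2 u = 0%C /\ X3 u = 0%C).
  { exact (Cminus_eq_0 _ _ (proj1 X)). }
  destruct half_period_k as [K1 [K2 [K3 K4]]].
  apply (connect_half (fun z => ~ lat z /\ ~ lat (z + h)%C)
    (fun u => X1 u = 0%C /\ X2 u = 0%C /\ X3 u = 0%C) k); auto.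
  - intros z Hz. split; [now apply not_halflat_lat | now apply not_lat_shift].
  - intros p d Hg [Q1 [Q2 Q3]].
    apply (linear_system_zero X1 X2 X3
      (fun z => 6 * ((pe z - e) + (pe (z + h) - e)) + 24 * e)%C
      (fun z => 6 * ((pe z - e) + (pe (z + h) - e)) + 12 * e)%C
      (fun z => -6 * (pe' z + pe' (z + h)))%C p d); auto.
    intros t Ht z. destruct (Hg t Ht) as [G1 G2]. fold z in G1, G2.
    pose proof (hasd_weier a b Ha Hb z G1) as D0. pose proof (hasd_weier' a b Ha Hb z G1) as D1.
    pose proof (hasd_weier_shift z h G2) as T0. pose proof (hasd_weier'_shift z h G2) as T1.
    assert (A0 := hasd_minus _ _ _ _ _ D0 (hasd_const e z)).
    assert (B0 := hasd_minus _ _ _ _ _ T0 (hasd_const e z)).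
    refine (conj _ (conj _ (conj _ (conj _ (conj _ _))))).
    + unfold X1, X2. eapply hasd_eq.
      * apply hasd_minus; [apply hasd_mult; [exact A0 | exact B0] | apply hasd_const].
      * simpl. ring.
    + unfold X1, X2, X3. eapply hasd_eq.
      * apply hasd_plus; apply hasd_mult; [exact D1 | exact B0 | exact A0 | exact T1].
      * simpl. unfold c. field.
    + unfold X1, X2, X3. eapply hasd_eq.
      * apply hasd_plus; [apply hasd_plus |].
        -- apply hasd_mult; [exact D1 | exact T1].
        -- apply hasd_scal, hasd_plus; [exact A0 | exact B0].
        -- apply hasd_const.
      * simpl. unfold c. field.
    + eapply hasd_cont. apply hasd_plus; [apply hasd_scal, hasd_plus; [exact A0 | exact B0] |
        apply hasd_const].
    + eapply hasd_cont. apply hasd_plus; [apply hasd_scal, hasd_plus; [exact A0 | exact B0] |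
        apply hasd_const].
    + eapply hasd_cont. apply hasd_scal, hasd_plus; [exact D1 | exact T1].
  - unfold X1, X2, X3. rewrite K3, !weier'_half_period; auto using halflat_plus.
    split; [ring |]. split; [ring |].
    replace (pe (k + h)%C) with (pe k + pe (k + h) + e - pe k - e)%C by ring.
    rewrite K4. ring.
Qed.

(** In the translation formula the product of the two factors is a nonzero constant, so neither
    factor can vanish. This replaces counting the zeros of an elliptic function. *)
Lemma half_period_value_avoided (u : C) : ~ halflat u -> pe u <> e.
Proof.
  intros Hu E. destruct half_period_k as [K1 [K2 [K3 _]]].
  assert (X := half_period_translation u Hu). rewrite <- K3, E in X.
  apply (Cmult_neq_0 _ _ K1 K2). rewrite <- X. ring.
Qed.

End HalfPeriodTranslation.

Definition half1 : C := ((a / 2)%R, 0).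
Definition half2 : C := (0, (b / 2)%R).
Definition half3 : C := ((a / 2)%R, (b / 2)%R).

Lemma halflat_half : halflat half1 /\ halflat half2 /\ halflat half3.
Proof.
  unfold in_halflat, in_lat, lpoint, half1, half2, half3. repeat split;
  [exists (1, 0)%Z | exists (0, 1)%Z | exists (1, 1)%Z]; apply C_eq; simpl; field.
Qed.

Lemma half_not_multiple (x : R) (n : Z) : 0 < x -> x / 2 <> IZR n * x.
Proof.
  intros Hx. replace (x / 2) with ((IZR 0 + / 2) * x) by (simpl; field).
  apply fraction_not_multiple; lra.
Qed.

Lemma not_lat_half : ~ lat half1 /\ ~ lat half2 /\ ~ lat half3.
Proof.
  repeat split.
  - apply not_lat_re. intros n. now apply half_not_multiple.
  - apply not_lat_im. intros n. now apply half_not_multiple.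
  - apply not_lat_re. intros n. now apply half_not_multiple.
Qed.

Lemma half_sum : (half1 + half2)%C = half3 /\ (half1 + half3 = 2 * half1 + half2)%C.
Proof. repeat split; apply C_eq; unfold half1, half2, half3; simpl; field. Qed.

Lemma not_lat_half13 : ~ lat (half1 + half3)%C.
Proof.
  destruct halflat_half as [A1 _]. destruct not_lat_half as [_ [B2 _]].
  destruct half_sum as [_ ->]. intros L. apply B2.
  replace half2 with (2 * half1 + half2 + - (2 * half1))%C by ring.
  apply lat_plus; [exact L | now apply lat_opp].
Qed.

Local Notation E1 := (pe half1).
Local Notation E2 := (pe half2).
Local Notation E3 := (pe half3).

Lemma half_values_roots : E1 <> E2 /\ E1 <> E3 /\ E2 <> E3 /\
  (E1 + E2 + E3 = 0)%C /\ (g2 = -4 * (E1 * E2 + E2 * E3 + E3 * E1))%C /\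
  (g3 = 4 * E1 * E2 * E3)%C.
Proof.
  destruct halflat_half as [A1 [A2 A3]]. destruct not_lat_half as [B1 [B2 B3]].
  assert (N12 : E1 <> E2).
  { apply half_values_distinct; auto.
    apply not_lat_im. intros n. unfold half1, half2. simpl.
    replace (b / 2 + - 0) with (b / 2) by ring. now apply half_not_multiple. }
  assert (N13 : E1 <> E3).
  { apply half_values_distinct; auto.
    apply not_lat_im. intros n. unfold half1, half3. simpl.
    replace (b / 2 + - 0) with (b / 2) by ring. now apply half_not_multiple. }
  assert (N23 : E2 <> E3).
  { apply half_values_distinct; auto.
    apply not_lat_re. intros n. unfold half2, half3. simpl.
    replace (a / 2 + - 0) with (a / 2) by ring. now apply half_not_multiple. }
  refine (conj N12 (conj N13 (conj N23 _))).
  apply cubic_roots; auto; now apply half_value_root.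
Qed.

Lemma weier'_sqr_factored (z : C) : ~ lat z ->
  (pe' z ^ 2 = 4 * ((pe z - E1) * (pe z - E2) * (pe z - E3)))%C.
Proof.
  intros N. rewrite weier'_sqr by exact N.
  destruct half_values_roots as [_ [_ [_ [S [-> ->]]]]].
  replace E3 with (E1 + E2 + E3 - E1 - E2)%C by ring. rewrite S. ring.
Qed.

Lemma weier_avoids_half_values (u : C) : ~ halflat u -> pe u <> E1 /\ pe u <> E2 /\ pe u <> E3.
Proof.
  intros Hu.
  destruct halflat_half as [A1 [A2 A3]]. destruct not_lat_half as [B1 [B2 B3]].
  destruct half_sum as [S3 _].
  repeat split.
  - apply (half_period_value_avoided half1 half2); auto.
    replace (half2 + half1)%C with half3; [exact B3 |]. rewrite <- S3. ring.
  - apply (half_period_value_avoided half2 half1); auto. now rewrite S3.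
  - apply (half_period_value_avoided half3 half1); auto using not_lat_half13.
Qed.

Lemma weier'_nonzero (u : C) : ~ halflat u -> pe' u <> 0%C.
Proof.
  intros Hu E. assert (X := weier'_sqr_factored u (not_halflat_lat u Hu)).
  rewrite E in X. destruct (weier_avoids_half_values u Hu) as [N1 [N2 N3]].
  apply Cminus_neq_0 in N1. apply Cminus_neq_0 in N2. apply Cminus_neq_0 in N3.
  apply (Cmult_neq_0 _ _ (Cmult_neq_0 _ _ N1 N2) N3).
  replace ((pe u - E1) * (pe u - E2) * (pe u - E3))%C
    with (/ 4 * (4 * ((pe u - E1) * (pe u - E2) * (pe u - E3))))%C by field.
  rewrite <- X. ring.
Qed.

Lemma not_halflat_center : ~ halflat center.
Proof.
  intros L. apply halflat_lat in L. revert L. apply not_lat_re. exact center_generic_re.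
Qed.

(* kappa = weier'' / (2 weier') by the differential equation; in terms of it,
   weier (2 u) = kappa^2 - 2 weier u. *)
Definition kappa (u : C) : C := ((6 * pe u ^ 2 - g2 / 2) / (2 * pe' u))%C.

(** A Riccati equation, obtained from weier''' = 12 weier weier'. *)
Lemma hasd_kappa (u : C) : ~ halflat u ->
  hasd kappa u (6 * pe u - 2 * kappa u ^ 2)%C.
Proof.
  intros Hu. pose proof (not_halflat_lat u Hu) as N.
  pose proof (hasd_weier a b Ha Hb u N) as D0. pose proof (hasd_weier' a b Ha Hb u N) as D1.
  pose proof (weier'_nonzero u Hu) as NP.
  pose proof RtoC_2_neq_0 as H2'.
  apply (hasd_ext_loc (fun u => (6 * (pe u * pe u) - g2 / 2) / (2 * pe' u))%C).
  - unfold kappa. f_equal. ring.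
  - apply filter_forall. intros h. unfold kappa. f_equal. ring.
  - eapply hasd_eq.
    + apply hasd_div.
      * now apply Cmult_neq_0.
      * apply hasd_minus; [apply hasd_scal, hasd_mult; exact D0 | apply hasd_const].
      * apply hasd_scal; exact D1.
    + unfold kappa. simpl. field. exact NP.
Qed.

(** As functions of u, both sides satisfy R'' = 24 R^2 - 2 g2, so their difference solves a linear
    equation with coefficient 24 times their sum. [X2] is the derivative of this difference, and
    both vanish at [center]. *)
Lemma weier_double (u : C) : ~ halflat u -> pe (2 * u)%C = (kappa u ^ 2 - 2 * pe u)%C.
Proof.
  intros Hu.
  set (X1 := fun u => (pe (2 * u) - (kappa u * kappa u - 2 * pe u))%C).
  set (X2 := fun u => (2 * pe' (2 * u)
     - (12 * (pe u * kappa u) - 4 * (kappa u * (kappa u * kappa u)) - 2 * pe' u))%C).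
  enough (X : X1 u = 0%C /\ X2 u = 0%C).
  { destruct X as [X _]. apply Cminus_eq_0 in X. rewrite X. ring. }
  apply (connect_from_generic (a / 2) (b / 2) (fun z => ~ halflat z)
    (fun u => X1 u = 0%C /\ X2 u = 0%C) center u).
  - intros z Hz L. now apply Hz, halflat_lat.
  - intros p d Hg [Q1 Q2].
    destruct (linear_system_zero X1 X2 (fun _ => 0%C)
      (fun z => 24 * (pe (2 * z) + (kappa z * kappa z - 2 * pe z)))%C
      (fun _ => 0%C) (fun _ => 0%C) p d) as [R1 [R2 _]]; auto.
    intros t Ht z. assert (Hz := Hg t Ht). fold z in Hz.
    pose proof (not_halflat_lat z Hz) as N.
    pose proof (hasd_weier a b Ha Hb z N) as D0. pose proof (hasd_weier' a b Ha Hb z N) as D1.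
    pose proof (hasd_kappa z Hz) as Dk.
    pose proof RtoC_2_neq_0 as H2'.
    assert (M0 : hasd (fun u => pe (2 * u)%C) z (2 * pe' (2 * z))%C).
    { apply (hasd_ext_loc (fun u => pe (2 * u + 0)%C)).
      - f_equal. ring.
      - apply filter_forall. intros h. f_equal. ring.
      - apply (hasd_comp_affine pe 2 0 z _ H2').
        replace (2 * z + 0)%C with (2 * z)%C by ring. now apply hasd_weier. }
    assert (M1 : hasd (fun u => pe' (2 * u)%C) z (2 * (6 * pe (2 * z) ^ 2 - g2 / 2))%C).
    { apply (hasd_ext_loc (fun u => pe' (2 * u + 0)%C)).
      - f_equal. ring.
      - apply filter_forall. intros h. f_equal. ring.
      - apply (hasd_comp_affine pe' 2 0 z _ H2').
        replace (2 * z + 0)%C with (2 * z)%C by ring. now apply hasd_weier'. }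
    refine (conj _ (conj _ (conj _ (conj _ (conj (contc_const _ _) (contc_const _ _)))))).
    + unfold X1, X2. eapply hasd_eq.
      * apply hasd_minus; [exact M0 |]. apply hasd_minus;
          [apply hasd_mult; exact Dk | apply hasd_scal; exact D0].
      * simpl. ring.
    + unfold X1, X2. eapply hasd_eq.
      * apply hasd_minus; [apply hasd_scal; exact M1 |].
        apply hasd_minus; [| apply hasd_scal; exact D1].
        apply hasd_minus; apply hasd_scal; [apply hasd_mult; [exact D0 | exact Dk] |].
        apply hasd_mult; [exact Dk | apply hasd_mult; exact Dk].
      * simpl.
        assert (Ek : (pe' z * kappa z = (6 * pe z ^ 2 - g2 / 2) / 2)%C).
        { unfold kappa. field. now apply weier'_nonzero. }
        replace (pe' z * kappa z)%C with ((6 * pe z ^ 2 - g2 / 2) / 2)%C.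
        field.
    + eapply hasd_eq; [apply hasd_const | ring].
    + eapply hasd_cont. apply hasd_scal, hasd_plus; [exact M0 |].
      apply hasd_minus; [apply hasd_mult; exact Dk | apply hasd_scal; exact D0].
  - exact center_generic_re.
  - exact center_generic_im.
  - destruct halflat_half as [A1 [A2 A3]]. destruct not_lat_half as [B1 [B2 B3]].
    pose proof not_halflat_center as NC. pose proof (not_halflat_lat _ NC) as NL.
    assert (Ec : (2 * center)%C = half3) by (apply C_eq; unfold center, half3; simpl; field).
    (* [center] is fixed by u -> half3 - u, so the translation formula at [- center] becomes a
       perfect square. All initial data can then be expressed by A = pe center - E3 and e = E3. *)
    assert (T : ((pe center - E3) ^ 2 = 3 * E3 ^ 2 - g2 / 4)%C).
    { assert (X := half_period_translation half3 half1 A3 A1 B3 B1 not_lat_half13 (- center)%C).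
      rewrite <- X.
      - rewrite weier_even by assumption. replace (- center + half3)%C with center.
        + ring.
        + rewrite <- Ec. ring.
      - intros L. apply NC. replace center with (- - center)%C by ring. now apply halflat_opp. }
    pose proof (weier'_nonzero _ NC) as NP.
    pose proof (weier'_sqr _ NL) as Y2.
    pose proof (half_value_root half3 A3 B3) as R3.
    destruct (weier_avoids_half_values _ NC) as [_ [_ NA]]. apply Cminus_neq_0 in NA.
    unfold X1, X2. rewrite Ec, weier'_half_period by assumption.
    set (x := pe center) in *. set (e := pe half3) in *. set (y := pe' center) in *.
    set (A := (x - e)%C) in *.
    assert (Ex : x = (A + e)%C) by (unfold A; ring).
    assert (Eg : g2 = (12 * e ^ 2 - 4 * A ^ 2)%C) by (rewrite T; field).
    assert (Eg3 : g3 = (4 * e ^ 3 - g2 * e)%C).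
    { replace g3 with (4 * e ^ 3 - g2 * e - (4 * e ^ 3 - g2 * e - g3))%C by ring.
      rewrite R3. ring. }
    assert (Em : (6 * x ^ 2 - g2 / 2 = 8 * A ^ 2 + 12 * e * A)%C) by (rewrite Eg, Ex; field).
    assert (Ey : (y ^ 2 = A * (8 * A ^ 2 + 12 * e * A))%C) by (rewrite Y2, Eg3, Eg, Ex; ring).
    assert (Ek : kappa center = ((8 * A ^ 2 + 12 * e * A) / (2 * y))%C).
    { unfold kappa. fold x. fold y. now rewrite Em. }
    assert (Ek2 : (kappa center * kappa center = 2 * A + 3 * e)%C).
    { rewrite Ek.
      replace ((8 * A ^ 2 + 12 * e * A) / (2 * y) * ((8 * A ^ 2 + 12 * e * A) / (2 * y)))%C
        with ((8 * A ^ 2 + 12 * e * A) ^ 2 / (4 * y ^ 2))%C by (field; exact NP).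
      assert (NM : (8 * A ^ 2 + 12 * e * A)%C <> 0%C).
      { intros Z. rewrite Z in Ey. apply (Cmult_neq_0 _ _ NP NP).
        replace (y * y)%C with (y ^ 2)%C by ring. rewrite Ey. ring. }
      rewrite Ey. field. split; [exact NM | exact NA]. }
    rewrite Ek2. split.
    + rewrite Ex. ring.
    + replace (kappa center * (2 * A + 3 * e))%C with ((2 * A + 3 * e) * kappa center)%C by ring.
      rewrite Ex.
      replace (2 * 0 - (12 * ((A + e) * kappa center) - 4 * ((2 * A + 3 * e) * kappa center) - 2 * y))%C
        with (-4 * A * kappa center + 2 * y)%C by ring.
      rewrite Ek.
      replace (-4 * A * ((8 * A ^ 2 + 12 * e * A) / (2 * y)) + 2 * y)%C
        with (2 / y * (y ^ 2 - A * (8 * A ^ 2 + 12 * e * A)))%C by (field; exact NP).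
      rewrite Ey. ring.
  - intros L. now apply Hu, halflat_lat.
Qed.

Lemma weier_double_square (e x2 x3 u : C) : ~ halflat u ->
  (e + x2 + x3 = 0)%C -> (g2 = -4 * (e * x2 + x2 * x3 + x3 * e))%C -> (g3 = 4 * e * x2 * x3)%C ->
  (pe (2 * u) - e = (- ((pe u - e) ^ 2 - (e - x2) * (e - x3)) / pe' u) ^ 2)%C.
Proof.
  intros Hu S G2 G3. pose proof (weier'_nonzero u Hu) as NP.
  pose proof (weier'_sqr u (not_halflat_lat u Hu)) as Y2.
  rewrite weier_double by exact Hu. unfold kappa.
  set (x := pe u) in *. set (y := pe' u) in *.
  assert (X3 : x3 = (- e - x2)%C).
  { replace x3 with (e + x2 + x3 - e - x2)%C by ring. rewrite S. ring. }
  replace (((6 * x ^ 2 - g2 / 2) / (2 * y)) ^ 2 - 2 * x - e)%C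
    with (((6 * x ^ 2 - g2 / 2) ^ 2 / 4 - (2 * x + e) * y ^ 2) / y ^ 2)%C by (field; exact NP).
  replace ((- ((x - e) ^ 2 - (e - x2) * (e - x3)) / y) ^ 2)%C
    with (((x - e) ^ 2 - (e - x2) * (e - x3)) ^ 2 / y ^ 2)%C by (field; exact NP).
  f_equal. rewrite Y2, G2, G3, X3. field.
Qed.

End WeierstrassAlgebra.

(** * Meromorphic square roots *)

(** Continuity is all that is extracted from the holomorphy of a root: its square is known, so only
    a sign has to be followed along paths. *)
Lemma ex_derive_contc (f : C -> C) (z : C) :
  @ex_derive C_AbsRing C_NormedModule f z -> contc f z.
Proof.
  intros H. apply ex_derive_continuous in H.
  apply (cvg_eps at0). intros eps He.
  assert (H2 : 0 < eps / 2) by lra.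
  destruct (H (fun y : C => Rabs (Re y - Re (f z)) < eps / 2 /\ Rabs (Im y - Im (f z)) < eps / 2))
    as [d Hd].
  { exists (mkposreal _ H2). intros y [A B]. split; [exact A | exact B]. }
  exists d. split; [apply cond_pos |]. intros h _ Lh.
  destruct (Hd (z + h)%C) as [A B].
  { change (Cmod (z + h - z)%C < d). now replace (z + h - z)%C with h by ring. }
  eapply Rle_lt_trans; [apply Cmod_le_Re_Im |].
  change (Re (f (z + h) - f z)%C) with (Re (f (z + h)%C) - Re (f z)).
  change (Im (f (z + h) - f z)%C) with (Im (f (z + h)%C) - Im (f z)). lra.
Qed.

Lemma locally_at0 (P : C -> Prop) : locally (RtoC 0) P -> at0 P.
Proof.
  intros [d Hd]. exists d. split; [apply cond_pos |]. intros h _ Lh. apply Hd. split.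
  - change (Rabs (Re h - 0) < d). rewrite Rminus_0_r.
    eapply Rle_lt_trans; [apply re_le_Cmod | exact Lh].
  - change (Rabs (Im h - 0) < d). rewrite Rminus_0_r.
    eapply Rle_lt_trans; [apply im_le_Cmod | exact Lh].
Qed.

Lemma principal_part_lim (c : nat -> C) (N : nat) :
  cvg at0 (fun z => z ^ S N * sum_n (fun j => c j / (z - 0) ^ S j) N)%C (c N).
Proof.
  induction N as [| N IH].
  - refine (cvg_at0_ext _ _ _ _ (cvg_const at0 (c 0%nat))). intros h Nh.
    rewrite sum_O. replace (h - 0)%C with h by ring. simpl. field. exact Nh.
  - assert (X := cvg_plus at0 _ _ _ _ (cvg_mult at0 _ _ _ _ cvg_at0_id IH)
                   (cvg_const at0 (c (S N)))).
    replace (0 * c N + c (S N))%C with (c (S N)) in X by ring.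
    refine (cvg_at0_ext _ _ _ _ X). intros h Nh. cbv beta.
    rewrite (sum_Sn (G := C_AbelianMonoid)).
    set (s := @sum_n C_AbelianMonoid _ N).
    replace (h - 0)%C with h by ring.
    change (plus s (c (S N) / h ^ S (S N)))%C with (s + c (S N) / h ^ S (S N))%C.
    assert (Np : (h ^ S (S N))%C <> 0%C) by now apply Cpow_nz.
    change (h ^ S (S N))%C with (h * h ^ S N)%C in *.
    field. split; [| exact Nh]. now apply Cpow_nz.
Qed.

(* The square having a double pole with leading coefficient 1 kills the
   coefficients of all higher negative powers. *)
Lemma residue_one_lim (f h : C -> C) (c : nat -> C) (N : nat) :
  cvg at0 (fun z => (z * f z) ^ 2)%C 1%C -> contc h 0%C ->
  at0 (fun z => f z = (h z + sum_n (fun j => c j / (z - 0) ^ S j) N)%C) ->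
  cvg at0 (fun z => z * f z)%C (c 0%nat).
Proof.
  intros Hsq Hh. unfold contc in Hh.
  assert (Hh' : cvg at0 h (h 0%C)).
  { refine (cvg_at0_ext _ _ _ _ Hh). intros y _. f_equal. ring. }
  induction N as [| N IH]; intros E.
  - assert (X := cvg_plus at0 _ _ _ _ (cvg_mult at0 _ _ _ _ cvg_at0_id Hh')
                   (principal_part_lim c 0)).
    replace (0 * h 0 + c 0%nat)%C with (c 0%nat) in X by ring.
    refine (cvg_ext at0 _ _ _ _ X). refine (filter_imp _ _ _ E).
    intros y ->. set (s := @sum_n C_AbelianMonoid _ 0). simpl. ring.
  - apply IH.
    assert (C0 : c (S N) = 0%C).
    { assert (X := cvg_plus at0 _ _ _ _
        (cvg_mult at0 _ _ _ _ (cvg_pow at0 _ _ (S (S N)) cvg_at0_id) Hh')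
                   (principal_part_lim c (S N))).
      assert (Y : cvg at0 (fun z => z ^ S (S N) * f z)%C (c (S N))).
      { replace (0 ^ S (S N) * h 0 + c (S N))%C with (c (S N)) in X by (simpl; ring).
        refine (cvg_ext at0 _ _ _ _ X). refine (filter_imp _ _ _ E).
        intros y ->. set (s := @sum_n C_AbelianMonoid _ (S N)). ring. }
      assert (Y2 := cvg_pow at0 _ _ 2 Y).
      assert (Z2 := cvg_mult at0 _ _ _ _ (cvg_pow at0 _ _ 2 (cvg_pow at0 _ _ (S N) cvg_at0_id)) Hsq).
      replace ((0 ^ S N) ^ 2 * 1)%C with (RtoC 0) in Z2 by (simpl; ring).
      assert (Q : (c (S N) ^ 2)%C = 0%C).
      { refine (cvg_unique at0 _ _ _ Y2 _). refine (cvg_at0_ext _ _ _ _ Z2).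
        intros y _. change (y ^ S (S N))%C with (y * y ^ S N)%C. ring. }
      simpl in Q. destruct (Cmult_integral (c (S N)) (c (S N))) as [R | R]; auto.
      rewrite <- Q. ring. }
    refine (filter_imp _ _ _ E). intros y ->.
    rewrite (sum_Sn (G := C_AbelianMonoid)), C0.
    set (s := @sum_n C_AbelianMonoid _ N).
    change (plus s (0 / (y - 0) ^ S (S N)))%C with (s + 0 / (y - 0) ^ S (S N))%C.
    unfold Cdiv. ring.
Qed.

Lemma cvg_at0_double (f : C -> C) (l : C) :
  cvg at0 f l -> cvg at0 (fun u => f (2 * u)%C) l.
Proof.
  intros H. apply (cvg_eps at0). intros eps He.
  exact (at0_double _ (proj1 (cvg_eps at0 _ _) H eps He)).
Qed.

Lemma contc_double (f : C -> C) (u : C) : contc f (2 * u)%C -> contc (fun u => f (2 * u)%C) u.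
Proof.
  intros H. unfold contc in *. apply cvg_at0_double in H.
  refine (cvg_at0_ext _ _ _ _ H). intros h _. f_equal. ring.
Qed.

(** The quotient f/g is 1 or -1, so the continuous function [Cmod (f / g - 1)] takes only the values
    0 and 2 and can never pass through 1. *)
Lemma sign_constant_on_segment (f g : C -> C) (p d : C) :
  (forall t, 0 <= t <= 1 -> let z := (p + RtoC t * d)%C in
     contc f z /\ contc g z /\ g z <> 0%C /\ (f z ^ 2 = g z ^ 2)%C) ->
  f p = g p -> f (p + d)%C = g (p + d)%C.
Proof.
  intros H E.
  set (r := fun z => (f z / g z - 1)%C).
  assert (V : forall t, 0 <= t <= 1 ->
    (f (p + RtoC t * d) = g (p + RtoC t * d))%C /\ Cmod (r (p + RtoC t * d)%C) = 0 \/
    Cmod (r (p + RtoC t * d)%C) = 2).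
  { intros t Ht. destruct (H t Ht) as [_ [_ [Nz Sq]]]. set (z := (p + RtoC t * d)%C) in *.
    unfold r.
    destruct (Cmult_integral (f z - g z) (f z + g z)) as [X | X].
    - replace ((f z - g z) * (f z + g z))%C with (f z ^ 2 - g z ^ 2)%C by ring.
      rewrite Sq. ring.
    - left. assert (X' : f z = g z).
      { now apply Cminus_eq_0. }
      split; [exact X' |]. rewrite X'. replace (g z / g z - 1)%C with (RtoC 0) by (field; auto).
      apply Cmod_0.
    - right. replace (f z) with (f z + g z - g z)%C by ring. rewrite X.
      replace ((0 - g z) / g z - 1)%C with (RtoC (-2)) by (field; auto).
      rewrite Cmod_R, Rabs_left; lra. }
  replace (p + d)%C with (p + RtoC 1 * d)%C by ring.
  destruct (V 1 ltac:(lra)) as [[X _] | X]; [exact X |]. exfalso.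
  destruct (Ranalysis5.IVT_interv (fun t => Cmod (r (p + RtoC t * d)%C) - 1) 0 1)
    as [t [Ht Et]].
  - intros t Ht. apply continuity_pt_minus; [| apply continuity_pt_const; now intros x y].
    apply contc_Cmod_path. destruct (H t Ht) as [Cf [Cg [Nz _]]].
    unfold r. apply (cvg_minus at0).
    + now apply (cvg_div at0).
    + apply (cvg_const at0).
  - lra.
  - replace (p + RtoC 0 * d)%C with p by ring. unfold r. rewrite E.
    destruct (H 0 ltac:(lra)) as [_ [_ [Nz _]]].
    replace (p + RtoC 0 * d)%C with p in Nz by ring.
    replace (g p / g p - 1)%C with (RtoC 0) by (field; auto).
    rewrite Cmod_0. lra.
  - rewrite X. lra.
  - destruct (V t Ht) as [[_ Y] | Y]; rewrite Y in Et; lra.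
Qed.

Section Roots.
Variables (a b : R).
Hypotheses (Ha : 0 < a) (Hb : 0 < b).

Local Notation lat := (in_lat a b).
Local Notation halflat := (in_halflat a b).
Local Notation pe := (weier a b).
Local Notation pe' := (weier' a b).
Local Notation g2 := (invariant_g2 a b).
Local Notation g3 := (invariant_g3 a b).

(** Comparing signs divides by the candidate root, which must not vanish; its zeros have [2 * u] in
    the half-lattice. The grid to be avoided is therefore a quarter of the lattice. *)
Lemma quarterlat (z : C) : in_lat (a / 4) (b / 4) z <-> halflat (2 * z)%C.
Proof.
  unfold in_halflat, in_lat, lpoint. split; intros [v E]; exists v.
  - rewrite E. apply C_eq; simpl; field.
  - replace z with (/ 4 * (2 * (2 * z)))%C by field. rewrite E. apply C_eq; simpl; field.
Qed.

Variables (f : C -> C) (e x2 x3 : C).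
Hypotheses (Hf : forall z, ~ lat z ->
     @ex_derive C_AbsRing C_NormedModule f z /\ (f z ^ 2)%C = (pe z - e)%C)
  (Hr : has_residue f (RtoC 0) (RtoC 1))
  (He : forall u, ~ halflat u -> pe u <> e)
  (HS : (e + x2 + x3 = 0)%C) (HG2 : (g2 = -4 * (e * x2 + x2 * x3 + x3 * e))%C)
  (HG3 : (g3 = 4 * e * x2 * x3)%C).

(** The leading minus sign is the residue condition: weier' behaves like -2/u^3, so u times this
    quotient tends to 1/2, just as u f(2u) does. *)
Let s (u : C) : C := (- ((pe u - e) ^ 2 - (e - x2) * (e - x3)) / pe' u)%C.

Lemma root_candidate_sqr (u : C) : ~ halflat u -> (s u ^ 2 = pe (2 * u) - e)%C.
Proof. intros Hu. symmetry. now apply weier_double_square. Qed.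

Lemma root_candidate_contc (u : C) : ~ halflat u -> contc s u.
Proof.
  intros Hu. pose proof (not_halflat_lat a b u Hu) as N.
  pose proof (hasd_cont _ _ _ (hasd_weier a b Ha Hb u N)) as C0.
  pose proof (hasd_cont _ _ _ (hasd_weier' a b Ha Hb u N)) as C1.
  unfold contc, s. apply (cvg_div at0); [now apply weier'_nonzero | | exact C1].
  apply (cvg_opp at0), (cvg_minus at0); [| apply (cvg_const at0)].
  apply (cvg_pow at0), (cvg_minus at0); [exact C0 | apply (cvg_const at0)].
Qed.

Lemma root_candidate_pole : cvg at0 (fun u => u * s u)%C (/ 2)%C.
Proof.
  assert (L0 := weier_pole a b Ha Hb). assert (L1 := weier'_pole a b Ha Hb).
  assert (Q2 := cvg_pow at0 _ _ 2 cvg_at0_id). assert (Q4 := cvg_pow at0 _ _ 4 cvg_at0_id).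
  assert (X := cvg_minus at0 _ _ _ _
    (cvg_pow at0 _ _ 2 (cvg_minus at0 _ _ _ _ L0 (cvg_scal at0 e _ _ Q2)))
    (cvg_scal at0 ((e - x2) * (e - x3))%C _ _ Q4)).
  assert (N2 : RtoC (-2) <> RtoC 0) by (intros E; apply RtoC_inj in E; lra).
  assert (Y := cvg_div at0 _ _ _ _ N2 (cvg_opp at0 _ _ X) L1).
  replace (- ((1 - e * 0 ^ 2) ^ 2 - (e - x2) * (e - x3) * 0 ^ 4) / -2)%C with (/ 2)%C in Y.
  2:{ replace (RtoC (-2)) with (- (2))%C by (apply C_eq; simpl; ring). field. }
  refine (cvg_ext at0 _ _ _ _ Y).
  refine (filter_imp _ _ _ (filter_and _ _ at0_neq (at0_not_halflat a b Ha Hb 0%C (halflat_0 a b)))).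
  intros h [Nh Hh]. replace (0 + h)%C with h in Hh by ring.
  pose proof (weier'_nonzero a b Ha Hb h Hh). unfold s. field. auto.
Qed.

Lemma wp_root_pole : cvg at0 (fun z => z * f z)%C 1%C.
Proof.
  destruct Hr as [N [c [h [[Hh HL] Hc]]]].
  assert (R := residue_one_lim f h c N).
  rewrite Hc in R. apply R.
  - assert (X := cvg_minus at0 _ _ _ _ (weier_pole a b Ha Hb)
      (cvg_scal at0 e _ _ (cvg_pow at0 _ _ 2 cvg_at0_id))).
    replace (1 - e * 0 ^ 2)%C with (RtoC 1) in X by ring.
    refine (cvg_ext at0 _ _ _ _ X).
    destruct (near_zero_not_lat a b Ha Hb) as [k [Hk NL]].
    exists k. split; [exact Hk |]. intros y Ny Ly.
    destruct (Hf y (NL y Ny (Rlt_le _ _ Ly))) as [_ Sq].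
    replace ((y * f y) ^ 2)%C with (y ^ 2 * f y ^ 2)%C by ring. rewrite Sq. ring.
  - apply ex_derive_contc. exact (locally_singleton _ _ Hh).
  - refine (filter_imp _ _ _ (filter_and _ _ at0_neq (locally_at0 _ HL))).
    intros y [Ny Ey]. apply Ey, Ny.
Qed.

Lemma root_candidate_nonzero (u : C) : ~ halflat (2 * u)%C -> s u <> 0%C.
Proof.
  intros Hu Z.
  assert (Hu' : ~ halflat u) by (intros L; apply Hu, lat_halflat, L).
  assert (X := root_candidate_sqr u Hu'). rewrite Z in X. apply (He (2 * u)%C Hu).
  apply Cminus_eq_0. rewrite <- X. ring.
Qed.

(** The quotient f(2u)/s(u) tends to 1 at the origin, so it cannot be -1 at a generic point close to
    0; from there the sign is carried to every other point. *)
Lemma wp_root_double_generic (u : C) : ~ halflat (2 * u)%C -> f (2 * u)%C = s u.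
Proof.
  intros Hu.
  assert (R0 : cvg at0 (fun u => f (2 * u) / s u)%C 1%C).
  { assert (X := cvg_at0_double _ _ wp_root_pole).
    assert (N2 : (2 * / 2)%C <> 0%C).
    { replace (2 * / 2)%C with (RtoC 1) by field. intros E; apply RtoC_inj in E; lra. }
    assert (Y := cvg_div at0 _ _ _ _ N2 X (cvg_scal at0 2%C _ _ root_candidate_pole)).
    replace (1 / (2 * / 2))%C with (RtoC 1) in Y by field.
    refine (cvg_ext at0 _ _ _ _ Y).
    refine (filter_imp _ _ _ (filter_and _ _ at0_neq _)).
    2:{ refine (filter_imp _ _ _ (at0_double _ (at0_not_halflat a b Ha Hb 0%C (halflat_0 a b)))).
        intros h K. apply (root_candidate_nonzero h). now replace (2 * h)%C with (0 + 2 * h)%C by ring. }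
    intros h [Nh Sh]. cbv beta in Sh. field. auto. }
  destruct (proj1 (cvg_eps at0 _ _) R0 1 ltac:(lra)) as [d [Hd K]].
  (* The bound 1/8 puts both coordinates of c strictly inside a cell of the quarter-lattice; the
     other bound puts c inside the disc of radius d. *)
  set (de := Rmin (/ 8) (d / (2 * (a + b)))).
  assert (D0 : 0 < de) by (apply Rmin_pos; [lra | apply Rdiv_lt_0_compat; lra]).
  assert (D1 : de <= / 8) by apply Rmin_l.
  assert (D2 : de * (2 * (a + b)) <= d) by (apply Rle_div_r; [lra | apply Rmin_r]).
  set (c := ((de * a)%R, (de * b)%R) : C).
  assert (Gre : forall n : Z, Re c <> IZR n * (a / 4)).
  { intros n. simpl. replace (de * a) with ((IZR 0 + 4 * de) * (a / 4)) by (simpl; field).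
    apply fraction_not_multiple; lra. }
  assert (Gim : forall n : Z, Im c <> IZR n * (b / 4)).
  { intros n. simpl. replace (de * b) with ((IZR 0 + 4 * de) * (b / 4)) by (simpl; field).
    apply fraction_not_multiple; lra. }
  assert (Hc : ~ halflat (2 * c)%C).
  { intros L. apply quarterlat in L. revert L. now apply not_lat_re. }
  assert (good_sqr : forall z, ~ halflat (2 * z)%C -> (f (2 * z) ^ 2 = s z ^ 2)%C).
  { intros z Hz. rewrite root_candidate_sqr by (intros L; apply Hz, lat_halflat, L).
    apply Hf. intros L. apply Hz, lat_halflat, L. }
  apply (connect_from_generic (a / 4) (b / 4) (fun z => ~ halflat (2 * z)%C)
    (fun u => f (2 * u)%C = s u) c u); auto.
  - intros z Hz L. now apply Hz, quarterlat.
  - intros p q Hg Hp. apply (sign_constant_on_segment (fun u => f (2 * u)%C) s p q); auto.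
    intros t Ht z. assert (Hz := Hg t Ht). fold z in Hz.
    assert (Hz1 : ~ halflat z) by (intros L; apply Hz, lat_halflat, L).
    refine (conj _ (conj _ (conj _ _))).
    + apply (contc_double f). apply ex_derive_contc, Hf.
      intros L. apply Hz, lat_halflat, L.
    + now apply root_candidate_contc.
    + now apply root_candidate_nonzero.
    + now apply good_sqr.
  - assert (Sc := root_candidate_nonzero c Hc). assert (Q := good_sqr c Hc).
    assert (Kc := K c).
    assert (B : Cmod (f (2 * c) / s c - 1)%C < 1).
    { apply Kc.
      - intros E. apply (f_equal Re) in E. simpl in E. nra.
      - eapply Rle_lt_trans; [apply Cmod_le_Re_Im |]. simpl.
        rewrite !Rabs_pos_eq by nra. nra. }
    destruct (Cmult_integral (f (2 * c) - s c) (f (2 * c) + s c)) as [X | X].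
    + replace ((f (2 * c) - s c) * (f (2 * c) + s c))%C with (f (2 * c) ^ 2 - s c ^ 2)%C by ring.
      rewrite Q. ring.
    + now apply Cminus_eq_0.
    + exfalso. replace (f (2 * c)%C) with (f (2 * c) + s c - s c)%C in B by ring.
      rewrite X in B. replace ((0 - s c) / s c - 1)%C with (RtoC (-2)) in B by (field; auto).
      rewrite Cmod_R, Rabs_left in B; lra.
  - intros L. apply Hu. now apply quarterlat.
Qed.

(** If [2 * u] is a half-period but not a period, both sides are continuous at u and agree on a
    punctured neighbourhood. *)
Lemma wp_root_double (u : C) : ~ halflat u -> f (2 * u)%C = s u.
Proof.
  intros Hu. destruct (classic (halflat (2 * u)%C)) as [L | L]; [| now apply wp_root_double_generic].
  assert (C1 : contc (fun u => f (2 * u)%C) u).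
  { apply contc_double, ex_derive_contc, Hf. exact Hu. }
  assert (C2 := root_candidate_contc u Hu). unfold contc in C1, C2.
  refine (cvg_unique at0 _ _ _ C1 _). refine (cvg_ext at0 _ _ _ _ C2).
  refine (filter_imp _ _ _ (at0_double _ (at0_not_halflat a b Ha Hb _ L))).
  intros h K. symmetry. apply wp_root_double_generic.
  now replace (2 * (u + h))%C with (2 * u + 2 * h)%C by ring.
Qed.

End Roots.

(** * Elliptic integrals and the modulus *)

Definition ellg (k psi : R) : R := / sqrt (1 - k ^ 2 * sin psi ^ 2).

Lemma sin_sqr_bound (x : R) : 0 <= sin x ^ 2 <= 1.
Proof.
  pose proof (SIN_bound x). split; [apply pow2_ge_0 | nra].
Qed.

Lemma ellg_pos (k x : R) : 0 < k < 1 -> 0 < 1 - k ^ 2 * sin x ^ 2.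
Proof. intros Hk. pose proof (sin_sqr_bound x). nra. Qed.

Lemma ellg_continuous (k x : R) : 0 < k < 1 -> continuous (ellg k) x.
Proof.
  intros Hk. apply continuity_pt_filterlim. unfold ellg.
  assert (P := ellg_pos k x Hk).
  apply derivable_continuous_pt. apply ex_derive_Reals_0. auto_derive.
  split; [exact P |]. split; [| exact I].
  apply Rgt_not_eq, sqrt_lt_R0, P.
Qed.

Lemma ellK_increasing (k l : R) : 0 < k -> k < l -> l < 1 -> ellK k < ellK l.
Proof.
  intros H1 H2 H3. unfold ellK. pose proof PI_RGT_0.
  apply RInt_lt; [lra | | |].
  - intros x _. apply (ellg_continuous l); lra.
  - intros x _. apply (ellg_continuous k); lra.
  - intros x Hx.
    assert (S : 0 < sin x) by (apply sin_gt_0; lra).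
    assert (P1' := ellg_pos k x ltac:(lra)). assert (P2' := ellg_pos l x ltac:(lra)).
    apply Rinv_lt_contravar.
    + apply Rmult_lt_0_compat; apply sqrt_lt_R0; assumption.
    + apply sqrt_lt_1; [lra | lra |]. assert (Q1 : 0 < sin x ^ 2) by nra.
      assert (Q2 : k ^ 2 < l ^ 2) by nra.
      apply (Rmult_lt_compat_r _ _ _ Q1) in Q2. lra.
Qed.

Lemma ellK_pos (k : R) : 0 < k < 1 -> 0 < ellK k.
Proof.
  intros Hk. unfold ellK. pose proof PI_RGT_0. apply RInt_gt_0; [lra | |].
  - intros x _. apply Rinv_0_lt_compat, sqrt_lt_R0, ellg_pos, Hk.
  - intros x _. now apply (ellg_continuous k).
Qed.

Definition ellF (k phi : R) : R := RInt (ellg k) 0 phi.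

Lemma ellF_derive (k x : R) : 0 < k < 1 -> is_derive (ellF k) x (ellg k x).
Proof.
  intros Hk. apply (is_derive_RInt (ellg k) (ellF k) 0).
  - apply filter_forall. intros y. apply (RInt_correct (V := R_CompleteNormedModule)).
    apply (ex_RInt_continuous (V := R_CompleteNormedModule)). intros z _.
    now apply ellg_continuous.
  - now apply ellg_continuous.
Qed.

Lemma ellg_bound (k x : R) : 0 < k < 1 -> 0 <= ellg k x <= / sqrt (1 - k ^ 2).
Proof.
  intros Hk. assert (P := ellg_pos k x Hk). pose proof (sin_sqr_bound x).
  assert (Q : 0 < 1 - k ^ 2) by nra. split.
  - left. apply Rinv_0_lt_compat, sqrt_lt_R0, P.
  - apply Rinv_le_contravar; [now apply sqrt_lt_R0 |]. apply sqrt_le_1; nra.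
Qed.

Lemma ellF_lipschitz (k x y : R) : 0 < k < 1 -> x <= y ->
  0 <= ellF k y - ellF k x <= / sqrt (1 - k ^ 2) * (y - x).
Proof.
  intros Hk Hxy.
  destruct (MVT_gen (ellF k) x y (ellg k)) as [c [_ E]].
  - intros z _. now apply ellF_derive.
  - intros z _. apply derivable_continuous_pt. exists (ellg k z).
    now apply is_derive_Reals, ellF_derive.
  - rewrite E. pose proof (ellg_bound k c Hk). split; [nra |].
    apply Rmult_le_compat_r; lra.
Qed.

Lemma atan_le (y : R) : 0 <= y -> 0 <= atan y <= y.
Proof.
  intros Hy. destruct (MVT_gen atan 0 y (fun x => / (1 + x ^ 2))) as [c [_ E]].
  - intros x _. auto_derive; [exact I | field; nra].
  - intros x _. apply derivable_continuous_pt, derivable_pt_atan.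
  - rewrite atan_0 in E.
    assert (0 < / (1 + c ^ 2) <= 1).
    { split; [apply Rinv_0_lt_compat; nra |].
      rewrite <- Rinv_1. apply Rinv_le_contravar; nra. }
    split; nra.
Qed.

(** * Real inversion of an elliptic integral, from the pole to the largest root *)

Section EllipticInversion.
Variables (P Q : R -> R) (h r1 r2 r3 : R).
Hypotheses (Hh : 0 < h)
  (HP : forall x, 0 < x <= h -> is_derive P x (Q x))
  (HQc : forall x, 0 < x <= h -> continuity_pt Q x)
  (HQ : forall x, 0 < x <= h -> Q x ^ 2 = 4 * ((P x - r1) * (P x - r2) * (P x - r3)))
  (H0 : forall M, exists d, 0 < d /\ forall x, 0 < x < d -> M < P x)
  (Hend : P h = r1)
  (HQ0 : forall x, 0 < x < h -> Q x <> 0)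
  (N12 : r1 <> r2) (N13 : r1 <> r3).

Lemma inversion_continuity (x : R) : 0 < x <= h -> continuity_pt P x.
Proof.
  intros Hx. apply derivable_continuous_pt. exists (Q x). now apply is_derive_Reals, HP.
Qed.

(** [P] comes down from plus infinity, hence meets every value above [P x] before reaching x. *)
Lemma ivt_from_pole (x r : R) : 0 < x <= h -> P x < r -> exists y, 0 < y < x /\ P y = r.
Proof.
  intros Hx Hr. destruct (H0 r) as [d [Hd K]].
  set (x0 := Rmin (d / 2) (x / 2)).
  assert (A : 0 < x0) by (apply Rmin_pos; lra).
  assert (B : x0 <= d / 2) by apply Rmin_l. assert (B' : x0 <= x / 2) by apply Rmin_r.
  assert (V : r < P x0) by (apply K; lra).
  destruct (Ranalysis5.IVT_interv (fun y => r - P y) x0 x) as [y [Hy Ey]].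
  - intros z Hz. apply continuity_pt_minus; [apply continuity_pt_const; now intros u v |].
    apply inversion_continuity; lra.
  - lra.
  - lra.
  - lra.
  - exists y. split; [| lra]. split; [lra |].
    destruct (Req_dec y x) as [-> | Ny]; lra.
Qed.

Lemma no_root_inside (x r : R) : 0 < x < h -> r = r1 \/ r = r2 \/ r = r3 -> P x <> r.
Proof.
  intros Hx Hr E. apply (HQ0 x Hx).
  assert (X := HQ x ltac:(lra)). rewrite E in X.
  assert (Z : Q x ^ 2 = 0) by (rewrite X; destruct Hr as [-> | [-> | ->]]; ring).
  nra.
Qed.

(** On its way from plus infinity to r1, [P] would cross any larger root at an interior point, where
    [Q] would have to vanish. *)
Lemma largest_root : r2 < r1 /\ r3 < r1.
Proof.
  split; apply Rnot_le_lt; intros L.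
  - destruct (ivt_from_pole h r2) as [y [Hy Ey]]; [lra | lra |].
    apply (no_root_inside y r2); auto.
  - destruct (ivt_from_pole h r3) as [y [Hy Ey]]; [lra | lra |].
    apply (no_root_inside y r3); auto.
Qed.

Lemma above_largest_root (x : R) : 0 < x < h -> r1 < P x.
Proof.
  intros Hx. apply Rnot_le_lt. intros L.
  destruct (Req_dec (P x) r1) as [E | N]; [now apply (no_root_inside x r1); auto |].
  destruct (ivt_from_pole x r1) as [y [Hy Ey]]; [lra | lra |].
  apply (no_root_inside y r1); auto. lra.
Qed.

(** [Q] keeps its sign in the interior, and the mean value theorem exhibits a point where it is
    negative, since [P] falls to r1. *)
Lemma inversion_decreasing (x : R) : 0 < x < h -> Q x < 0.
Proof.
  intros Hx. apply Rnot_le_lt. intros L. pose proof (HQ0 x Hx).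
  destruct (MVT_gen P x h Q) as [c [Hc Ec]].
  - intros z Hz. rewrite Rmin_left, Rmax_right in Hz by lra. apply HP; lra.
  - intros z Hz. rewrite Rmin_left, Rmax_right in Hz by lra. apply inversion_continuity; lra.
  - rewrite Rmin_left, Rmax_right in Hc by lra.
    pose proof (above_largest_root x Hx). rewrite Hend in Ec.
    assert (Qc : Q c < 0) by nra.
    assert (Nc : x < c) by (destruct (Req_dec x c) as [-> |]; lra).
    destruct (Ranalysis5.IVT_interv (fun y => - Q y) x c) as [y [Hy Ey]].
    + intros z Hz. apply continuity_pt_opp, HQc; lra.
    + lra.
    + lra.
    + lra.
    + destruct (Req_dec y h) as [-> | Ny].
      * assert (c = h) by lra. subst c.
        assert (X := HQ h ltac:(lra)). rewrite Hend in X. nra.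
      * apply (HQ0 y); lra.
Qed.

Hypothesis (H23 : r2 < r3).

Let D := r1 - r2.
Let kap := sqrt ((r3 - r2) / D).
(** The amplitude in the classical formula P = r2 + (r1 - r2)/sn^2: here sin(theta)^2 = D/(P - r2).
    The form with [atan] tends to 0 at the pole and to PI/2 at h. *)
Let theta (x : R) := atan (sqrt (D / (P x - r1))).

Lemma root_gap_pos : 0 < D.
Proof. pose proof largest_root. unfold D. lra. Qed.

Lemma kap_sqr : kap ^ 2 = (r3 - r2) / D.
Proof.
  unfold kap. rewrite <- Rsqr_pow2, Rsqr_sqrt; [reflexivity |].
  pose proof root_gap_pos. apply Rdiv_le_0_compat; lra.
Qed.

Lemma kap_range : 0 < kap < 1.
Proof.
  pose proof root_gap_pos. pose proof largest_root.
  assert (A : 0 < (r3 - r2) / D) by (apply Rdiv_lt_0_compat; lra).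
  assert (B : (r3 - r2) / D < 1) by (apply Rlt_div_l; unfold D in *; lra).
  split; [now apply sqrt_lt_R0 |]. unfold kap. rewrite <- sqrt_1. apply sqrt_lt_1; lra.
Qed.

Lemma theta_derive (x : R) : 0 < x < h ->
  is_derive theta x (sqrt D * sqrt ((P x - r3) / (P x - r2))).
Proof.
  intros Hx. pose proof root_gap_pos as HD. pose proof largest_root as LR.
  pose proof (above_largest_root x Hx) as PA. pose proof (inversion_decreasing x Hx) as QN.
  assert (Hq := HQ x ltac:(lra)). assert (HPx := HP x ltac:(lra)).
  assert (T : 0 < D / (P x - r1)) by (apply Rdiv_lt_0_compat; lra).
  unfold theta. auto_derive.
  - refine (conj (ex_intro _ _ HPx) (conj _ (conj T I))). lra.
  - replace (Derive (fun x : R => P x) x) with (Q x) by (symmetry; apply is_derive_unique, HPx).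
    (* The differential equation determines [Q x] up to sign, and [inversion_decreasing] selects the
       negative root. *)
    assert (EQ : Q x = - (2 * (sqrt (P x - r1) * sqrt (P x - r2) * sqrt (P x - r3)))).
    { rewrite <- !sqrt_mult by nra.
      set (m := (P x - r1) * (P x - r2) * (P x - r3)) in *.
      assert (Hm : 0 <= m) by (unfold m; apply Rmult_le_pos; [apply Rmult_le_pos |]; lra).
      pose proof (sqrt_pos m). pose proof (sqrt_sqrt m Hm).
      assert (Z : (Q x + 2 * sqrt m) * (Q x - 2 * sqrt m) = 0) by nra.
      apply Rmult_integral in Z. lra. }
    change (P x + - r1) with (P x - r1). change (D * / (P x - r1)) with (D / (P x - r1)).
    rewrite EQ. rewrite (sqrt_div_alt D), (sqrt_div_alt (P x - r3)) by lra.
    assert (E1 := sqrt_sqrt D ltac:(lra)).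
    assert (E2 := sqrt_sqrt (P x - r1) ltac:(lra)).
    assert (E3 := sqrt_sqrt (P x - r2) ltac:(lra)).
    assert (S1 := sqrt_lt_R0 D HD). assert (S2 := sqrt_lt_R0 (P x - r1) ltac:(lra)).
    assert (S3 := sqrt_lt_R0 (P x - r2) ltac:(lra)).
    set (sd := sqrt D) in *. set (sp := sqrt (P x - r1)) in *. set (sq := sqrt (P x - r2)) in *.
    set (ss := sqrt (P x - r3)) in *.
    assert (EP : P x - r1 = sp * sp) by lra. rewrite EP. rewrite <- E1.
    assert (ES : sq * sq = sp * sp + sd * sd) by (rewrite E1, E2, E3; unfold D; ring).
    assert (PP : 0 < sp * sp + sd * sd) by nra.
    match goal with |- ?l = ?r => replace l with (sd * ss * sq / (sp * sp + sd * sd)) end.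
    + rewrite <- ES. field. lra.
    + field. repeat split; nra.
Qed.

Lemma ellF_theta_derive (x : R) : 0 < x < h ->
  is_derive (fun x => ellF kap (theta x)) x (sqrt D).
Proof.
  intros Hx. pose proof root_gap_pos as HD. pose proof largest_root as LR.
  pose proof (above_largest_root x Hx) as PA.
  assert (X := is_derive_comp (ellF kap) theta x _ _
    (ellF_derive kap (theta x) kap_range) (theta_derive x Hx)).
  assert (T : 0 < D / (P x - r1)) by (apply Rdiv_lt_0_compat; lra).
  (* The choice of [kap] makes 1 - kap^2 sin(theta)^2 equal to (P - r3)/(P - r2), which cancels the
     nonconstant factor of the derivative of theta. *)
  assert (E : ellg kap (theta x) = / sqrt ((P x - r3) / (P x - r2))).
  { unfold ellg. do 2 f_equal. rewrite kap_sqr. unfold theta. rewrite sin_atan.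
    assert (Y2 := sqrt_sqrt _ (Rlt_le _ _ T)). set (y := sqrt (D / (P x - r1))) in *.
    assert (Z2 := sqrt_sqrt (1 + Rsqr y) ltac:(unfold Rsqr; nra)).
    assert (Z := sqrt_lt_R0 (1 + Rsqr y) ltac:(unfold Rsqr; nra)).
    set (z := sqrt (1 + Rsqr y)) in *.
    replace ((y / z) ^ 2) with ((y * y) / (z * z)) by (field; lra).
    rewrite Z2. unfold Rsqr. rewrite Y2. unfold D in *. field. repeat split; lra. }
  rewrite E in X.
  assert (S : 0 < sqrt ((P x - r3) / (P x - r2)))
    by (apply sqrt_lt_R0, Rdiv_lt_0_compat; lra).
  replace (sqrt D) with (scal (sqrt D * sqrt ((P x - r3) / (P x - r2)))
    (/ sqrt ((P x - r3) / (P x - r2)))); [exact X |].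
  change (sqrt D * sqrt ((P x - r3) / (P x - r2)) * / sqrt ((P x - r3) / (P x - r2)) = sqrt D).
  field. lra.
Qed.

(** The difference of [ellF kap (theta x)] and [sqrt D * x] is constant on the open interval. Its
    limits at the ends are 0 and K(kap) - h sqrt D; they are found by estimates, because the formula
    for theta degenerates at both ends. *)
Lemma elliptic_inversion : h * sqrt (r1 - r2) = ellK kap.
Proof.
  pose proof root_gap_pos as HD. pose proof kap_range as HK. pose proof largest_root as LR.
  fold D. change (ellK kap) with (ellF kap (PI / 2)).
  set (W := fun x => ellF kap (theta x) - sqrt D * x).
  set (gm := / sqrt (1 - kap ^ 2)).
  assert (Hgm : 0 < gm) by (apply Rinv_0_lt_compat, sqrt_lt_R0; nra).
  assert (SD : 0 < sqrt D) by now apply sqrt_lt_R0.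
  assert (WC : forall x, 0 < x < h -> W x = W (h / 2)).
  { intros x Hx. destruct (MVT_gen W (h / 2) x (fun _ => 0)) as [c [_ E]].
    - intros z Hz.
      assert (Hz' : 0 < z < h).
      { split; [eapply Rlt_trans; [| apply Hz]; apply Rmin_pos; lra |].
        eapply Rlt_trans; [apply Hz |]. apply Rmax_lub_lt; lra. }
      replace 0 with (sqrt D - sqrt D) by ring.
      apply (is_derive_minus (V := R_NormedModule)); [now apply ellF_theta_derive |].
      auto_derive; [exact I | ring].
    - intros z Hz.
      assert (Hz' : 0 < z < h).
      { split; [eapply Rlt_le_trans; [| apply Hz]; apply Rmin_pos; lra |].
        eapply Rle_lt_trans; [apply Hz |]. apply Rmax_lub_lt; lra. }
      apply derivable_continuous_pt. apply ex_derive_Reals_0. unfold W.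
      apply (ex_derive_minus (V := R_NormedModule)).
      + eexists. now apply ellF_theta_derive.
      + auto_derive. exact I.
    - lra. }
  assert (Bnd : forall x, 0 < x < h ->
    0 <= ellF kap (theta x) <= gm * sqrt (D / (P x - r1)) /\
    0 <= ellF kap (PI / 2) - ellF kap (theta x) <= gm * sqrt ((P x - r1) / D)).
  { intros x Hx. pose proof (above_largest_root x Hx) as PA.
    assert (T : 0 < D / (P x - r1)) by (apply Rdiv_lt_0_compat; lra).
    assert (ST := sqrt_lt_R0 _ T).
    assert (A := atan_le _ (Rlt_le _ _ ST)). fold (theta x) in A.
    assert (F0 : ellF kap 0 = 0) by (apply (RInt_point (V := R_CompleteNormedModule))).
    split.
    - assert (L := ellF_lipschitz kap 0 (theta x) HK ltac:(lra)). fold gm in L.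
      rewrite F0, Rminus_0_r in L. split; [lra |]. nra.
    - assert (I := atan_inv _ ST). fold (theta x) in I.
      assert (EI : / sqrt (D / (P x - r1)) = sqrt ((P x - r1) / D)).
      { rewrite <- sqrt_inv. f_equal. field. lra. }
      rewrite EI in I.
      assert (A' := atan_le (sqrt ((P x - r1) / D)) (sqrt_pos _)).
      assert (L := ellF_lipschitz kap (theta x) (PI / 2) HK ltac:(lra)). fold gm in L.
      split; [lra |]. nra. }
  assert (Small : forall d eps, 0 < d -> 0 < eps -> exists x,
    0 < x /\ x <= d / 2 /\ x <= h / 2 /\ x * (2 * sqrt D) <= eps).
  { intros d eps Hd He. set (m := Rmin (d / 2) (h / 2)).
    assert (m1 : m <= d / 2) by apply Rmin_l. assert (m2 : m <= h / 2) by apply Rmin_r.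
    exists (Rmin m (eps / (2 * sqrt D))).
    pose proof (Rmin_l m (eps / (2 * sqrt D))). split; [| split; [lra | split; [lra |]]].
    - repeat apply Rmin_pos; try lra. apply Rdiv_lt_0_compat; lra.
    - apply Rle_div_r; [lra | apply Rmin_r]. }
  assert (W0 : W (h / 2) = 0).
  { apply Rabs_eq_0. apply Rle_antisym; [| apply Rabs_pos].
    apply le_epsilon. intros eps He. rewrite Rplus_0_l.
    (* Half of [eps] is spent on the elliptic integral, whose Lipschitz constant is [gm], and half
       on [sqrt D * x]. *)
    set (del := eps / (2 * gm)). assert (Hdel : 0 < del) by (apply Rdiv_lt_0_compat; lra).
    destruct (H0 (r1 + D / del ^ 2)) as [d [Hd K]].
    destruct (Small d eps Hd He) as [x [x1 [x2 [x3 x4]]]].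
    assert (Hx : 0 < x < h) by lra.
    rewrite <- (WC x Hx). destruct (Bnd x Hx) as [[B1 B2] _].
    specialize (K x ltac:(lra)).
    assert (D2 : 0 < del ^ 2) by (apply pow_lt, Hdel).
    assert (SB : sqrt (D / (P x - r1)) <= del).
    { rewrite <- (sqrt_pow2 del) by lra. apply sqrt_le_1_alt.
      assert (D / del ^ 2 < P x - r1) by lra.
      apply Rle_div_l.
      - assert (0 < D / del ^ 2) by (apply Rdiv_lt_0_compat; lra). lra.
      - apply Rlt_div_l in H; [| exact D2]. lra. }
    assert (gm * sqrt (D / (P x - r1)) <= eps / 2).
    { replace (eps / 2) with (gm * del) by (unfold del; field; lra).
      apply Rmult_le_compat_l; lra. }
    unfold W. apply Rabs_le. nra. }
  enough (E : ellF kap (PI / 2) - sqrt D * h = 0) by lra.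
  apply Rabs_eq_0. apply Rle_antisym; [| apply Rabs_pos].
  apply le_epsilon. intros eps He. rewrite Rplus_0_l.
  set (del := eps / (2 * gm)). assert (Hdel : 0 < del) by (apply Rdiv_lt_0_compat; lra).
  assert (D2 : 0 < D * del ^ 2) by (apply Rmult_lt_0_compat; [lra | apply pow_lt, Hdel]).
  destruct (inversion_continuity h ltac:(lra) (D * del ^ 2) D2) as [d [Hd K]].
  destruct (Small d eps Hd He) as [y [x1 [x2 [x3 x4]]]].
  assert (Hx : 0 < h - y < h) by lra.
  destruct (Bnd (h - y) Hx) as [_ [B1 B2]].
  assert (Kx : Rabs (P (h - y) - P h) < D * del ^ 2).
  { apply K. split; [split; [exact I | lra] |].
    change (Rabs (h - y - h) < d). replace (h - y - h) with (- y) by ring.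
    rewrite Rabs_Ropp, Rabs_pos_eq; lra. }
  rewrite Hend in Kx. pose proof (Rle_abs (P (h - y) - r1)).
  assert (SB : sqrt ((P (h - y) - r1) / D) <= del).
  { rewrite <- (sqrt_pow2 del) by lra. apply sqrt_le_1_alt. apply Rle_div_l; lra. }
  assert (gm * sqrt ((P (h - y) - r1) / D) <= eps / 2).
  { replace (eps / 2) with (gm * del) by (unfold del; field; lra).
    apply Rmult_le_compat_l; lra. }
  assert (E := WC (h - y) Hx). rewrite W0 in E. unfold W in E.
  apply Rabs_le. nra.
Qed.

End EllipticInversion.

(** * The modulus determined by the periods *)

Lemma kc_range (k : R) : 0 < k < 1 -> 0 < kc k < 1 /\ kc k ^ 2 = 1 - k ^ 2.
Proof.
  intros Hk. assert (P : 0 < 1 - k ^ 2 < 1) by nra. unfold kc. split.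
  - split; [apply sqrt_lt_R0; lra |]. rewrite <- sqrt_1 at 2. apply sqrt_lt_1; lra.
  - rewrite <- Rsqr_pow2, Rsqr_sqrt; lra.
Qed.

(* K'/K is strictly monotone, so the period ratio determines the modulus. *)
Lemma modulus_unique (k r1 r2 r3 : R) : 0 < k < 1 -> r2 < r3 -> r3 < r1 ->
  sqrt (k * kc k) * ellK k * sqrt (r1 - r2) = ellK (sqrt ((r3 - r2) / (r1 - r2))) ->
  sqrt (k * kc k) * ellK (kc k) * sqrt (r1 - r2) = ellK (sqrt ((r1 - r3) / (r1 - r2))) ->
  r1 - r3 = kc k / k /\ r3 - r2 = k / kc k.
Proof.
  intros Hk H23 H31 E1 E2. destruct (kc_range k Hk) as [Hc Ec].
  set (D := r1 - r2) in *. assert (HD : 0 < D) by (unfold D; lra).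
  set (l := sqrt ((r3 - r2) / D)) in *. set (l' := sqrt ((r1 - r3) / D)) in *.
  assert (A : 0 < (r3 - r2) / D) by (apply Rdiv_lt_0_compat; lra).
  assert (A' : 0 < (r1 - r3) / D) by (apply Rdiv_lt_0_compat; lra).
  assert (AA : (r3 - r2) / D + (r1 - r3) / D = 1) by (unfold D in *; field; lra).
  assert (L2 : l ^ 2 = (r3 - r2) / D) by (unfold l; rewrite <- Rsqr_pow2, Rsqr_sqrt; lra).
  assert (L2' : l' ^ 2 = (r1 - r3) / D) by (unfold l'; rewrite <- Rsqr_pow2, Rsqr_sqrt; lra).
  assert (Pl : 0 < l) by now apply sqrt_lt_R0. assert (Pl' : 0 < l') by now apply sqrt_lt_R0.
  assert (Kk := ellK_pos k Hk). assert (Kc := ellK_pos (kc k) Hc).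
  assert (Pkk : 0 < k * kc k) by nra.
  set (c := sqrt (k * kc k) * sqrt D).
  assert (F1 : c * ellK k = ellK l) by (unfold c; rewrite <- E1; ring).
  assert (F2 : c * ellK (kc k) = ellK l') by (unfold c; rewrite <- E2; ring).
  assert (El : l = k).
  { destruct (Rtotal_order l k) as [L | [L | L]]; [| exact L |]; exfalso.
    - assert (L' : kc k < l') by nra.
      assert (M1 := ellK_increasing l k Pl L ltac:(lra)).
      assert (M2 := ellK_increasing (kc k) l' ltac:(lra) L' ltac:(nra)). nra.
    - assert (L' : l' < kc k) by nra.
      assert (M1 := ellK_increasing k l ltac:(lra) L ltac:(nra)).
      assert (M2 := ellK_increasing l' (kc k) Pl' L' ltac:(lra)). nra. }
  rewrite El in F1. assert (C1 : c = 1) by nra.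
  assert (C2 : k * kc k * D = 1).
  { unfold c in C1. rewrite <- sqrt_mult in C1 by lra.
    rewrite <- (sqrt_sqrt (k * kc k * D)) by nra. rewrite C1. ring. }
  rewrite El in L2.
  assert (ED : D = / (k * kc k)).
  { apply (Rmult_eq_reg_l (k * kc k)); [| lra]. rewrite C2. field. lra. }
  assert (G1 : r3 - r2 = k ^ 2 * D) by (rewrite L2; field; lra).
  assert (G2 : r1 - r3 = kc k ^ 2 * D) by (rewrite Ec; unfold D in *; lra).
  rewrite G1, G2, ED. split; field; lra.
Qed.

(** * The Weierstrass function on the real and imaginary axes *)

Section Axes.
Variables (a b : R).
Hypotheses (Ha : 0 < a) (Hb : 0 < b).

Local Notation lat := (in_lat a b).
Local Notation halflat := (in_halflat a b).
Local Notation pe := (weier a b).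
Local Notation pe' := (weier' a b).

Lemma weier'_conj (z : C) : pe' (Cconj z) = Cconj (pe' z).
Proof.
  unfold weier'. rewrite Cmult_conj.
  replace (Cconj (-2)) with (RtoC (-2)) by (apply C_eq; simpl; ring). f_equal.
  unfold cube_sum. rewrite <- lsum_conj. apply lsum_ext. intros N.
  rewrite <- (csum_box_conj (eis_term a b 3 (Cconj z))).
  apply csum_ext. intros v _. unfold eis_term. rewrite lpoint_conj.
  now rewrite Cinv_conj_total, Cpow_conj, Cminus_conj.
Qed.

Lemma real_of_conj (z : C) : Cconj z = z -> z = RtoC (Re z).
Proof.
  intros E. apply C_eq; [reflexivity |].
  apply (f_equal Im) in E. simpl in E. unfold Im in *. simpl. lra.
Qed.

Section Axis.
Variables (d : C) (ep hl : R) (Ea Eb Ec : C).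
Hypotheses (Hep : ep = 1 \/ ep = -1) (Hd2 : (d * d)%C = RtoC ep)
  (Hdc : Cconj d = (RtoC ep * d)%C) (Hhl : 0 < hl)
  (Hlat : forall t, 0 < t <= hl -> ~ lat (0 + RtoC t * d)%C)
  (Hhalf : forall t, 0 < t < hl -> ~ halflat (0 + RtoC t * d)%C)
  (Hend : pe (0 + RtoC hl * d)%C = Ea)
  (Hsq : forall z, ~ lat z -> (pe' z ^ 2 = 4 * ((pe z - Ea) * (pe z - Eb) * (pe z - Ec)))%C)
  (Ra : Ea = RtoC (Re Ea)) (Rb : Eb = RtoC (Re Eb)) (Rc : Ec = RtoC (Re Ec))
  (Nab : Ea <> Eb) (Nac : Ea <> Ec).

Lemma path_conj (t : R) : Cconj (0 + RtoC t * d)%C = (0 + RtoC t * d)%C \/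
  Cconj (0 + RtoC t * d)%C = (- (0 + RtoC t * d))%C.
Proof.
  rewrite Cplus_conj, Cmult_conj, Hdc.
  replace (Cconj 0) with (RtoC 0) by (apply C_eq; simpl; ring).
  replace (Cconj (RtoC t)) with (RtoC t) by (apply C_eq; simpl; ring).
  destruct Hep as [-> | ->]; [left | right; replace (RtoC (-1)) with (- (1))%C by
    (apply C_eq; simpl; ring)]; ring.
Qed.

Lemma axis_weier_real (t : R) : pe (0 + RtoC t * d)%C = RtoC (Re (pe (0 + RtoC t * d)%C)).
Proof.
  apply real_of_conj. rewrite <- weier_conj.
  destruct (path_conj t) as [-> | ->]; [reflexivity | apply weier_even].
Qed.

Lemma axis_weier'_real (t : R) : (d * pe' (0 + RtoC t * d))%C = RtoC (Re (d * pe' (0 + RtoC t * d))%C).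
Proof.
  apply real_of_conj. rewrite Cmult_conj, <- weier'_conj, Hdc.
  assert (E : Cconj (0 + RtoC t * d)%C = (RtoC ep * (0 + RtoC t * d))%C).
  { rewrite Cplus_conj, Cmult_conj, Hdc.
    replace (Cconj 0) with (RtoC 0) by (apply C_eq; simpl; ring).
    replace (Cconj (RtoC t)) with (RtoC t) by (apply C_eq; simpl; ring). ring. }
  rewrite E. destruct Hep as [-> | ->].
  - replace (1 * (0 + RtoC t * d))%C with (0 + RtoC t * d)%C by ring. ring.
  - replace (RtoC (-1)) with (- (1))%C by (apply C_eq; simpl; ring).
    replace (- (1) * (0 + RtoC t * d))%C with (- (0 + RtoC t * d))%C by ring.
    rewrite weier'_odd. ring.
Qed.

(** One treatment of both axes: d = 1 with ep = 1, and d = i with ep = -1. On the imaginary axis the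
    pole goes to minus infinity; the factor [ep] turns it upwards and, as ep^3 = ep, preserves the
    form of the differential equation. *)
Let P (t : R) : R := ep * Re (pe (0 + RtoC t * d)%C).
Let Q (t : R) : R := ep * Re (d * pe' (0 + RtoC t * d))%C.

Lemma axis_derive (t : R) : 0 < t <= hl -> is_derive P t (Q t).
Proof.
  intros Ht. apply (is_derive_scal (fun t => Re (pe (0 + RtoC t * d)%C))).
  exact (proj1 (hasd_path pe 0%C d _ t (hasd_weier a b Ha Hb _ (Hlat t Ht)))).
Qed.

Lemma axis_continuity (t : R) : 0 < t <= hl -> continuity_pt Q t.
Proof.
  intros Ht. apply derivable_continuous_pt. apply ex_derive_Reals_0.
  apply (ex_derive_scal (fun t => Re (d * pe' (0 + RtoC t * d))%C)).
  eexists.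
  exact (proj1 (hasd_path (fun z => d * pe' z)%C 0%C d _ t
    (hasd_scal d pe' _ _ (hasd_weier' a b Ha Hb _ (Hlat t Ht))))).
Qed.

Lemma axis_square (t : R) : 0 < t <= hl ->
  Q t ^ 2 = 4 * ((P t - ep * Re Ea) * (P t - ep * Re Eb) * (P t - ep * Re Ec)).
Proof.
  intros Ht. set (z := (0 + RtoC t * d)%C).
  assert (E : ((d * pe' z) ^ 2 = RtoC ep * (4 * ((pe z - Ea) * (pe z - Eb) * (pe z - Ec))))%C).
  { rewrite <- Hsq by (apply Hlat, Ht). rewrite <- Hd2. ring. }
  unfold z in E. rewrite axis_weier'_real, axis_weier_real, Ra, Rb, Rc in E.
  unfold Q, P. set (q := Re (d * _)%C) in *. set (p := Re (pe _)) in *.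
  rewrite <- !RtoC_minus, <- !RtoC_mult, <- RtoC_pow in E.
  apply RtoC_inj in E.
  destruct Hep as [-> | ->]; nra.
Qed.

Lemma axis_pole (M : R) : exists dl, 0 < dl /\ forall t, 0 < t < dl -> M < P t.
Proof.
  destruct (proj1 (cvg_eps at0 _ _) (weier_pole a b Ha Hb) (/ 2) ltac:(lra)) as [r [Hr K]].
  set (m := Rmax 1 M). assert (m1 : 1 <= m) by apply Rmax_l. assert (m2 : M <= m) by apply Rmax_r.
  assert (Nd : d <> 0%C).
  { intros E. rewrite E in Hd2. replace (0 * 0)%C with (RtoC 0) in Hd2 by ring.
    apply RtoC_inj in Hd2. lra. }
  assert (Md : Cmod d = 1).
  { assert (X : Cmod (d * d)%C = 1).
    { rewrite Hd2, Cmod_R. destruct Hep as [-> | ->]; [apply Rabs_R1 |].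
      rewrite Rabs_left; lra. }
    rewrite Cmod_mult in X. pose proof (Cmod_ge_0 d). nra. }
  (* Within r, t^2 P(t) exceeds 1/2. If P(t) <= m, then t m < 1/2 and t < 1 would give t^2 P(t) <
     1/2; taking m >= 1 ensures t < 1. *)
  set (dl := Rmin r (/ (2 * m))).
  assert (A1 : dl <= r) by apply Rmin_l. assert (A2 : dl <= / (2 * m)) by apply Rmin_r.
  exists dl. split; [apply Rmin_pos; [exact Hr | apply Rinv_0_lt_compat; lra] |].
  intros t Ht. specialize (K (0 + RtoC t * d)%C).
  assert (B : Cmod ((0 + RtoC t * d) ^ 2 * pe (0 + RtoC t * d) - 1)%C < / 2).
  { apply K.
    - replace (0 + RtoC t * d)%C with (RtoC t * d)%C by ring.
      apply Cmult_neq_0; [intros E; apply RtoC_inj in E; lra | exact Nd].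
    - replace (0 + RtoC t * d)%C with (RtoC t * d)%C by ring.
      rewrite Cmod_mult, Md, Cmod_R, Rabs_pos_eq; lra. }
  replace ((0 + RtoC t * d) ^ 2)%C with (RtoC t * RtoC t * (d * d))%C in B by ring.
  rewrite Hd2, axis_weier_real in B.
  rewrite <- !RtoC_mult, <- RtoC_minus, Cmod_R in B.
  unfold P. set (p := Re (pe _)) in *.
  apply Rabs_def2 in B.
  assert (T : t * (2 * m) < 1).
  { apply (Rmult_lt_reg_r (/ (2 * m))); [apply Rinv_0_lt_compat; lra |].
    replace (t * (2 * m) * / (2 * m)) with t by (field; lra). lra. }
  assert (T2 : / 2 < t * t * (ep * p)) by lra.
  assert (t < 1) by nra.
  apply Rnot_le_lt. intros L.
  assert (0 < ep * p) by nra.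
  assert (t * t * (ep * p) <= t * (t * m)) by nra. nra.
Qed.

Lemma axis_ends (E : C) : E = RtoC (Re E) -> Ea <> E -> ep * Re Ea <> ep * Re E.
Proof.
  intros RE N X. apply N. rewrite Ra, RE. f_equal. destruct Hep as [-> | ->]; lra.
Qed.

Lemma axis_nonzero (t : R) : 0 < t < hl -> Q t <> 0.
Proof.
  intros Ht E. apply (weier'_nonzero a b Ha Hb _ (Hhalf t Ht)).
  assert (X := axis_weier'_real t). unfold Q in E.
  assert (Z : Re (d * pe' (0 + RtoC t * d))%C = 0) by (destruct Hep as [-> | ->]; lra).
  rewrite Z in X. destruct (Cmult_integral _ _ X) as [Y | Y]; [| exact Y].
  exfalso. rewrite Y in Hd2. replace (0 * 0)%C with (RtoC 0) in Hd2 by ring.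
  apply RtoC_inj in Hd2. lra.
Qed.

Lemma axis_order : ep * Re Eb < ep * Re Ea /\ ep * Re Ec < ep * Re Ea.
Proof.
  apply (largest_root P Q hl); auto using axis_derive, axis_square, axis_pole, axis_nonzero.
  - unfold P. now rewrite Hend.
  - now apply axis_ends.
  - now apply axis_ends.
Qed.

Lemma axis_period : ep * Re Eb < ep * Re Ec ->
  hl * sqrt (ep * Re Ea - ep * Re Eb) =
  ellK (sqrt ((ep * Re Ec - ep * Re Eb) / (ep * Re Ea - ep * Re Eb))).
Proof.
  intros H. apply (elliptic_inversion P Q hl);
    auto using axis_derive, axis_square, axis_pole, axis_nonzero, axis_continuity.
  - unfold P. now rewrite Hend.
  - now apply axis_ends.
  - now apply axis_ends.
Qed.

End Axis.

Local Notation E1 := (pe (half1 a)).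
Local Notation E2 := (pe (half2 b)).
Local Notation E3 := (pe (half3 a b)).

(** Conjugation maps each half-period to plus or minus itself, up to a period for the third, and p
    is even and commutes with conjugation. *)
Lemma half_values_real : E1 = RtoC (Re E1) /\ E2 = RtoC (Re E2) /\ E3 = RtoC (Re E3).
Proof.
  destruct (not_lat_half a b Ha Hb) as [B1 [B2 B3]].
  repeat split; apply real_of_conj; rewrite <- weier_conj.
  - f_equal. apply C_eq; simpl; ring.
  - rewrite <- weier_even. f_equal. apply C_eq; simpl; ring.
  - rewrite <- weier_even.
    replace (- Cconj (half3 a b))%C with (half3 a b + lpoint a b (-1, 0)%Z)%C
      by (apply C_eq; unfold lpoint, half3; simpl; field).
    now apply weier_periodic.
Qed.

(** On the imaginary axis the signs reverse: -E2 is the largest root and -E1 the smallest. Hence D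
    is the same on both axes, while the two squared moduli add up to 1. *)
Lemma periods_from_values :
  Re E2 < Re E3 /\ Re E3 < Re E1 /\
  a / 2 * sqrt (Re E1 - Re E2) = ellK (sqrt ((Re E3 - Re E2) / (Re E1 - Re E2))) /\
  b / 2 * sqrt (Re E1 - Re E2) = ellK (sqrt ((Re E1 - Re E3) / (Re E1 - Re E2))).
Proof.
  destruct half_values_real as [R1 [R2 R3]].
  destruct (half_values_roots a b Ha Hb) as [N12 [N13 [N23 _]]].
  assert (Between : forall x t (n : Z), 0 < x -> 0 < t < x -> t <> IZR n * x).
  { intros x t n Hx Ht. replace t with ((IZR 0 + t / x) * x) by (simpl; field; lra).
    apply fraction_not_multiple; [exact Hx |].
    split; [apply Rdiv_lt_0_compat; lra | apply Rlt_div_l; lra]. }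
  assert (Lx : forall t, 0 < t <= a / 2 -> ~ lat (0 + RtoC t * 1)%C).
  { intros t Ht. apply not_lat_re. intros n. simpl.
    replace (0 + (t * 1 - 0 * 0)) with t by ring. apply Between; lra. }
  assert (Hx : forall t, 0 < t < a / 2 -> ~ halflat (0 + RtoC t * 1)%C).
  { intros t Ht. apply not_lat_re. intros n. simpl.
    match goal with |- ?l <> _ => replace l with (2 * t) by ring end. apply Between; lra. }
  assert (Ly : forall t, 0 < t <= b / 2 -> ~ lat (0 + RtoC t * Ci)%C).
  { intros t Ht. apply not_lat_im. intros n. simpl.
    match goal with |- ?l <> _ => replace l with t by ring end. apply Between; lra. }
  assert (Hy : forall t, 0 < t < b / 2 -> ~ halflat (0 + RtoC t * Ci)%C).
  { intros t Ht. apply not_lat_im. intros n. simpl.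
    match goal with |- ?l <> _ => replace l with (2 * t) by ring end. apply Between; lra. }
  assert (Ex : pe (0 + RtoC (a / 2) * 1)%C = E1)
    by (f_equal; apply C_eq; unfold half1; simpl; ring).
  assert (Ey : pe (0 + RtoC (b / 2) * Ci)%C = E2)
    by (f_equal; apply C_eq; unfold half2; simpl; ring).
  assert (Sq := weier'_sqr_factored a b Ha Hb).
  assert (Sq' : forall z, ~ lat z ->
    (pe' z ^ 2 = 4 * ((pe z - E2) * (pe z - E1) * (pe z - E3)))%C)
    by (intros z Hz; rewrite Sq by exact Hz; ring).
  assert (D1 : (1 * 1)%C = RtoC 1) by ring.
  assert (D2 : (Ci * Ci)%C = RtoC (-1)) by (apply C_eq; simpl; ring).
  assert (K1 : Cconj 1 = (RtoC 1 * 1)%C) by (apply C_eq; simpl; ring).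
  assert (K2 : Cconj Ci = (RtoC (-1) * Ci)%C) by (apply C_eq; simpl; ring).
  assert (O1 := axis_order 1 1 (a / 2) E1 E2 E3 (or_introl eq_refl) D1 K1 ltac:(lra)
    Lx Hx Ex Sq R1 R2 R3 N12 N13).
  assert (O2 := axis_order Ci (-1) (b / 2) E2 E1 E3 (or_intror eq_refl) D2 K2 ltac:(lra)
    Ly Hy Ey Sq' R2 R1 R3 (not_eq_sym N12) N23).
  assert (Q1 := axis_period 1 1 (a / 2) E1 E2 E3 (or_introl eq_refl) D1 K1 ltac:(lra)
    Lx Hx Ex Sq R1 R2 R3 N12 N13 ltac:(lra)).
  assert (Q2 := axis_period Ci (-1) (b / 2) E2 E1 E3 (or_intror eq_refl) D2 K2 ltac:(lra)
    Ly Hy Ey Sq' R2 R1 R3 (not_eq_sym N12) N23 ltac:(lra)).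
  split; [lra |]. split; [lra |]. split.
  - rewrite !Rmult_1_l in Q1. exact Q1.
  - replace (-1 * Re E2 - -1 * Re E1) with (Re E1 - Re E2) in Q2 by ring.
    replace (-1 * Re E3 - -1 * Re E1) with (Re E1 - Re E3) in Q2 by ring. exact Q2.
Qed.

End Axes.

(** * The null curve *)

Lemma csum_seq (f : nat -> C) (n : nat) : csum f (seq 0 (S n)) = sum_n f n.
Proof.
  induction n as [| n IH].
  - rewrite sum_O. simpl. ring.
  - rewrite seq_S, csum_app, IH, (sum_Sn (G := C_AbelianMonoid)). simpl.
    change (plus (sum_n f n) (f (S n))) with (sum_n f n + f (S n))%C. ring.
Qed.

Lemma csum_list_prod {A B} (f : A * B -> C) (l : list A) (m : list B) :
  csum f (list_prod l m) = csum (fun x => csum (fun y => f (x, y)) m) l.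
Proof.
  induction l as [| x l IH]; simpl; [reflexivity |].
  now rewrite csum_app, IH, csum_map.
Qed.

(** * From the given periods to the rectangular lattice *)

Section Modulus.
Variables (k : R).
Hypothesis (hk : 0 < k < 1).

Let a : R := 2 * sqrt (k * kc k) * ellK k.
Let b : R := 2 * sqrt (k * kc k) * ellK (kc k).

Lemma sqrt_kkc_pos : 0 < sqrt (k * kc k).
Proof. destruct (kc_range k hk). apply sqrt_lt_R0. nra. Qed.

Lemma period_a_pos : 0 < a.
Proof. pose proof sqrt_kkc_pos. pose proof (ellK_pos k hk). unfold a. nra. Qed.

Lemma period_b_pos : 0 < b.
Proof.
  pose proof sqrt_kkc_pos. destruct (kc_range k hk) as [Hc _].
  pose proof (ellK_pos (kc k) Hc). unfold b. nra.
Qed.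

Lemma period_combination (m n : Z) :
  (RtoC (IZR m) * omega1 k + RtoC (IZR n) * omega2 k)%C = lpoint a b (m, n).
Proof. apply C_eq; unfold omega1, omega2, lpoint, a, b; simpl; ring. Qed.

Lemma in_lattice_lat (z : C) : in_lattice (omega1 k) (omega2 k) z <-> in_lat a b z.
Proof.
  split.
  - intros [m [n E]]. exists (m, n). now rewrite <- period_combination.
  - intros [[m n] E]. exists m, n. now rewrite period_combination.
Qed.

(** [wp] sets the term of the zero period to 0 and adds the pole separately, whereas [weier_term]
    carries the pole as its term at the origin. *)
Lemma wp_box_csum (z : C) (N : nat) :
  wp_box (omega1 k) (omega2 k) z N = (csum (weier_term a b z) (box N) - / z ^ 2)%C.
Proof.
  assert (E : wp_box (omega1 k) (omega2 k) z N =
    csum (fun v => wp_term (omega1 k) (omega2 k) z (fst v) (snd v)) (box N)).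
  { unfold wp_box, box. rewrite csum_list_prod. unfold zrange. rewrite csum_map, csum_seq.
    apply sum_n_ext. intros i. now rewrite csum_map, csum_seq. }
  rewrite E.
  enough (X : csum (fun v => weier_term a b z v - wp_term (omega1 k) (omega2 k) z (fst v) (snd v))%C (box N)
              = (/ z ^ 2)%C).
  { rewrite csum_minus in X. rewrite <- X. ring. }
  rewrite (csum_single _ (0, 0)%Z _ (NoDup_box N)).
  - unfold weier_term, wp_term. simpl fst. simpl snd. rewrite lpoint_0, (Cpow_inv_C 0), Cinv_0. simpl.
    replace (z - 0)%C with z by ring. ring.
  - apply in_box. unfold nz; simpl; lia.
  - intros [m n] _ Nv. unfold weier_term, wp_term. simpl fst. simpl snd.
    destruct (Z.eqb_spec m 0) as [-> | Nm]; [destruct (Z.eqb_spec n 0) as [-> | Nn] |];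
      [contradiction | |]; simpl andb; cbv iota zeta; rewrite period_combination; ring.
Qed.

Lemma wpk_eq (z : C) : ~ in_lat a b z -> wpk k z = weier a b z.
Proof.
  intros N. unfold wpk, wp.
  assert (X := cvg_minus eventually _ _ _ _ (weier_term_cvg a b period_a_pos period_b_pos z N)
                 (cvg_const eventually (/ z ^ 2)%C)).
  assert (Y : cvg eventually (fun N => wp_box (omega1 k) (omega2 k) z N) (weier a b z - / z ^ 2)%C).
  { refine (cvg_ext eventually _ _ _ _ X). apply filter_forall. intros n.
    now rewrite wp_box_csum. }
  destruct Y as [Y1 Y2].
  rewrite (is_lim_seq_unique _ (Finite _) Y1), (is_lim_seq_unique _ (Finite _) Y2).
  cbn [real]. apply C_eq; unfold Re, Im; simpl; ring.
Qed.

Lemma half_periods : (omega1 k / 2)%C = half1 a /\ (omega2 k / 2)%C = half2 b /\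
  (omega3 k / 2)%C = half3 a b.
Proof.
  repeat split; apply C_eq; unfold omega3, omega1, omega2, half1, half2, half3, a, b; simpl; field.
Qed.

Lemma e_weier : e1 k = weier a b (half1 a) /\ e2 k = weier a b (half2 b) /\ e3 k = weier a b (half3 a b).
Proof.
  destruct (not_lat_half a b period_a_pos period_b_pos) as [B1 [B2 B3]].
  destruct half_periods as [E1 [E2 E3]].
  unfold e1, e2, e3. rewrite E1, E2, E3. repeat split; now apply wpk_eq.
Qed.

(** The factor 2 sqrt(k kc) in the periods is the normalization for which e1 - e2 = 1/(k kc); the
    two period equations then yield the differences, once their ratio has fixed the modulus. *)
Lemma e_differences :
  (e1 k - e3 k)%C = (RtoC (kc k) / RtoC k)%C /\ (e3 k - e2 k)%C = (RtoC k / RtoC (kc k))%C /\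
  (e1 k + e2 k + e3 k)%C = 0%C.
Proof.
  destruct e_weier as [-> [-> ->]]. destruct (kc_range k hk) as [Hc _].
  destruct (periods_from_values a b period_a_pos period_b_pos) as [H23 [H31 [Q1 Q2]]].
  destruct (half_values_real a b period_a_pos period_b_pos) as [R1 [R2 R3]].
  destruct (half_values_roots a b period_a_pos period_b_pos) as [_ [_ [_ [S _]]]].
  destruct (modulus_unique k _ _ _ hk H23 H31) as [M1 M2].
  - rewrite <- Q1. unfold a. field.
  - rewrite <- Q2. unfold b. field.
  - split; [| split; [| exact S]].
    + rewrite R1, R3, <- RtoC_minus, M1, RtoC_div; [reflexivity | lra].
    + rewrite R3, R2, <- RtoC_minus, M2, RtoC_div; [reflexivity | lra].
Qed.

Section Point.
Variable (u : C).
Hypothesis (hu : ~ in_halflat a b u).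

Lemma hasd_wpk (z : C) : ~ in_lat a b z -> hasd (wpk k) z (weier' a b z).
Proof.
  intros N. apply (hasd_ext_loc (weier a b)).
  - symmetry. now apply wpk_eq.
  - refine (filter_imp _ _ _ (not_lat_at0 a b period_a_pos period_b_pos z N)).
    intros h Nh. symmetry. now apply wpk_eq.
  - apply hasd_weier; auto using period_a_pos, period_b_pos.
Qed.

Lemma hasd_gk (z : C) : ~ in_lat a b z -> hasd (gk k) z (weier' a b z).
Proof.
  intros N. eapply hasd_eq; [apply hasd_minus; [now apply hasd_wpk | apply hasd_const] | ring].
Qed.

Lemma fk_eq (z : C) : ~ in_lat a b z -> fk k z = (omega1 k / 4 * weier' a b z)%C.
Proof. intros N. unfold fk. now rewrite (hasd_C_derive _ _ _ (hasd_wpk z N)). Qed.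

Lemma hasd_fk (z : C) : ~ in_lat a b z ->
  hasd (fk k) z (omega1 k / 4 * (6 * weier a b z ^ 2 - invariant_g2 a b / 2))%C.
Proof.
  intros N. apply (hasd_ext_loc (fun z => omega1 k / 4 * weier' a b z)%C).
  - symmetry. now apply fk_eq.
  - refine (filter_imp _ _ _ (not_lat_at0 a b period_a_pos period_b_pos z N)).
    intros h Nh. symmetry. now apply fk_eq.
  - apply hasd_scal, hasd_weier'; auto using period_a_pos, period_b_pos.
Qed.

Lemma dd_eq (z : C) : ~ in_halflat a b z ->
  dd (fk k) (gk k) z = (omega1 k / 2 * kappa a b z)%C.
Proof.
  intros Hz. assert (N := not_halflat_lat a b z Hz).
  unfold dd. rewrite (hasd_C_derive _ _ _ (hasd_gk z N)), (hasd_C_derive _ _ _ (hasd_fk z N)).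
  unfold kappa. field. apply weier'_nonzero; auto using period_a_pos, period_b_pos.
Qed.

Lemma not_halflat_at0 (z : C) : ~ in_halflat a b z -> at0 (fun h => ~ in_halflat a b (z + h)%C).
Proof.
  intros Hz.
  refine (filter_imp _ _ _ (at0_double _ (not_lat_at0 a b period_a_pos period_b_pos (2 * z)%C Hz))).
  intros h. unfold in_halflat. now replace (2 * (z + h))%C with (2 * z + 2 * h)%C by ring.
Qed.

(** [dd] is differentiated once more, so its formula is needed on a whole neighbourhood of u; the
    complement of the half-lattice being open provides it. *)
Lemma dd2_eq :
  dd2 (fk k) (gk k) u =
  (omega1 k / 2 * (6 * weier a b u - 2 * kappa a b u ^ 2) / weier' a b u)%C.
Proof.
  assert (N := not_halflat_lat a b u hu).
  assert (D : hasd (dd (fk k) (gk k)) u (omega1 k / 2 * (6 * weier a b u - 2 * kappa a b u ^ 2))%C).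
  { apply (hasd_ext_loc (fun z => omega1 k / 2 * kappa a b z)%C).
    - symmetry. now apply dd_eq.
    - refine (filter_imp _ _ _ (not_halflat_at0 u hu)). intros h Nh. symmetry. now apply dd_eq.
    - apply hasd_scal, hasd_kappa; auto using period_a_pos, period_b_pos. }
  unfold dd2. unfold dd at 1.
  now rewrite (hasd_C_derive _ _ _ D), (hasd_C_derive _ _ _ (hasd_gk u N)).
Qed.

End Point.
End Modulus.

Lemma wp_root_double_k (k : R) (hk : 0 < k < 1) (f : C -> C) (e x2 x3 u : C) :
  let a := 2 * sqrt (k * kc k) * ellK k in
  let b := 2 * sqrt (k * kc k) * ellK (kc k) in
  is_wp_root k e f -> (forall u, ~ in_halflat a b u -> weier a b u <> e) ->
  (e + x2 + x3 = 0)%C -> (invariant_g2 a b = -4 * (e * x2 + x2 * x3 + x3 * e))%C ->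
  (invariant_g3 a b = 4 * e * x2 * x3)%C -> ~ in_halflat a b u ->
  f (2 * u)%C = (- ((weier a b u - e) ^ 2 - (e - x2) * (e - x3)) / weier' a b u)%C.
Proof.
  intros a b [_ [Hf Hr]] He HS HG2 HG3 Hu.
  apply (wp_root_double a b (period_a_pos k hk) (period_b_pos k hk)); auto.
  intros z Nz. destruct (Hf z) as [D S].
  - intros L. apply Nz, (in_lattice_lat k), L.
  - split; [exact D |]. rewrite S. now rewrite wpk_eq.
Qed.

(* The identities are between meromorphic functions of u; both sides are
   regular exactly when 2 u is not a period. *)
Theorem theorem4p7 (k : R) (hk : 0 < k < 1) (f1 f2 f3 : C -> C)
    (hf1 : is_wp_root k (e1 k) f1)
    (hf2 : is_wp_root k (e2 k) f2)
    (hf3 : is_wp_root k (e3 k) f3)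
    (u : C) (hu : ~ in_lattice (omega1 k) (omega2 k) (2 * u)%C) :
  Phi1 k (gk k) (fk k) u = (- RtoC k * (omega1 k / 4) * f1 (2 * u) ^ 3)%C /\
  Phi2 k (gk k) (fk k) u = (RtoC (kc k) * (omega1 k / 4) * f2 (2 * u) ^ 3)%C /\
  Phi3 (gk k) (fk k) u = (- Ci * (omega1 k / 4) * f3 (2 * u) ^ 3)%C.
Proof.
  set (a := 2 * sqrt (k * kc k) * ellK k). set (b := 2 * sqrt (k * kc k) * ellK (kc k)).
  pose proof (period_a_pos k hk) as Ha. pose proof (period_b_pos k hk) as Hb. fold a in Ha. fold b in Hb.
  assert (Hu : ~ in_halflat a b u) by (intros L; apply hu, (in_lattice_lat k), L).
  pose proof (not_halflat_lat a b u Hu) as N.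
  destruct (kc_range k hk) as [Hc _].
  assert (Nk : RtoC k <> 0%C) by (intros E; apply RtoC_inj in E; lra).
  assert (Nc : RtoC (kc k) <> 0%C) by (intros E; apply RtoC_inj in E; lra).
  assert (NP := weier'_nonzero a b Ha Hb u Hu).
  destruct (e_weier k hk) as [E1 [E2 E3]]. fold a b in E1, E2, E3.
  destruct (half_values_roots a b Ha Hb) as [_ [_ [_ [S [G2 G3]]]]].
  rewrite <- E1, <- E2, <- E3 in S, G2, G3.
  assert (Y2 := weier'_sqr_factored a b Ha Hb u N).
  rewrite <- E1, <- E2, <- E3 in Y2.
  assert (Av := weier_avoids_half_values a b Ha Hb).
  assert (F1 : f1 (2 * u)%C =
    (- ((weier a b u - e1 k) ^ 2 - (e1 k - e2 k) * (e1 k - e3 k)) / weier' a b u)%C).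
  { apply (wp_root_double_k k hk); fold a b; auto.
    intros z Hz. rewrite E1. now apply Av. }
  assert (F2 : f2 (2 * u)%C =
    (- ((weier a b u - e2 k) ^ 2 - (e2 k - e1 k) * (e2 k - e3 k)) / weier' a b u)%C).
  { apply (wp_root_double_k k hk); fold a b; auto.
    - intros z Hz. rewrite E2. now apply Av.
    - rewrite <- S. ring.
    - rewrite G2. ring.
    - rewrite G3. ring. }
  assert (F3 : f3 (2 * u)%C =
    (- ((weier a b u - e3 k) ^ 2 - (e3 k - e1 k) * (e3 k - e2 k)) / weier' a b u)%C).
  { apply (wp_root_double_k k hk); fold a b; auto.
    - intros z Hz. rewrite E3. now apply Av.
    - rewrite <- S. ring.
    - rewrite G2. ring.
    - rewrite G3. ring. }
  destruct (e_differences k hk) as [D1 [D2 _]].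
  (* Since the e_j sum to 0, all three are combinations of their differences lam and mu, leaving g,
     lam and mu as the only quantities besides weier'. *)
  set (lam := (RtoC (kc k) / RtoC k)%C) in *. set (mu := (RtoC k / RtoC (kc k))%C) in *.
  assert (L1 : e1 k = (e3 k + lam)%C) by (rewrite <- D1; ring).
  assert (L2 : e2 k = (e3 k - mu)%C) by (rewrite <- D2; ring).
  assert (L3 : e3 k = ((mu - lam) / 3)%C).
  { replace (mu - lam)%C with (mu - lam + 0)%C by ring. rewrite <- S, L1, L2. field. }
  assert (Gk : gk k u = (weier a b u - e3 k)%C) by (unfold gk; rewrite (wpk_eq k hk); auto).
  assert (Dd := dd_eq k hk u Hu). assert (Dd2 := dd2_eq k hk u Hu). assert (Fk := fk_eq k hk u N).
  fold a b in Dd, Dd2, Fk.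
  set (g := gk k u) in *. set (y := weier' a b u) in *.
  assert (X : weier a b u = (g + (mu - lam) / 3)%C) by (rewrite Gk, L3; ring).
  rewrite L1, L2, L3, X in *. clear L1 L2.
  set (W := omega1 k) in *.
  set (Y := (4 * ((g - lam) * (g + mu) * g))%C).
  assert (HY : (y ^ 2 = Y)%C) by (rewrite Y2; unfold Y; ring).
  (* This is weier'' as a polynomial in g, namely half the derivative of Y with respect to g. *)
  set (m := (2 * ((g - lam) * (g + mu) + g * (g + mu) + g * (g - lam)))%C).
  assert (Hkap : kappa a b u = (m / (2 * y))%C).
  { unfold kappa. fold y. rewrite X, G2. unfold m. field. exact NP. }
  (* The cube of each f_j(2u) has denominator y^3. Bringing f and its two derivatives over the same
     odd power, with y^2 replaced by Y in the numerators, reduces each component to a polynomial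
     identity in g with coefficients rational in k and kc. *)
  assert (T0 : fk k u = (W * Y ^ 2 / (4 * y ^ 3))%C) by (rewrite Fk, <- HY; field; exact NP).
  assert (T1 : dd (fk k) (gk k) u = (W * m * Y / (4 * y ^ 3))%C)
    by (rewrite Dd, Hkap, <- HY; field; exact NP).
  assert (T2 : dd2 (fk k) (gk k) u = (W * (12 * (g + (mu - lam) / 3) * Y - m ^ 2) / (4 * y ^ 3))%C)
    by (rewrite Dd2, Hkap, <- HY; field; exact NP).
  unfold Phi1, Phi2, Phi3, Omega1, Omega2, Omega3. fold g.
  rewrite T0, T1, T2, F1, F2, F3. unfold Y, m, lam, mu.
  split; [| split]; field; auto.
Qed.
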